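(* Let $\mathfrak{h}$ be a Lie algebra over a field $\mathbb{k}$, let $H$ be a group, and let $\mathrm{A}:H\to\mathrm{Aut}(\mathfrak{h})$, $p\mapsto \mathrm{A}_p$, be a representation of $H$ on $\mathfrak{h}$ by Lie algebra automorphisms. Let $\mathcal{H}=(U(\mathfrak{h})\otimes\wedge(\mathfrak{h}^-))[H]$ be the space of finite sums of elements $(p,x)$ with $p\in H$ and $x\in U(\mathfrak{h})\otimes\wedge(\mathfrak{h}^-)$, linear in $x$. Then the following operations, extended linearly, define a filtered differential graded Hopf algebra structure on $\mathcal{H}$ with unit $(e,1\otimes1)$: for $p,q\in H$, $v,w\in U(\mathfrak{h})$, $\alpha,\beta\in\wedge(\mathfrak{h}^-)$, differential (for $\alpha=\alpha_0\wedge\cdots\wedge\alpha_k$, and $\partial=0$ in degree $0$): $$\partial(p,v\otimes\alpha)=\Big(p,\ \sum_{i=0}^k(-1)^i\,\mathrm{A}_p^{-1}(\alpha_i)\,v\otimes\alpha_0\wedge\cdots\hat{\alpha_i}\cdots\wedge\alpha_k+\sum_{i<j}(-1)^{i+j+1}v\otimes[\alpha_i,\alpha_j]\wedge\alpha_0\wedge\cdots\hat{\alpha_i}\cdots\hat{\alpha_j}\cdots\wedge\alpha_k\Big);$$ co-product: $\Delta(p,v\otimes\alpha)=(p,v_{(1)}\otimes\alpha_{(1)})\otimes(p,v_{(2)}\otimes\alpha_{(2)})$; co-unit: $\varepsilon(p,v\otimes\alpha)=\varepsilon(v)\varepsilon(\alpha)$; product: $(p,v\otimes\alpha)\ast(q,w\otimes\beta)=(pq,\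 \mathrm{A}_q^{-1}(v_{(1)})\,w\otimes\alpha\wedge\mathrm{A}_p[v_{(2)},\beta])$; antipode: $S(p,v\otimes\alpha)=(p^{-1},\ \mathrm{A}_p(S(v_{(1)}))\otimes[S(v_{(2)}),\mathrm{A}_p^{-1}S(\alpha)])$.
   Context: $\mathfrak{h}^-$ is $\mathfrak{h}$ with the negative of its Lie bracket; as a graded vector space $\wedge(\mathfrak{h}^-)=\wedge(\mathfrak{h})$. $U(\mathfrak{h})$ is the universal enveloping algebra with its usual Hopf algebra structure (elements of $\mathfrak{h}$ primitive) and filtration $U^r(\mathfrak h)$. $\wedge(\mathfrak{h}^-)$ is the graded Hopf algebra in which elements of $\mathfrak{h}$ are primitive of degree $1$; its antipode is $S(\alpha)=(-1)^k\alpha$ for $\alpha\in\wedge^k$. Sweedler notation is used for co-products in $U(\mathfrak{h})$ and $\wedge(\mathfrak{h}^-)$. $\mathrm{A}_p$ is extended to $U(\mathfrak{h})$ and $\wedge(\mathfrak{h}^-)$ by algebra automorphisms. $[\cdot,\cdot]$ denotes the bracket of $\mathfrak{h}$ and also its extension $[\cdot,\cdot]:U(\mathfrak{h})\times\wedge(\mathfrak{h}^-)\to\wedge(\mathfrak{h}^-)$: each $x\in\mathfrak{h}$ acts as the degree-zero derivation of $\wedge$ extending $y\mapsto[x,y]$, and this is extended to an algebra action of $U(\mathfrak{h})$ (so $[vw,\beta]=[v,[w,\beta]]$ and $[1,\beta]=\beta$). Grading and filtration: $\mathcal{H}_k^r$ is spanned by the $(p,v\otimes\alpha)$ with $v\in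 U^r(\mathfrak{h})$, $\alpha\in\wedge^k$. Filtered differential graded Hopf algebra: a graded vector space $\mathcal{H}=\bigoplus_{k\ge0}\mathcal{H}_k$ with increasing filtrations $\mathcal{H}_k=\bigcup_r\mathcal{H}_k^r$, together with a graded Hopf algebra structure (associative unital product, co-associative co-unital co-product, the co-product and co-unit being unital algebra maps where $\mathcal{H}\otimes\mathcal{H}$ has product $(x\otimes y)(x'\otimes y')=(-1)^{|y||x'|}xx'\otimes yy'$, and an antipode $S$ with $S(x_{(1)})x_{(2)}=x_{(1)}S(x_{(2)})=\varepsilon(x)1$), such that $\mathcal{H}_i^s\mathcal{H}_j^t\subseteq\mathcal{H}_{i+j}^{s+t}$, $\Delta(\mathcal{H}_k^r)\subseteq\bigoplus_{i+j=k}\sum_{s+t=r}\mathcal{H}_i^s\otimes\mathcal{H}_j^t$, $\varepsilon(\mathcal H_k)=0$ for $k>0$, $S(\mathcal{H}_k^r)\subseteq\mathcal{H}_k^r$; and a linear map $\partial$ with $\partial(\mathcal{H}_k^r)\subseteq\mathcal{H}_{k-1}^{r+1}$, $\partial^2=0$, $\partial(xy)=\partial(x)y+(-1)^{|x|}x\,\partial(y)$ and $\Delta\partial(x)=\partial x_{(1)}\otimes x_{(2)}+(-1)^{|x_{(1)}|}x_{(1)}\otimes\partial x_{(2)}$. *)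

(* Defs.v *)
From HB Require Import structures.
From mathcomp Require Import all_boot all_algebra.
From mathcomp Require Import generic_quotient boolp.

Set Implicit Arguments.
Unset Strict Implicit.
Unset Printing Implicit Defensive.

Import GRing.Theory.
Local Open Scope ring_scope.
Local Open Scope quotient_scope.

HB.mixin Record Lmodule_isLie (K : fieldType) (L : Type) of GRing.Lmodule K L := {
  lie : L -> L -> L;
  lie_linearl : forall (c : K) (x y z : L),
    lie (c *: x + y) z = c *: lie x z + lie y z;
  lie_linearr : forall (c : K) (x y z : L),
    lie z (c *: x + y) = c *: lie z x + lie z y;
  liexx : forall x, lie x x = 0;
  lie_jacobi : forall x y z,
    lie x (lie y z) + lie y (lie z x) + lie z (lie x y) = 0
}.

#[short(type="lieAlgType")]
HB.structure Definition LieAlgebra (K : fieldType) :=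
  {L of Lmodule_isLie K L & GRing.Lmodule K L}.

(* The K-vector space presented by the generators G and the relations
   t = u for R t u. *)
Inductive mterm (K G : Type) : Type :=
| MVar of G
| MZero
| MAdd of mterm K G & mterm K G
| MScale of K & mterm K G.
Arguments MVar {K G}.
Arguments MZero {K G}.

Section PresentedModule.
Variables (K : fieldType) (G : Type) (R : mterm K G -> mterm K G -> Prop).

Inductive mcong : mterm K G -> mterm K G -> Prop :=
| mc_rel t u : R t u -> mcong t u
| mc_refl t : mcong t t
| mc_sym t u : mcong t u -> mcong u t
| mc_trans t u w : mcong t u -> mcong u w -> mcong t w
| mc_add t t' u u' : mcong t t' -> mcong u u' -> mcong (MAdd t u) (MAdd t' u')
| mc_scale c t t' : mcong t t' -> mcong (MScale c t) (MScale c t')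
| mc_addA t u w : mcong (MAdd t (MAdd u w)) (MAdd (MAdd t u) w)
| mc_addC t u : mcong (MAdd t u) (MAdd u t)
| mc_add0 t : mcong (MAdd MZero t) t
| mc_scale0 t : mcong (MScale 0 t) MZero
| mc_scale1 t : mcong (MScale 1 t) t
| mc_scaleA a b t : mcong (MScale a (MScale b t)) (MScale (a * b) t)
| mc_scaleDr a t u :
    mcong (MScale a (MAdd t u)) (MAdd (MScale a t) (MScale a u))
| mc_scaleDl a b t :
    mcong (MScale (a + b) t) (MAdd (MScale a t) (MScale b t)).

HB.instance Definition _ := gen_eqMixin (mterm K G).
HB.instance Definition _ := gen_choiceMixin (mterm K G).

Definition meqv (t u : mterm K G) : bool := `[< mcong t u >].

Lemma meqv_refl : reflexive meqv.
Proof. by move=> t; apply/asboolP; apply: mc_refl. Qed.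
Lemma meqv_sym : symmetric meqv.
Proof. by move=> t u; apply/asboolP/asboolP; apply: mc_sym. Qed.
Lemma meqv_trans : transitive meqv.
Proof. by move=> u t w /asboolP h /asboolP h'; apply/asboolP/(mc_trans h h'). Qed.
Canonical meqv_equiv := EquivRel meqv meqv_refl meqv_sym meqv_trans.

Definition pmod : Type := {eq_quot meqv}.
HB.instance Definition _ := Choice.on pmod.

Definition pmod_pi (t : mterm K G) : pmod := \pi_{eq_quot meqv} t.
Definition pmod_repr (x : pmod) : mterm K G := repr (x : {eq_quot meqv}).

Lemma pmod_reprK x : pmod_pi (pmod_repr x) = x.
Proof. exact: reprK. Qed.
Lemma pmod_eqP t u : mcong t u <-> pmod_pi t = pmod_pi u.
Proof. by split=> [h|/eqmodP/asboolP//]; apply/eqmodP/asboolP. Qed.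
Lemma pmod_piK t : mcong (pmod_repr (pmod_pi t)) t.
Proof. by apply/pmod_eqP; rewrite pmod_reprK. Qed.

Definition pmod_zero := pmod_pi MZero.
Definition pmod_add x y := pmod_pi (MAdd (pmod_repr x) (pmod_repr y)).
Definition pmod_scale c x := pmod_pi (MScale c (pmod_repr x)).
Definition pmod_opp x := pmod_scale (-1) x.

Lemma pmod_addE t u : pmod_add (pmod_pi t) (pmod_pi u) = pmod_pi (MAdd t u).
Proof. by apply/pmod_eqP/mc_add; apply: pmod_piK. Qed.
Lemma pmod_scaleE c t : pmod_scale c (pmod_pi t) = pmod_pi (MScale c t).
Proof. by apply/pmod_eqP/mc_scale/pmod_piK. Qed.

Lemma pmod_addA : associative pmod_add.
Proof.
move=> x y z; rewrite -(pmod_reprK x) -(pmod_reprK y) -(pmod_reprK z) !pmod_addE.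
exact/pmod_eqP/mc_addA.
Qed.
Lemma pmod_addC : commutative pmod_add.
Proof. by move=> x y; apply/pmod_eqP/mc_addC. Qed.
Lemma pmod_add0 : left_id pmod_zero pmod_add.
Proof.
by move=> x; rewrite -(pmod_reprK x) pmod_addE; apply/pmod_eqP/mc_add0.
Qed.
Lemma pmod_scaleA a b x : pmod_scale a (pmod_scale b x) = pmod_scale (a * b) x.
Proof.
by rewrite -(pmod_reprK x) !pmod_scaleE; apply/pmod_eqP/mc_scaleA.
Qed.
Lemma pmod_scale1 : left_id 1 pmod_scale.
Proof.
by move=> x; rewrite -(pmod_reprK x) !pmod_scaleE; apply/pmod_eqP/mc_scale1.
Qed.
Lemma pmod_scaleDr : right_distributive pmod_scale pmod_add.
Proof.
move=> a x y; rewrite -(pmod_reprK x) -(pmod_reprK y).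
by rewrite !(pmod_addE, pmod_scaleE); apply/pmod_eqP/mc_scaleDr.
Qed.
Lemma pmod_scaleDl x : {morph pmod_scale^~ x : a b / a + b >-> pmod_add a b}.
Proof.
move=> a b /=; rewrite -(pmod_reprK x) !(pmod_addE, pmod_scaleE).
exact/pmod_eqP/mc_scaleDl.
Qed.
Lemma pmod_addN : left_inverse pmod_zero pmod_opp pmod_add.
Proof.
move=> x; rewrite /pmod_opp -{2}(pmod_scale1 x) -pmod_scaleDl addNr.
by rewrite -(pmod_reprK x) pmod_scaleE; apply/pmod_eqP/mc_scale0.
Qed.

HB.instance Definition _ :=
  GRing.isZmodule.Build pmod pmod_addA pmod_addC pmod_add0 pmod_addN.
HB.instance Definition _ := GRing.Zmodule_isLmodule.Build K pmod
  pmod_scaleA pmod_scale1 pmod_scaleDr pmod_scaleDl.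

Definition pmod_gen (g : G) : pmod := pmod_pi (MVar g).

Fixpoint meval (Z : lmodType K) (f : G -> Z) (t : mterm K G) : Z :=
  match t with
  | MVar g => f g
  | MZero => 0
  | MAdd t u => meval f t + meval f u
  | MScale c t => c *: meval f t
  end.

(* The linear map extending f, provided f respects the relations. *)
Definition pmod_lift (Z : lmodType K) (f : G -> Z) (x : pmod) : Z :=
  meval f (pmod_repr x).

Lemma meval_cong (Z : lmodType K) (f : G -> Z) :
  (forall t u, R t u -> meval f t = meval f u) ->
  forall t u, mcong t u -> meval f t = meval f u.
Proof.
move=> fR t u; elim=> //=.
- by move=> {}t {}u w _ -> _ ->.
- by move=> ? ? ? ? _ -> _ ->.
- by move=> ? ? ? _ ->.
- by move=> *; rewrite addrA.
- by move=> *; rewrite addrC.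
- by move=> *; rewrite add0r.
- by move=> *; rewrite scale0r.
- by move=> *; rewrite scale1r.
- by move=> *; rewrite scalerA.
- by move=> *; rewrite scalerDr.
- by move=> *; rewrite scalerDl.
Qed.

Section Lift.
Variables (Z : lmodType K) (f : G -> Z).
Hypothesis fR : forall t u, R t u -> meval f t = meval f u.

Lemma pmod_lift_gen g : pmod_lift f (pmod_gen g) = f g.
Proof. exact: (meval_cong fR (pmod_piK (MVar g))). Qed.

Lemma pmod_lift_linear : linear (pmod_lift f).
Proof.
move=> c x y; have := meval_cong fR (pmod_piK
  (MAdd (pmod_repr (c *: x)) (pmod_repr y))).
rewrite -[pmod_pi _]/(c *: x + y) /= => E; rewrite {1}/pmod_lift E.
congr (_ + _); exact: (meval_cong fR (pmod_piK (MScale c (pmod_repr x)))).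
Qed.
End Lift.

Lemma pmod_ind (P : pmod -> Prop) :
  P 0 -> (forall c x y, P x -> P y -> P (c *: x + y)) ->
  (forall g, P (pmod_gen g)) -> forall x, P x.
Proof.
move=> P0 PD Pg x; rewrite -(pmod_reprK x).
elim: (pmod_repr x) => [g||t Pt u Pu|c t Pt]; [exact: Pg|exact: P0| |].
- have -> : pmod_pi (MAdd t u) = 1 *: pmod_pi t + pmod_pi u.
    by rewrite scale1r -pmod_addE.
  exact: PD.
- have -> : pmod_pi (MScale c t) = c *: pmod_pi t + 0.
    by rewrite addr0 -pmod_scaleE.
  exact: PD.
Qed.

End PresentedModule.

(* The associative unital K-algebra presented by the generators X and the
   relations t = u for R t u; ASc c is the scalar c times the unit. *)
Inductive aterm (K X : Type) : Type :=
| AVar of X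
| ASc of K
| AAdd of aterm K X & aterm K X
| AMul of aterm K X & aterm K X.
Arguments AVar {K X}.
Arguments ASc {K X}.

Section PresentedAlgebra.
Variables (K : fieldType) (X : Type) (R : aterm K X -> aterm K X -> Prop).

Inductive acong : aterm K X -> aterm K X -> Prop :=
| ac_rel t u : R t u -> acong t u
| ac_refl t : acong t t
| ac_sym t u : acong t u -> acong u t
| ac_trans t u w : acong t u -> acong u w -> acong t w
| ac_add t t' u u' : acong t t' -> acong u u' -> acong (AAdd t u) (AAdd t' u')
| ac_mul t t' u u' : acong t t' -> acong u u' -> acong (AMul t u) (AMul t' u')
| ac_addA t u w : acong (AAdd t (AAdd u w)) (AAdd (AAdd t u) w)
| ac_addC t u : acong (AAdd t u) (AAdd u t)
| ac_add0 t : acong (AAdd (ASc 0) t) t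
| ac_mulA t u w : acong (AMul t (AMul u w)) (AMul (AMul t u) w)
| ac_mul1 t : acong (AMul (ASc 1) t) t
| ac_mul0 t : acong (AMul (ASc 0) t) (ASc 0)
| ac_mulDl t u w : acong (AMul (AAdd t u) w) (AAdd (AMul t w) (AMul u w))
| ac_mulDr t u w : acong (AMul t (AAdd u w)) (AAdd (AMul t u) (AMul t w))
| ac_scC c t : acong (AMul (ASc c) t) (AMul t (ASc c))
| ac_scD a b : acong (ASc (a + b)) (AAdd (ASc a) (ASc b))
| ac_scM a b : acong (ASc (a * b)) (AMul (ASc a) (ASc b)).

HB.instance Definition _ := gen_eqMixin (aterm K X).
HB.instance Definition _ := gen_choiceMixin (aterm K X).

Definition aeqv (t u : aterm K X) : bool := `[< acong t u >].

Lemma aeqv_refl : reflexive aeqv.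
Proof. by move=> t; apply/asboolP; apply: ac_refl. Qed.
Lemma aeqv_sym : symmetric aeqv.
Proof. by move=> t u; apply/asboolP/asboolP; apply: ac_sym. Qed.
Lemma aeqv_trans : transitive aeqv.
Proof. by move=> u t w /asboolP h /asboolP h'; apply/asboolP/(ac_trans h h'). Qed.
Canonical aeqv_equiv := EquivRel aeqv aeqv_refl aeqv_sym aeqv_trans.

Definition palg : Type := {eq_quot aeqv}.
HB.instance Definition _ := Choice.on palg.

Definition palg_pi (t : aterm K X) : palg := \pi_{eq_quot aeqv} t.
Definition palg_repr (x : palg) : aterm K X := repr (x : {eq_quot aeqv}).

Lemma palg_reprK x : palg_pi (palg_repr x) = x.
Proof. exact: reprK. Qed.
Lemma palg_eqP t u : acong t u <-> palg_pi t = palg_pi u.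
Proof. by split=> [h|/eqmodP/asboolP//]; apply/eqmodP/asboolP. Qed.
Lemma palg_piK t : acong (palg_repr (palg_pi t)) t.
Proof. by apply/palg_eqP; rewrite palg_reprK. Qed.

Definition palg_sc c := palg_pi (ASc c).
Definition palg_add x y := palg_pi (AAdd (palg_repr x) (palg_repr y)).
Definition palg_mul x y := palg_pi (AMul (palg_repr x) (palg_repr y)).
Definition palg_scale c x := palg_mul (palg_sc c) x.
Definition palg_opp x := palg_scale (-1) x.

Lemma palg_addE t u : palg_add (palg_pi t) (palg_pi u) = palg_pi (AAdd t u).
Proof. by apply/palg_eqP/ac_add; apply: palg_piK. Qed.
Lemma palg_mulE t u : palg_mul (palg_pi t) (palg_pi u) = palg_pi (AMul t u).
Proof. by apply/palg_eqP/ac_mul; apply: palg_piK. Qed.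

Lemma palg_addA : associative palg_add.
Proof.
move=> x y z; rewrite -(palg_reprK x) -(palg_reprK y) -(palg_reprK z) !palg_addE.
exact/palg_eqP/ac_addA.
Qed.
Lemma palg_addC : commutative palg_add.
Proof. by move=> x y; apply/palg_eqP/ac_addC. Qed.
Lemma palg_add0 : left_id (palg_sc 0) palg_add.
Proof.
by move=> x; rewrite -(palg_reprK x) palg_addE; apply/palg_eqP/ac_add0.
Qed.
Lemma palg_mulA : associative palg_mul.
Proof.
move=> x y z; rewrite -(palg_reprK x) -(palg_reprK y) -(palg_reprK z) !palg_mulE.
exact/palg_eqP/ac_mulA.
Qed.
Lemma palg_mul1l : left_id (palg_sc 1) palg_mul.
Proof.
by move=> x; rewrite -(palg_reprK x) palg_mulE; apply/palg_eqP/ac_mul1.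
Qed.
Lemma palg_scC c x : palg_mul (palg_sc c) x = palg_mul x (palg_sc c).
Proof.
by rewrite -(palg_reprK x) !palg_mulE; apply/palg_eqP/ac_scC.
Qed.
Lemma palg_mul1r : right_id (palg_sc 1) palg_mul.
Proof. by move=> x; rewrite -palg_scC palg_mul1l. Qed.
Lemma palg_mulDl : left_distributive palg_mul palg_add.
Proof.
move=> x y z; rewrite -(palg_reprK x) -(palg_reprK y) -(palg_reprK z).
by rewrite !(palg_addE, palg_mulE); apply/palg_eqP/ac_mulDl.
Qed.
Lemma palg_mulDr : right_distributive palg_mul palg_add.
Proof.
move=> x y z; rewrite -(palg_reprK x) -(palg_reprK y) -(palg_reprK z).
by rewrite !(palg_addE, palg_mulE); apply/palg_eqP/ac_mulDr.
Qed.
Lemma palg_scD a b : palg_sc (a + b) = palg_add (palg_sc a) (palg_sc b).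
Proof. by rewrite palg_addE; apply/palg_eqP/ac_scD. Qed.
Lemma palg_scM a b : palg_sc (a * b) = palg_mul (palg_sc a) (palg_sc b).
Proof. by rewrite palg_mulE; apply/palg_eqP/ac_scM. Qed.
Lemma palg_addN : left_inverse (palg_sc 0) palg_opp palg_add.
Proof.
move=> x; rewrite /palg_opp /palg_scale -{2}(palg_mul1l x) -palg_mulDl -palg_scD.
by rewrite addNr -(palg_reprK x) palg_mulE; apply/palg_eqP/ac_mul0.
Qed.

HB.instance Definition _ :=
  GRing.isZmodule.Build palg palg_addA palg_addC palg_add0 palg_addN.
HB.instance Definition _ := GRing.Zmodule_isPzRing.Build palg
  palg_mulA palg_mul1l palg_mul1r palg_mulDl palg_mulDr.

Lemma palg_scaleA a b x : palg_scale a (palg_scale b x) = palg_scale (a * b) x.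
Proof. by rewrite /palg_scale palg_scM palg_mulA. Qed.
Lemma palg_scale1 : left_id 1 palg_scale.
Proof. exact: palg_mul1l. Qed.
Lemma palg_scaleDr : right_distributive palg_scale (@GRing.add palg).
Proof. by move=> a x y; apply: palg_mulDr. Qed.
Lemma palg_scaleDl x : {morph palg_scale^~ x : a b / a + b}.
Proof. by move=> a b; rewrite /palg_scale palg_scD palg_mulDl. Qed.

HB.instance Definition _ := GRing.Zmodule_isLmodule.Build K palg
  palg_scaleA palg_scale1 palg_scaleDr palg_scaleDl.

Lemma palg_scalerAl c (x y : palg) : c *: (x * y) = (c *: x) * y.
Proof. exact: palg_mulA. Qed.
Lemma palg_scalerAr c (x y : palg) : c *: (x * y) = x * (c *: y).
Proof.
rewrite [LHS]palg_mulA [palg_mul _ x]palg_scC.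
by rewrite -[RHS]/(palg_mul x (palg_mul _ y)) palg_mulA.
Qed.

Definition palg_gen (x : X) : palg := palg_pi (AVar x).

Fixpoint aeval (B : pzRingType) (s : K -> B) (f : X -> B) (t : aterm K X) : B :=
  match t with
  | AVar x => f x
  | ASc c => s c
  | AAdd t u => aeval s f t + aeval s f u
  | AMul t u => aeval s f t * aeval s f u
  end.

(* The algebra map extending f to the ring B with structure map s : K -> B,
   provided s is a central ring map and f respects the relations. *)
Definition palg_lift (B : pzRingType) (s : K -> B) (f : X -> B) (x : palg) : B :=
  aeval s f (palg_repr x).

Record central_map (B : pzRingType) (s : K -> B) : Prop := CentralMap {
  central0 : s 0 = 0;
  central1 : s 1 = 1;
  centralD : {morph s : a b / a + b};
  centralM : {morph s : a b / a * b};
  centralC : forall c b, s c * b = b * s c }.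

Section Lift.
Variables (B : pzRingType) (s : K -> B) (f : X -> B).
Hypothesis sP : central_map s.
Hypothesis fR : forall t u, R t u -> aeval s f t = aeval s f u.

Lemma aeval_cong t u : acong t u -> aeval s f t = aeval s f u.
Proof.
case: sP => s0 s1 sD sM sC; elim=> //=.
- by move=> {}t {}u w _ -> _ ->.
- by move=> ? ? ? ? _ -> _ ->.
- by move=> ? ? ? ? _ -> _ ->.
- by move=> *; rewrite addrA.
- by move=> *; rewrite addrC.
- by move=> *; rewrite s0 add0r.
- by move=> *; rewrite mulrA.
- by move=> *; rewrite s1 mul1r.
- by move=> *; rewrite s0 mul0r.
- by move=> *; rewrite mulrDl.
- by move=> *; rewrite mulrDr.
Qed.

Lemma palg_lift_gen x : palg_lift s f (palg_gen x) = f x.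
Proof. exact: (aeval_cong (palg_piK (AVar x))). Qed.
Lemma palg_liftD x y : palg_lift s f (x + y) = palg_lift s f x + palg_lift s f y.
Proof. exact: (aeval_cong (palg_piK (AAdd (palg_repr x) (palg_repr y)))). Qed.
Lemma palg_liftM x y : palg_lift s f (x * y) = palg_lift s f x * palg_lift s f y.
Proof. exact: (aeval_cong (palg_piK (AMul (palg_repr x) (palg_repr y)))). Qed.
Lemma palg_lift_sc c : palg_lift s f (palg_sc c) = s c.
Proof. exact: (aeval_cong (palg_piK (ASc c))). Qed.
Lemma palg_lift1 : palg_lift s f 1 = 1.
Proof. by rewrite (palg_lift_sc 1) central1. Qed.
Lemma palg_liftZ c x : palg_lift s f (c *: x) = s c * palg_lift s f x.
Proof. by rewrite [c *: x]/(palg_sc c * x) palg_liftM palg_lift_sc. Qed.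
End Lift.

Lemma palg_scE c : palg_sc c = c *: (1 : palg).
Proof. by rewrite -[RHS]/(palg_sc c * 1) mulr1. Qed.

Lemma palg_ind (P : palg -> Prop) :
  (forall c, P (c *: (1 : palg))) -> (forall x y, P x -> P y -> P (x + y)) ->
  (forall x y, P x -> P y -> P (x * y)) ->
  (forall x, P (palg_gen x)) -> forall x, P x.
Proof.
move=> P0 PD PM Pg x; rewrite -(palg_reprK x).
elim: (palg_repr x) => [g|c|t Pt u Pu|t Pt u Pu].
- exact: Pg.
- by rewrite -[palg_pi _]/(palg_sc c) palg_scE; apply: P0.
- by rewrite -palg_addE; apply: PD.
- by rewrite -palg_mulE; apply: PM.
Qed.

End PresentedAlgebra.

Inductive tensor_rel (K : fieldType) (V W : lmodType K) :
    mterm K (V * W) -> mterm K (V * W) -> Prop :=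
| TensorL c v v' w : tensor_rel (MVar (c *: v + v', w))
    (MAdd (MScale c (MVar (v, w))) (MVar (v', w)))
| TensorR c v w w' : tensor_rel (MVar (v, c *: w + w'))
    (MAdd (MScale c (MVar (v, w))) (MVar (v, w'))).

Definition tensor (K : fieldType) (V W : lmodType K) : Type :=
  pmod (@tensor_rel K V W).
HB.instance Definition _ (K : fieldType) (V W : lmodType K) :=
  GRing.Lmodule.on (tensor V W).

Definition tpure (K : fieldType) (V W : lmodType K) (v : V) (w : W) : tensor V W :=
  pmod_gen (@tensor_rel K V W) (v, w).

Notation "v ⊗ w" := (tpure v w) (at level 40, left associativity) : ring_scope.

(* The linear map v ⊗ w |-> f v w, for f bilinear.  Applied to a coproduct it
   renders Sweedler notation: the sum of the f v_(1) v_(2) is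
   tlift f (Delta v). *)
Definition tlift (K : fieldType) (V W Z : lmodType K) (f : V -> W -> Z)
    (x : tensor V W) : Z :=
  pmod_lift (fun g => f g.1 g.2) x.

Definition bilinear (K : fieldType) (V W Z : lmodType K) (f : V -> W -> Z) : Prop :=
  (forall w, linear (f^~ w)) /\ (forall v, linear (f v)).

Section TensorTheory.
Variables (K : fieldType) (V W : lmodType K).

Lemma tpure_bilinear : bilinear (@tpure K V W).
Proof.
split=> [w c v v'|v c w w'].
- transitivity (pmod_pi (@tensor_rel K V W)
    (MAdd (MScale c (MVar (v, w))) (MVar (v', w)))); last first.
    by rewrite -pmod_addE -pmod_scaleE.
  by apply/pmod_eqP; apply: mc_rel; apply: TensorL.
- transitivity (pmod_pi (@tensor_rel K V W)
    (MAdd (MScale c (MVar (v, w))) (MVar (v, w')))); last first.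
    by rewrite -pmod_addE -pmod_scaleE.
  by apply/pmod_eqP; apply: mc_rel; apply: TensorR.
Qed.

Lemma tlift_rel (Z : lmodType K) (f : V -> W -> Z) : bilinear f ->
  forall t u, tensor_rel t u ->
    meval (fun g => f g.1 g.2) t = meval (fun g => f g.1 g.2) u.
Proof. by move=> [fl fr] t u [c v v' w|c v w w'] /=; rewrite ?fl ?fr. Qed.

Lemma tliftE (Z : lmodType K) (f : V -> W -> Z) v w :
  bilinear f -> tlift f (v ⊗ w) = f v w.
Proof. by move=> /tlift_rel fP; apply: pmod_lift_gen. Qed.

Lemma tlift_linear (Z : lmodType K) (f : V -> W -> Z) :
  bilinear f -> linear (tlift f).
Proof. by move=> /tlift_rel fP; apply: pmod_lift_linear. Qed.

Lemma tensor_ind (P : tensor V W -> Prop) :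
  P 0 -> (forall c x y, P x -> P y -> P (c *: x + y)) ->
  (forall v w, P (v ⊗ w)) -> forall x, P x.
Proof. by move=> P0 PD Pg; apply: pmod_ind => // -[v w]; apply: Pg. Qed.
End TensorTheory.

Definition tmap (K : fieldType) (V V' W W' : lmodType K)
    (f : V -> V') (g : W -> W') : tensor V W -> tensor V' W' :=
  tlift (fun v w => f v ⊗ g w).

Definition tassoc (K : fieldType) (V W Z : lmodType K) :
    tensor (tensor V W) Z -> tensor V (tensor W Z) :=
  tlift (fun t z => tlift (fun v w => v ⊗ (w ⊗ z)) t).

(* V[H]: finite sums of elements (p, x) with p in H and x in V, linear in x. *)
Inductive gsum_rel (K : fieldType) (H : Type) (V : lmodType K) :
    mterm K (H * V) -> mterm K (H * V) -> Prop :=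
| GSumRel p c x y : gsum_rel (MVar (p, c *: x + y))
    (MAdd (MScale c (MVar (p, x))) (MVar (p, y))).

Definition gsum (K : fieldType) (H : Type) (V : lmodType K) : Type :=
  pmod (@gsum_rel K H V).
HB.instance Definition _ (K : fieldType) (H : Type) (V : lmodType K) :=
  GRing.Lmodule.on (gsum H V).

Definition gpure (K : fieldType) (H : Type) (V : lmodType K) (p : H) (x : V) :
    gsum H V :=
  pmod_gen (@gsum_rel K H V) (p, x).

Definition glift (K : fieldType) (H : Type) (V Z : lmodType K)
    (f : H -> V -> Z) (x : gsum H V) : Z :=
  pmod_lift (fun g => f g.1 g.2) x.

Section GsumTheory.
Variables (K : fieldType) (H : Type) (V : lmodType K).

Lemma gpure_linear (p : H) : linear (@gpure K H V p).
Proof.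
move=> c x y; transitivity (pmod_pi (@gsum_rel K H V)
  (MAdd (MScale c (MVar (p, x))) (MVar (p, y)))); last first.
  by rewrite -pmod_addE -pmod_scaleE.
by apply/pmod_eqP; apply: mc_rel; apply: GSumRel.
Qed.

Lemma glift_rel (Z : lmodType K) (f : H -> V -> Z) : (forall p, linear (f p)) ->
  forall t u, gsum_rel t u ->
    meval (fun g => f g.1 g.2) t = meval (fun g => f g.1 g.2) u.
Proof. by move=> fl t u [p c x y] /=; rewrite fl. Qed.

Lemma gliftE (Z : lmodType K) (f : H -> V -> Z) p x :
  (forall p, linear (f p)) -> glift f (gpure p x) = f p x.
Proof. by move=> /glift_rel fP; apply: pmod_lift_gen. Qed.

Lemma glift_linear (Z : lmodType K) (f : H -> V -> Z) :
  (forall p, linear (f p)) -> linear (glift f).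
Proof. by move=> /glift_rel fP; apply: pmod_lift_linear. Qed.

Lemma gsum_ind (P : gsum H V -> Prop) :
  P 0 -> (forall c x y, P x -> P y -> P (c *: x + y)) ->
  (forall p x, P (gpure p x)) -> forall x, P x.
Proof. by move=> P0 PD Pg; apply: pmod_ind => // -[p x]; apply: Pg. Qed.
End GsumTheory.

(* U(h): the free algebra on the set h modulo linearity of h -> U(h) and
   xy = yx + [x, y]. *)
Inductive uea_rel (K : fieldType) (h : lieAlgType K) :
    aterm K h -> aterm K h -> Prop :=
| UeaLin c x y : uea_rel (AVar (c *: x + y))
    (AAdd (AMul (ASc c) (AVar x)) (AVar y))
| UeaLie x y : uea_rel (AMul (AVar x) (AVar y))
    (AAdd (AMul (AVar y) (AVar x)) (AVar (lie x y))).

Definition uea (K : fieldType) (h : lieAlgType K) : Type := palg (@uea_rel K h).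

(* /\(h): the free algebra on the set h modulo linearity of h -> /\(h) and
   x ^ x = 0, the exterior product being the product of ext h.  As the bracket
   does not occur, this is also /\(h^-). *)
Inductive ext_rel (K : fieldType) (h : lieAlgType K) :
    aterm K h -> aterm K h -> Prop :=
| ExtLin c x y : ext_rel (AVar (c *: x + y))
    (AAdd (AMul (ASc c) (AVar x)) (AVar y))
| ExtSq x : ext_rel (AMul (AVar x) (AVar x)) (ASc 0).

Definition ext (K : fieldType) (h : lieAlgType K) : Type := palg (@ext_rel K h).

Lemma idfun_central (K : fieldType) : central_map (@id K).
Proof. by split=> // a b; rewrite mulrC. Qed.

Section UeaExt.
Variables (K : fieldType) (h : lieAlgType K).

HB.instance Definition _ := GRing.PzRing.on (uea h).
HB.instance Definition _ := GRing.Lmodule.on (uea h).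
HB.instance Definition _ := GRing.PzRing.on (ext h).
HB.instance Definition _ := GRing.Lmodule.on (ext h).

Definition uea_gen (x : h) : uea h := palg_gen (@uea_rel K h) x.
Definition ext_gen (x : h) : ext h := palg_gen (@ext_rel K h) x.

Definition uea_counit : uea h -> K := palg_lift (@id K) (fun=> 0).
Definition ext_counit : ext h -> K := palg_lift (@id K) (fun=> 0).

Lemma uea_counit_rel t u : @uea_rel K h t u ->
  aeval (@id K) (fun=> 0) t = aeval (@id K) (fun=> 0) u.
Proof. by case=> [c x y|x y] /=; rewrite !(mulr0, addr0). Qed.
Lemma ext_counit_rel t u : @ext_rel K h t u ->
  aeval (@id K) (fun=> 0) t = aeval (@id K) (fun=> 0) u.
Proof. by case=> [c x y|x] /=; rewrite !(mulr0, addr0). Qed.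

Lemma uea_counit_gen x : uea_counit (uea_gen x) = 0.
Proof. exact: (palg_lift_gen (@idfun_central K) uea_counit_rel). Qed.
Lemma uea_counit1 : uea_counit 1 = 1.
Proof. exact: (palg_lift1 (@idfun_central K) uea_counit_rel). Qed.
Lemma uea_counitM : {morph uea_counit : v w / v * w}.
Proof. exact: (palg_liftM (@idfun_central K) uea_counit_rel). Qed.
Lemma uea_counit_linear : scalar uea_counit.
Proof.
move=> c v w; rewrite /uea_counit (palg_liftD (@idfun_central K) uea_counit_rel).
by rewrite (palg_liftZ (@idfun_central K) uea_counit_rel).
Qed.

Lemma ext_counit_gen x : ext_counit (ext_gen x) = 0.
Proof. exact: (palg_lift_gen (@idfun_central K) ext_counit_rel). Qed.
Lemma ext_counit1 : ext_counit 1 = 1.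
Proof. exact: (palg_lift1 (@idfun_central K) ext_counit_rel). Qed.
Lemma ext_counitM : {morph ext_counit : v w / v * w}.
Proof. exact: (palg_liftM (@idfun_central K) ext_counit_rel). Qed.
Lemma ext_counit_linear : scalar ext_counit.
Proof.
move=> c v w; rewrite /ext_counit (palg_liftD (@idfun_central K) ext_counit_rel).
by rewrite (palg_liftZ (@idfun_central K) ext_counit_rel).
Qed.

Lemma uea_neq0 : (1 : uea h) != 0.
Proof.
apply/eqP => E; have := uea_counit1; rewrite E.
rewrite /uea_counit -[0 : uea h](scale0r (1 : uea h)).
rewrite (palg_liftZ (@idfun_central K) uea_counit_rel) mul0r => /eqP.
by rewrite eq_sym oner_eq0.
Qed.
Lemma ext_neq0 : (1 : ext h) != 0.
Proof.
apply/eqP => E; have := ext_counit1; rewrite E.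
rewrite /ext_counit -[0 : ext h](scale0r (1 : ext h)).
rewrite (palg_liftZ (@idfun_central K) ext_counit_rel) mul0r => /eqP.
by rewrite eq_sym oner_eq0.
Qed.

HB.instance Definition _ := GRing.PzSemiRing_isNonZero.Build (uea h) uea_neq0.
HB.instance Definition _ := GRing.Lmodule_isLalgebra.Build K (uea h)
  (@palg_scalerAl K h (@uea_rel K h)).
HB.instance Definition _ := GRing.Lalgebra_isAlgebra.Build K (uea h)
  (@palg_scalerAr K h (@uea_rel K h)).
HB.instance Definition _ := GRing.PzSemiRing_isNonZero.Build (ext h) ext_neq0.
HB.instance Definition _ := GRing.Lmodule_isLalgebra.Build K (ext h)
  (@palg_scalerAl K h (@ext_rel K h)).
HB.instance Definition _ := GRing.Lalgebra_isAlgebra.Build K (ext h)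
  (@palg_scalerAr K h (@ext_rel K h)).

Lemma uea_gen_linear : linear uea_gen.
Proof.
move=> c x y; transitivity (palg_pi (@uea_rel K h)
  (AAdd (AMul (ASc c) (AVar x)) (AVar y))); last first.
  by rewrite -palg_addE -palg_mulE.
by apply/palg_eqP; apply: ac_rel; apply: UeaLin.
Qed.
Lemma uea_genM x y :
  uea_gen x * uea_gen y = uea_gen y * uea_gen x + uea_gen (lie x y).
Proof.
transitivity (palg_pi (@uea_rel K h) (AMul (AVar x) (AVar y))).
  by rewrite -palg_mulE.
transitivity (palg_pi (@uea_rel K h)
  (AAdd (AMul (AVar y) (AVar x)) (AVar (lie x y)))).
  by apply/palg_eqP; apply: ac_rel; apply: UeaLie.
by rewrite -palg_addE -palg_mulE.
Qed.
Lemma ext_gen_linear : linear ext_gen.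
Proof.
move=> c x y; transitivity (palg_pi (@ext_rel K h)
  (AAdd (AMul (ASc c) (AVar x)) (AVar y))); last first.
  by rewrite -palg_addE -palg_mulE.
by apply/palg_eqP; apply: ac_rel; apply: ExtLin.
Qed.
Lemma ext_gen_sqr x : ext_gen x * ext_gen x = 0.
Proof.
transitivity (palg_pi (@ext_rel K h) (AMul (AVar x) (AVar x))).
  by rewrite -palg_mulE.
by apply/palg_eqP; apply: ac_rel; apply: ExtSq.
Qed.

Lemma uea_ind (P : uea h -> Prop) :
  (forall c, P c%:A) -> (forall v w, P v -> P w -> P (v + w)) ->
  (forall v w, P v -> P w -> P (v * w)) ->
  (forall x, P (uea_gen x)) -> forall v, P v.
Proof. exact: palg_ind. Qed.
Lemma ext_ind (P : ext h -> Prop) :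
  (forall c, P c%:A) -> (forall v w, P v -> P w -> P (v + w)) ->
  (forall v w, P v -> P w -> P (v * w)) ->
  (forall x, P (ext_gen x)) -> forall v, P v.
Proof. exact: palg_ind. Qed.

Lemma uea_rel_lift (B : pzRingType) (s : K -> B) (f : h -> B) :
  (forall c x y, f (c *: x + y) = s c * f x + f y) ->
  (forall x y, f x * f y = f y * f x + f (lie x y)) ->
  forall t u, uea_rel t u -> aeval s f t = aeval s f u.
Proof. by move=> fl fb t u [c x y|x y] /=. Qed.
Lemma ext_rel_lift (B : pzRingType) (s : K -> B) (f : h -> B) :
  s 0 = 0 ->
  (forall c x y, f (c *: x + y) = s c * f x + f y) ->
  (forall x, f x * f x = 0) ->
  forall t u, ext_rel t u -> aeval s f t = aeval s f u.
Proof. by move=> s0 fl fb t u [c x y|x] /=; rewrite ?s0. Qed.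

End UeaExt.

Section Multilinear.
Variable K : fieldType.

Lemma linear_0 (V W : lmodType K) (f : V -> W) : linear f -> f 0 = 0.
Proof. by move=> fl; have := fl (-1) 0 0; rewrite !scaleN1r oppr0 addr0 addNr. Qed.
Lemma linear_D (V W : lmodType K) (f : V -> W) :
  linear f -> {morph f : x y / x + y}.
Proof. by move=> fl x y; rewrite -[x]scale1r fl !scale1r. Qed.

Lemma linear_eq (V W Z : lmodType K) (f g : tensor V W -> Z) :
  linear f -> linear g -> (forall v w, f (v ⊗ w) = g (v ⊗ w)) -> f =1 g.
Proof.
move=> fl gl fg; elim/tensor_ind => [|c x y Ex Ey|//].
- by rewrite !linear_0.
- by rewrite fl gl Ex Ey.
Qed.

Lemma tlift_comb (V W Z : lmodType K) (f g g' : V -> W -> Z) c :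
  (forall v w, f v w = c *: g v w + g' v w) ->
  forall x, tlift f x = c *: tlift g x + tlift g' x.
Proof.
move=> fE x; rewrite /tlift /pmod_lift.
elim: (pmod_repr x) => [[v w]||t /= -> u ->|a t /= ->] /=.
- exact: fE.
- by rewrite scaler0 addr0.
- by rewrite scalerDr addrACA.
- by rewrite scalerDr !scalerA mulrC.
Qed.

Lemma tlift2_bilinear (V W V' W' Z : lmodType K) (F : V -> W -> V' -> W' -> Z) :
  (forall w v' w', linear (fun v => F v w v' w')) ->
  (forall v v' w', linear (fun w => F v w v' w')) ->
  (forall v w, bilinear (F v w)) ->
  bilinear (fun x y => tlift (fun v w => tlift (F v w) y) x).
Proof.
move=> F1 F2 F3; split=> [y|x] /=.
- apply: tlift_linear; split=> [w|v] c u u' /=; apply: tlift_comb => v' w'.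
  + exact: F1.
  + exact: F2.
- by move=> c u u'; apply: tlift_comb => v w; apply: tlift_linear.
Qed.

Lemma tlift2E (V W V' W' Z : lmodType K) (F : V -> W -> V' -> W' -> Z) v w v' w' :
  (forall w v' w', linear (fun v => F v w v' w')) ->
  (forall v v' w', linear (fun w => F v w v' w')) ->
  (forall v w, bilinear (F v w)) ->
  tlift (fun v w => tlift (F v w) (v' ⊗ w')) (v ⊗ w) = F v w v' w'.
Proof.
move=> F1 F2 F3; rewrite tliftE ?tliftE //; split=> [?|?] c u u' /=;
  apply: tlift_comb => ? ?; [exact: F1|exact: F2].
Qed.

Section TensorRing.
Variables (V W : lmodType K) (m : tensor V W -> tensor V W -> tensor V W).
Hypothesis mB : bilinear m.

Lemma tmul_assoc :
  (forall a b a' b' a'' b'',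
    m (a ⊗ b) (m (a' ⊗ b') (a'' ⊗ b'')) = m (m (a ⊗ b) (a' ⊗ b')) (a'' ⊗ b'')) ->
  associative m.
Proof.
case: mB => ml mr mA; elim/tensor_ind => [y z|c x x' Ex Ex' y z|a b].
- by rewrite !(linear_0 (ml _)).
- by rewrite ml Ex Ex' -!ml.
elim/tensor_ind => [z|c y y' Ey Ey' z|a' b'].
- by rewrite !(linear_0 (mr _), linear_0 (ml _)).
- by rewrite ml !mr Ey Ey' -ml.
apply: linear_eq => // c x y; by rewrite !mr.
Qed.

Lemma tmul_1l u : (forall a b, m u (a ⊗ b) = a ⊗ b) -> left_id u m.
Proof. by case: mB => ml mr E; apply: linear_eq => // [c x y]. Qed.
Lemma tmul_1r u : (forall a b, m (a ⊗ b) u = a ⊗ b) -> right_id u m.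
Proof. by case: mB => ml mr E; apply: linear_eq => // [c x y]. Qed.
Lemma tmul_Dl : left_distributive m +%R.
Proof. by case: mB => ml mr x y z; apply: (linear_D (ml z)). Qed.
Lemma tmul_Dr : right_distributive m +%R.
Proof. by case: mB => ml mr x y z; apply: (linear_D (mr x)). Qed.
End TensorRing.
End Multilinear.

(* U(h) ⊗ U(h) with (a ⊗ b)(a' ⊗ b') = aa' ⊗ bb' *)
Section UeaTensor.
Variables (K : fieldType) (h : lieAlgType K).

Definition uea_tensor : Type := tensor (uea h) (uea h).
HB.instance Definition _ := GRing.Lmodule.on uea_tensor.

Definition uea_tmul (x y : uea_tensor) : uea_tensor :=
  tlift (fun a b => tlift (fun a' b' => (a * a') ⊗ (b * b')) y) x.

Let F1 (b a' b' : uea h) : linear (fun a => (a * a') ⊗ (b * b')).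
Proof. by move=> c u v; rewrite mulrDl -scalerAl (tpure_bilinear _ _).1. Qed.
Let F2 (a a' b' : uea h) : linear (fun b => (a * a') ⊗ (b * b')).
Proof. by move=> c u v; rewrite mulrDl -scalerAl (tpure_bilinear _ _).2. Qed.
Let F3 (a b : uea h) : bilinear (fun a' b' => (a * a') ⊗ (b * b')).
Proof.
split=> ? c u v /=; rewrite mulrDr -scalerAr.
- exact: (tpure_bilinear _ _).1.
- exact: (tpure_bilinear _ _).2.
Qed.

Lemma uea_tmulE (a b a' b' : uea h) :
  uea_tmul (a ⊗ b) (a' ⊗ b') = (a * a') ⊗ (b * b').
Proof. exact: tlift2E. Qed.
Lemma uea_tmul_bilinear : bilinear uea_tmul.
Proof. exact: tlift2_bilinear. Qed.
Lemma uea_tmulA : associative uea_tmul.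
Proof.
apply: tmul_assoc uea_tmul_bilinear _ => a b a' b' a'' b''.
by rewrite !uea_tmulE !mulrA.
Qed.
Lemma uea_tmul1l : left_id (1 ⊗ 1) uea_tmul.
Proof. by apply: (tmul_1l uea_tmul_bilinear) => a b; rewrite uea_tmulE !mul1r. Qed.
Lemma uea_tmul1r : right_id (1 ⊗ 1) uea_tmul.
Proof. by apply: (tmul_1r uea_tmul_bilinear) => a b; rewrite uea_tmulE !mulr1. Qed.

HB.instance Definition _ := GRing.Zmodule_isPzRing.Build uea_tensor
  uea_tmulA uea_tmul1l uea_tmul1r
  (tmul_Dl uea_tmul_bilinear) (tmul_Dr uea_tmul_bilinear).

Lemma uea_tensor_central : central_map (fun c : K => c *: (1 : uea_tensor)).
Proof.
have [ml mr] := uea_tmul_bilinear.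
have Zl c x : c *: (1 : uea_tensor) * x = c *: x.
  have := ml x c 1 0; rewrite (linear_0 (ml x)) !addr0 => E.
  by rewrite [LHS]E [uea_tmul _ _](mul1r x).
have Zr c x : x * (c *: (1 : uea_tensor)) = c *: x.
  have := mr x c 1 0; rewrite (linear_0 (mr x)) !addr0 => E.
  by rewrite [LHS]E [uea_tmul _ _](mulr1 x).
split=> [||a b|a b|c x].
- exact: scale0r.
- exact: scale1r.
- exact: scalerDl.
- by rewrite Zl scalerA.
- by rewrite Zl Zr.
Qed.
End UeaTensor.

Section ExtParity.
Variables (K : fieldType) (h : lieAlgType K).
Implicit Types (a b : ext h) (x y : h).

Lemma ext_gen_anticomm x y : ext_gen x * ext_gen y = - (ext_gen y * ext_gen x).
Proof.
apply/eqP; rewrite -addr_eq0; apply/eqP; have := ext_gen_sqr (x + y).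
rewrite (linear_D (@ext_gen_linear _ h)) mulrDl !mulrDr !ext_gen_sqr add0r addr0.
by [].
Qed.

Lemma alg_central (A : algType K) : central_map (fun c : K => c%:A : A).
Proof.
split=> [||c d|c d|c a]; rewrite ?scale0r ?scale1r ?scalerDl //.
- by rewrite -scalerAl mul1r scalerA.
- by rewrite -scalerAl -scalerAr mul1r mulr1.
Qed.

Lemma alg_mx_central (A : algType K) : central_map (fun c : K => (c%:A : A)%:M : 'M_2).
Proof.
have [s0 s1 sD sM sC] := alg_central A.
split=> [||c d|c d|c m].
- by rewrite s0 raddf0.
- by rewrite s1.
- by rewrite sD raddfD.
- by rewrite sM scalar_mxM.
- apply/matrixP => i j.
  rewrite -[(_ * m) i j]/((_ *m m) i j) -[(m * _) i j]/((m *m _) i j) !mxE.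
  rewrite (bigD1 i) //= big1 ?addr0 => [|k /negbTE ki]; last first.
    by rewrite mxE eq_sym ki mul0r.
  rewrite (bigD1 j) //= big1 ?addr0 => [|k /negbTE kj]; last first.
    by rewrite mxE kj mulr0.
  by rewrite !mxE !eqxx /=; apply: sC.
Qed.

(* The antipode: the algebra endomorphism with x |-> - x, that is, (-1)^k on
   /\^k. *)
Definition ext_antipode : ext h -> ext h :=
  palg_lift (fun c => c%:A) (fun x => - ext_gen x).

Let antR t u : @ext_rel K h t u ->
  aeval (fun c => c%:A) (fun x => - ext_gen x) t =
  aeval (fun c => c%:A) (fun x => - ext_gen x) u.
Proof.
apply: ext_rel_lift => [|c x y|x]; first exact: scale0r.
- by rewrite ext_gen_linear -scalerAl mul1r opprD scalerN.
- by rewrite mulrNN ext_gen_sqr.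
Qed.

Lemma ext_antipode_gen x : ext_antipode (ext_gen x) = - ext_gen x.
Proof. exact: (palg_lift_gen (alg_central _) antR). Qed.
Lemma ext_antipode1 : ext_antipode 1 = 1.
Proof. exact: (palg_lift1 (alg_central _) antR). Qed.
Lemma ext_antipodeM : {morph ext_antipode : a b / a * b}.
Proof. exact: (palg_liftM (alg_central _) antR). Qed.
Lemma ext_antipode_linear : linear ext_antipode.
Proof.
move=> c a b; rewrite /ext_antipode (palg_liftD (alg_central _) antR).
by rewrite (palg_liftZ (alg_central _) antR) -scalerAl mul1r.
Qed.
Lemma ext_antipode_prod (s : seq h) :
  ext_antipode (\prod_(x <- s) ext_gen x) =
  (-1) ^+ size s *: \prod_(x <- s) ext_gen x.
Proof.
elim: s => [|x s IHs]; first by rewrite big_nil scale1r ext_antipode1.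
rewrite big_cons ext_antipodeM IHs ext_antipode_gen exprS mulN1r scaleNr.
by rewrite -scalerAr mulNr scalerN.
Qed.

(* The even and odd components a0, a1 of a, read off from the algebra map into
   2 x 2 matrices sending x in h to [[0, x], [x, 0]] and a to
   [[a0, a1], [a1, a0]]. *)
Definition parity_gen x : 'M[ext h]_2 :=
  \matrix_(i, j) (if i == j then 0 else ext_gen x).
Definition parity_mx : ext h -> 'M[ext h]_2 :=
  palg_lift (fun c => (c%:A)%:M) parity_gen.
Definition ext_even a : ext h := parity_mx a 0 0.
Definition ext_odd a : ext h := parity_mx a 0 1.

Let parR t u : @ext_rel K h t u ->
  aeval (fun c => (c%:A)%:M : 'M[ext h]_2) parity_gen t =
  aeval (fun c => (c%:A)%:M : 'M[ext h]_2) parity_gen u.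
Proof.
apply: ext_rel_lift => [|c x y|x]; first by rewrite scale0r raddf0.
- apply/matrixP => i j; rewrite -mulmxE mul_scalar_mx !mxE ext_gen_linear.
  by case: ifP; rewrite ?mulr0 ?addr0 // -scalerAl mul1r.
- apply/matrixP => i j; rewrite -mulmxE !mxE big1 // => k _; rewrite !mxE.
  by do 2![case: ifP => _]; rewrite ?(mul0r, mulr0, ext_gen_sqr).
Qed.

Let parM a b : parity_mx (a * b) = parity_mx a * parity_mx b.
Proof. exact: (palg_liftM (alg_mx_central _) parR). Qed.
Let parD a b : parity_mx (a + b) = parity_mx a + parity_mx b.
Proof. exact: (palg_liftD (alg_mx_central _) parR). Qed.
Let parZ c a : parity_mx (c *: a) = c%:A *: parity_mx a.
Proof.
by rewrite [LHS](palg_liftZ (alg_mx_central _) parR) -mulmxE mul_scalar_mx.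
Qed.
Let parG x : parity_mx (ext_gen x) = parity_gen x.
Proof. exact: (palg_lift_gen (alg_mx_central _) parR). Qed.
Let par1 : parity_mx 1 = 1.
Proof. exact: (palg_lift1 (alg_mx_central _) parR). Qed.

Lemma ext_even_linear : linear ext_even.
Proof.
by move=> c a b; rewrite /ext_even parD parZ !mxE -scalerAl mul1r.
Qed.
Lemma ext_odd_linear : linear ext_odd.
Proof.
by move=> c a b; rewrite /ext_odd parD parZ !mxE -scalerAl mul1r.
Qed.
Lemma ext_even1 : ext_even 1 = 1.
Proof. by rewrite /ext_even par1 mxE. Qed.
Lemma ext_odd1 : ext_odd 1 = 0.
Proof. by rewrite /ext_odd par1 mxE. Qed.
Lemma ext_even_gen x : ext_even (ext_gen x) = 0.
Proof. by rewrite /ext_even parG mxE. Qed.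
Lemma ext_odd_gen x : ext_odd (ext_gen x) = ext_gen x.
Proof. by rewrite /ext_odd parG mxE. Qed.

Let parC a : (parity_mx a 1 1 = parity_mx a 0 0) *
             (parity_mx a 1 0 = parity_mx a 0 1).
Proof.
elim/ext_ind: a => [c|a b [e1 o1] [e2 o2]|a b [e1 o1] [e2 o2]|x].
- by rewrite parZ par1 !mxE.
- by rewrite parD !mxE e1 e2 o1 o2.
- rewrite parM -mulmxE !mxE !big_ord_recl !big_ord0 !addr0.
  rewrite (_ : lift ord0 ord0 = 1); last exact/val_inj.
  by rewrite e1 e2 o1 o2; split; rewrite addrC.
- by rewrite parG !mxE.
Qed.

Lemma ext_evenM a b :
  ext_even (a * b) = ext_even a * ext_even b + ext_odd a * ext_odd b.
Proof.
rewrite /ext_even parM -mulmxE !mxE !big_ord_recl !big_ord0 !addr0.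
by rewrite (_ : lift ord0 ord0 = 1) ?parC //; apply/val_inj.
Qed.
Lemma ext_oddM a b :
  ext_odd (a * b) = ext_even a * ext_odd b + ext_odd a * ext_even b.
Proof.
rewrite /ext_odd parM -mulmxE !mxE !big_ord_recl !big_ord0 !addr0.
by rewrite (_ : lift ord0 ord0 = 1) ?parC //; apply/val_inj.
Qed.

Lemma ext_even_odd a : ext_even a + ext_odd a = a.
Proof.
elim/ext_ind: a => [c|a b ha hb|a b ha hb|x].
- rewrite /ext_even /ext_odd parZ par1 !mxE mulr0 addr0.
  by rewrite -scalerAl mulr1.
- rewrite (linear_D ext_even_linear) (linear_D ext_odd_linear) addrACA.
  by rewrite ha hb.
- rewrite ext_evenM ext_oddM -[in RHS]ha -[in RHS]hb mulrDl !mulrDr addrACA.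
  by congr (_ + _); apply: addrC.
- by rewrite ext_even_gen ext_odd_gen add0r.
Qed.
End ExtParity.

(* /\(h) ⊗ /\(h) with (a ⊗ b)(a' ⊗ b') = (-1)^{|b||a'|} aa' ⊗ bb' *)
Section ExtTensor.
Variables (K : fieldType) (h : lieAlgType K).

Definition ext_tensor : Type := tensor (ext h) (ext h).
HB.instance Definition _ := GRing.Lmodule.on ext_tensor.

Let F (a b a' b' : ext h) : ext_tensor :=
  (a * a') ⊗ (ext_even b * b') + (a * ext_antipode a') ⊗ (ext_odd b * b').

Definition ext_tmul (x y : ext_tensor) : ext_tensor :=
  tlift (fun a b => tlift (fun a' b' =>
    (a * a') ⊗ (ext_even b * b') + (a * ext_antipode a') ⊗ (ext_odd b * b')) y) x.

Let tpl (w : ext h) : linear (fun v : ext h => v ⊗ w).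
Proof. exact: (tpure_bilinear _ _).1. Qed.
Let tpr (v : ext h) : linear (fun w : ext h => v ⊗ w).
Proof. exact: (tpure_bilinear _ _).2. Qed.

Let comb (c : K) (x y z t : ext_tensor) :
  c *: x + y + (c *: z + t) = c *: (x + z) + (y + t).
Proof. by rewrite scalerDr addrACA. Qed.

Let F1 b a' b' : linear (fun a => F a b a' b').
Proof. by move=> c u v; rewrite /F !mulrDl -!scalerAl !tpl comb. Qed.
Let F2 a a' b' : linear (fun b => F a b a' b').
Proof.
move=> c u v; rewrite /F ext_even_linear ext_odd_linear !mulrDl -!scalerAl.
by rewrite !tpr comb.
Qed.
Let F3 a b : bilinear (F a b).
Proof.
split=> ? c u v; rewrite /F.
- by rewrite ext_antipode_linear !mulrDr -!scalerAr !tpl comb.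
- by rewrite !mulrDr -!scalerAr !tpr comb.
Qed.

Lemma ext_tmulE (a b a' b' : ext h) :
  ext_tmul (a ⊗ b) (a' ⊗ b') =
  (a * a') ⊗ (ext_even b * b') + (a * ext_antipode a') ⊗ (ext_odd b * b').
Proof. exact: (tlift2E _ _ _ _ F1 F2 F3). Qed.
Lemma ext_tmul_bilinear : bilinear ext_tmul.
Proof. exact: (tlift2_bilinear F1 F2 F3). Qed.

Lemma ext_parityK (b : ext h) :
  [/\ ext_even (ext_even b) = ext_even b, ext_odd (ext_even b) = 0,
      ext_even (ext_odd b) = 0 & ext_odd (ext_odd b) = ext_odd b].
Proof.
have eD := linear_D (@ext_even_linear K h).
have oD := linear_D (@ext_odd_linear K h).
have e0 := linear_0 (@ext_even_linear K h).
have o0 := linear_0 (@ext_odd_linear K h).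
elim/ext_ind: b => [c|a b [ee1 oe1 eo1 oo1] [ee2 oe2 eo2 oo2]
    |a b [ee1 oe1 eo1 oo1] [ee2 oe2 eo2 oo2]|x].
- have E : ext_even (c%:A : ext h) = c%:A.
    have := ext_even_linear c (1 : ext h) 0.
    by rewrite e0 !addr0 ext_even1.
  have O : ext_odd (c%:A : ext h) = 0.
    have := ext_odd_linear c (1 : ext h) 0.
    by rewrite o0 !addr0 ext_odd1 scaler0.
  by rewrite !(E, O) e0 o0.
- by rewrite !(eD, oD) ee1 oe1 eo1 oo1 ee2 oe2 eo2 oo2 !addr0.
- rewrite ext_evenM ext_oddM !(eD, oD) !ext_evenM !ext_oddM.
  rewrite ee1 oe1 eo1 oo1 ee2 oe2 eo2 oo2.
  by rewrite !(mul0r, mulr0, addr0, add0r).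
- by rewrite ext_even_gen ext_odd_gen e0 o0 ext_even_gen ext_odd_gen.
Qed.

Lemma ext_antipodeK : involutive (@ext_antipode K h).
Proof.
have sD := linear_D (@ext_antipode_linear K h).
elim/ext_ind=> [c|a b ha hb|a b ha hb|x].
- have E : ext_antipode (c%:A : ext h) = c%:A.
    have := ext_antipode_linear c (1 : ext h) 0.
    by rewrite (linear_0 (@ext_antipode_linear K h)) !addr0 ext_antipode1.
  by rewrite !E.
- by rewrite !sD ha hb.
- by rewrite !ext_antipodeM ha hb.
- rewrite ext_antipode_gen -scaleN1r -[_ *: _]addr0 ext_antipode_linear.
  rewrite (linear_0 (@ext_antipode_linear K h)) ext_antipode_gen.
  by rewrite addr0 scalerN scaleN1r opprK.
Qed.

Lemma ext_tmulA : associative ext_tmul.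
Proof.
apply: tmul_assoc ext_tmul_bilinear _ => a b a' b' a'' b''.
have [ml mr] := ext_tmul_bilinear.
rewrite !ext_tmulE (linear_D (mr _)) (linear_D (ml _)) !ext_tmulE.
rewrite !(ext_evenM, ext_oddM); have [-> -> -> ->] := ext_parityK b.
rewrite !ext_antipodeM ext_antipodeK !(mul0r, add0r, addr0) !mulrA.
by rewrite -!addrA; congr (_ + _); rewrite addrC -!addrA.
Qed.
Lemma ext_tmul1l : left_id (1 ⊗ 1) ext_tmul.
Proof.
apply: (tmul_1l ext_tmul_bilinear) => a b.
by rewrite ext_tmulE ext_even1 ext_odd1 mul0r !mul1r (linear_0 (tpr _)) addr0.
Qed.
Lemma ext_tmul1r : right_id (1 ⊗ 1) ext_tmul.
Proof.
apply: (tmul_1r ext_tmul_bilinear) => a b.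
rewrite ext_tmulE ext_antipode1 !mulr1 -(linear_D (tpr _)).
by rewrite ext_even_odd.
Qed.

Lemma ext_parity_prod (s : seq h) :
  (ext_even (\prod_(x <- s) ext_gen x) =
     if odd (size s) then 0 else \prod_(x <- s) ext_gen x) *
  (ext_odd (\prod_(x <- s) ext_gen x) =
     if odd (size s) then \prod_(x <- s) ext_gen x else 0).
Proof.
elim: s => [|x s IHs]; first by rewrite !big_nil ext_even1 ext_odd1.
rewrite !big_cons ext_evenM ext_oddM ext_even_gen ext_odd_gen !IHs /=.
by case: (odd _); rewrite /= !(mul0r, mulr0, add0r).
Qed.

Lemma ext_tmul_sign a (s t : seq h) b' :
  ext_tmul (a ⊗ \prod_(x <- s) ext_gen x) ((\prod_(x <- t) ext_gen x) ⊗ b') =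
  (-1) ^+ (size s * size t) *:
    ((a * \prod_(x <- t) ext_gen x) ⊗ ((\prod_(x <- s) ext_gen x) * b')).
Proof.
rewrite ext_tmulE !ext_parity_prod ext_antipode_prod -scalerAr.
rewrite -[in RHS]signr_odd oddM.
case: (odd (size s)); rewrite /= mul0r (linear_0 (tpr _)).
- rewrite add0r signr_odd; have := tpl ((\prod_(x <- s) ext_gen x) * b')
    ((-1) ^+ size t) (a * \prod_(x <- t) ext_gen x) 0.
  by rewrite /= !addr0 (linear_0 (tpl _)) addr0.
- by rewrite addr0 scale1r.
Qed.

HB.instance Definition _ := GRing.Zmodule_isPzRing.Build ext_tensor
  ext_tmulA ext_tmul1l ext_tmul1r
  (tmul_Dl ext_tmul_bilinear) (tmul_Dr ext_tmul_bilinear).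

Lemma ext_tensor_central : central_map (fun c : K => c *: (1 : ext_tensor)).
Proof.
have [ml mr] := ext_tmul_bilinear.
have Zl c x : c *: (1 : ext_tensor) * x = c *: x.
  have := ml x c 1 0; rewrite (linear_0 (ml x)) !addr0 => E.
  by rewrite [LHS]E [ext_tmul _ _](mul1r x).
have Zr c x : x * (c *: (1 : ext_tensor)) = c *: x.
  have := mr x c 1 0; rewrite (linear_0 (mr x)) !addr0 => E.
  by rewrite [LHS]E [ext_tmul _ _](mulr1 x).
split=> [||a b|a b|c x].
- exact: scale0r.
- exact: scale1r.
- exact: scalerDl.
- by rewrite Zl scalerA.
- by rewrite Zl Zr.
Qed.
Lemma ext_tensorZl c (x : ext_tensor) : c *: (1 : ext_tensor) * x = c *: x.
Proof.
have [ml mr] := ext_tmul_bilinear.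
have := ml x c 1 0; rewrite (linear_0 (ml x)) !addr0 => E.
by rewrite [LHS]E [ext_tmul _ _](mul1r x).
Qed.

(* The algebra map with x |-> x ⊗ 1 + 1 ⊗ x *)
Definition ext_coprod : ext h -> tensor (ext h) (ext h) :=
  palg_lift (B := ext_tensor) (fun c => c *: (1 : ext_tensor))
    (fun x => ext_gen x ⊗ 1 + 1 ⊗ ext_gen x).

Let copR t u : @ext_rel K h t u ->
  aeval (B := ext_tensor) (fun c => c *: (1 : ext_tensor))
    (fun x => ext_gen x ⊗ 1 + 1 ⊗ ext_gen x) t =
  aeval (B := ext_tensor) (fun c => c *: (1 : ext_tensor))
    (fun x => ext_gen x ⊗ 1 + 1 ⊗ ext_gen x) u.
Proof.
apply: ext_rel_lift => [|c x y|x]; first exact: scale0r.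
- by rewrite ext_gen_linear tpl tpr comb ext_tensorZl.
- rewrite mulrDl !mulrDr -![LHS]/(ext_tmul _ _ + ext_tmul _ _ + (ext_tmul _ _ + ext_tmul _ _)).
  rewrite !ext_tmulE !ext_even_gen !ext_odd_gen !ext_even1 !ext_odd1.
  rewrite ext_antipode_gen ext_antipode1 !(mulr1, mul1r, mul0r, ext_gen_sqr).
  rewrite !(linear_0 (tpr _), linear_0 (tpl _)) !(addr0, add0r).
  by rewrite -(linear_D (tpl _)) addrN (linear_0 (tpl _)).
Qed.

Lemma ext_coprod_gen x : ext_coprod (ext_gen x) = ext_gen x ⊗ 1 + 1 ⊗ ext_gen x.
Proof. exact: (palg_lift_gen ext_tensor_central copR). Qed.
Lemma ext_coprod1 : ext_coprod 1 = 1 ⊗ 1.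
Proof. exact: (palg_lift1 ext_tensor_central copR). Qed.
Lemma ext_coprodM a b : ext_coprod (a * b) = ext_tmul (ext_coprod a) (ext_coprod b).
Proof. exact: (palg_liftM ext_tensor_central copR). Qed.
Lemma ext_coprod_linear : linear ext_coprod.
Proof.
move=> c a b; rewrite /ext_coprod (palg_liftD ext_tensor_central copR).
by rewrite (palg_liftZ ext_tensor_central copR) ext_tensorZl.
Qed.
End ExtTensor.

Section UeaHopf.
Variables (K : fieldType) (h : lieAlgType K).

Lemma uea_tensorZl c (x : uea_tensor h) : c *: (1 : uea_tensor h) * x = c *: x.
Proof.
have [ml mr] := uea_tmul_bilinear h.
have := ml x c 1 0; rewrite (linear_0 (ml x)) !addr0 => E.
by rewrite [LHS]E [uea_tmul _ _](mul1r x).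
Qed.

(* The algebra map with x |-> x ⊗ 1 + 1 ⊗ x *)
Definition uea_coprod : uea h -> tensor (uea h) (uea h) :=
  palg_lift (B := uea_tensor h) (fun c => c *: (1 : uea_tensor h))
    (fun x => uea_gen x ⊗ 1 + 1 ⊗ uea_gen x).

Let tpl (w : uea h) : linear (fun v : uea h => v ⊗ w).
Proof. exact: (tpure_bilinear _ _).1. Qed.
Let tpr (v : uea h) : linear (fun w : uea h => v ⊗ w).
Proof. exact: (tpure_bilinear _ _).2. Qed.

Let copR t u : @uea_rel K h t u ->
  aeval (B := uea_tensor h) (fun c => c *: (1 : uea_tensor h))
    (fun x => uea_gen x ⊗ 1 + 1 ⊗ uea_gen x) t =
  aeval (B := uea_tensor h) (fun c => c *: (1 : uea_tensor h))
    (fun x => uea_gen x ⊗ 1 + 1 ⊗ uea_gen x) u.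
Proof.
apply: uea_rel_lift => [c x y|x y].
- by rewrite uea_gen_linear tpl tpr uea_tensorZl scalerDr addrACA.
- have mE (x' y' : h) : (uea_gen x' ⊗ 1 + 1 ⊗ uea_gen x' : uea_tensor h) *
      (uea_gen y' ⊗ 1 + 1 ⊗ uea_gen y') =
      ((uea_gen x' * uea_gen y') ⊗ 1 + 1 ⊗ (uea_gen x' * uea_gen y')) +
      (uea_gen x' ⊗ uea_gen y' + uea_gen y' ⊗ uea_gen x').
    rewrite mulrDl !mulrDr.
    rewrite -![LHS]/(uea_tmul _ _ + uea_tmul _ _ + (uea_tmul _ _ + uea_tmul _ _)).
    rewrite !uea_tmulE !mulr1 !mul1r -!addrA; congr (_ + _).
    by rewrite [RHS]addrC !addrA.
  rewrite !mE (uea_genM x y) (linear_D (tpl _)) (linear_D (tpr _)).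
  by rewrite [X in X + _ = _]addrACA [RHS]addrAC [X in _ + X = _]addrC.
Qed.

Lemma uea_coprod_gen x : uea_coprod (uea_gen x) = uea_gen x ⊗ 1 + 1 ⊗ uea_gen x.
Proof. exact: (palg_lift_gen (uea_tensor_central h) copR). Qed.
Lemma uea_coprod1 : uea_coprod 1 = 1 ⊗ 1.
Proof. exact: (palg_lift1 (uea_tensor_central h) copR). Qed.
Lemma uea_coprodM a b : uea_coprod (a * b) = uea_tmul (uea_coprod a) (uea_coprod b).
Proof. exact: (palg_liftM (uea_tensor_central h) copR). Qed.
Lemma uea_coprod_linear : linear uea_coprod.
Proof.
move=> c a b; rewrite /uea_coprod (palg_liftD (uea_tensor_central h) copR).
by rewrite (palg_liftZ (uea_tensor_central h) copR) uea_tensorZl.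
Qed.

(* The algebra map into the opposite algebra with x |-> - x *)
Definition uea_antipode : uea h -> uea h :=
  palg_lift (B := (uea h)^c) (fun c => (c%:A : uea h)) (fun x => - uea_gen x).

Let cen : @central_map K (uea h)^c (fun c => (c%:A : uea h)).
Proof.
have [s0 s1 sD sM sC] := alg_central (uea h).
split=> // [c d|c a]; first by rewrite mulrC sM.
by symmetry; apply: sC.
Qed.

Let antR t u : @uea_rel K h t u ->
  aeval (B := (uea h)^c) (fun c => (c%:A : uea h)) (fun x => - uea_gen x) t =
  aeval (B := (uea h)^c) (fun c => (c%:A : uea h)) (fun x => - uea_gen x) u.
Proof.
apply: uea_rel_lift => [c x y|x y].
- rewrite uea_gen_linear opprD -scalerN; congr (_ + _).
  by rewrite -[RHS]/((- uea_gen x : uea h) * c%:A) -scalerAr mulr1.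
- rewrite -[LHS]/((- uea_gen y : uea h) * (- uea_gen x)).
  rewrite -[_ * _ in RHS]/((- uea_gen x : uea h) * (- uea_gen y)).
  by rewrite !mulrNN [uea_gen x * _]uea_genM addrK.
Qed.

Lemma uea_antipode_gen x : uea_antipode (uea_gen x) = - uea_gen x.
Proof. exact: (palg_lift_gen cen antR). Qed.
Lemma uea_antipode1 : uea_antipode 1 = 1.
Proof. exact: (palg_lift1 cen antR). Qed.
Lemma uea_antipodeM a b : uea_antipode (a * b) = uea_antipode b * uea_antipode a.
Proof. exact: (palg_liftM cen antR). Qed.
Lemma uea_antipode_linear : linear uea_antipode.
Proof.
move=> c a b; rewrite /uea_antipode (palg_liftD cen antR).
rewrite (palg_liftZ cen antR); congr (_ + _).
by rewrite -[LHS]/(uea_antipode a * c%:A) -scalerAr mulr1.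
Qed.
End UeaHopf.

Section Endomorphisms.
Variables (K : fieldType) (V : lmodType K).

Record endo : Type := Endo { endo_fun :> V -> V; endo_linear : linear endo_fun }.

HB.instance Definition _ := gen_eqMixin endo.
HB.instance Definition _ := gen_choiceMixin endo.

Lemma endoP (f g : endo) : f =1 g -> f = g.
Proof.
case: f g => [f fl] [g gl] /= /funext E; rewrite -E in gl *.
by congr Endo; apply: Prop_irrelevance.
Qed.

Lemma endo_scal_subproof (c : K) : linear (fun v : V => c *: v).
Proof. by move=> a u v; rewrite scalerDr !scalerA mulrC. Qed.
Lemma endo_opp_subproof (f : endo) : linear (fun v => - f v).
Proof. by move=> c u v; rewrite endo_linear opprD scalerN. Qed.
Lemma endo_add_subproof (f g : endo) : linear (fun v => f v + g v).
Proof. by move=> c u v; rewrite !endo_linear scalerDr addrACA. Qed.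
Lemma endo_mul_subproof (f g : endo) : linear (fun v => f (g v)).
Proof. by move=> c u v; rewrite !endo_linear. Qed.

Definition endo_scal c := Endo (endo_scal_subproof c).
Definition endo_opp f := Endo (endo_opp_subproof f).
Definition endo_add f g := Endo (endo_add_subproof f g).
Definition endo_mul f g := Endo (endo_mul_subproof f g).

Let addA : associative endo_add.
Proof. by move=> f g k; apply: endoP => v /=; rewrite addrA. Qed.
Let addC : commutative endo_add.
Proof. by move=> f g; apply: endoP => v /=; rewrite addrC. Qed.
Let add0 : left_id (endo_scal 0) endo_add.
Proof. by move=> f; apply: endoP => v /=; rewrite scale0r add0r. Qed.
Let addN : left_inverse (endo_scal 0) endo_opp endo_add.
Proof. by move=> f; apply: endoP => v /=; rewrite scale0r addNr. Qed.
HB.instance Definition _ := GRing.isZmodule.Build endo addA addC add0 addN.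

Let mulA : associative endo_mul.
Proof. by move=> f g k; apply: endoP. Qed.
Let mul1 : left_id (endo_scal 1) endo_mul.
Proof. by move=> f; apply: endoP => v /=; rewrite scale1r. Qed.
Let mulr1 : right_id (endo_scal 1) endo_mul.
Proof. by move=> f; apply: endoP => v /=; rewrite scale1r. Qed.
Let mulDl : left_distributive endo_mul +%R.
Proof. by move=> f g k; apply: endoP. Qed.
Let mulDr : right_distributive endo_mul +%R.
Proof. by move=> f g k; apply: endoP => v /=; apply: (linear_D (@endo_linear f)). Qed.
HB.instance Definition _ :=
  GRing.Zmodule_isPzRing.Build endo mulA mul1 mulr1 mulDl mulDr.

Lemma endo_scal_central : central_map endo_scal.
Proof.
split=> // [a b|a b|c f]; apply: endoP => v /=.
- exact: scalerDl.
- by rewrite scalerA.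
- have := endo_linear f c v 0.
  by rewrite (linear_0 (@endo_linear f)) !addr0.
Qed.
End Endomorphisms.

(* The bracket U(h) x /\(h) -> /\(h) *)
Section Action.
Variables (K : fieldType) (h : lieAlgType K).
Implicit Types (a b : ext h) (x y z : h).

Lemma lieD_r z : {morph @lie K h z : x y / x + y}.
Proof. by move=> x y; rewrite -[x]scale1r lie_linearr !scale1r. Qed.
Lemma lieD_l z : {morph (@lie K h)^~ z : x y / x + y}.
Proof. by move=> x y; rewrite -[x]scale1r lie_linearl !scale1r. Qed.
Lemma lieN_r x y : lie x (- y) = - lie x y.
Proof.
have l0 : lie x (0 : h) = 0 by have := lieD_r x 0 0; rewrite addr0 => /esym/eqP;
  rewrite -subr_eq0 addrK => /eqP.
by have := lie_linearr (-1) y 0 x; rewrite !scaleN1r !addr0 l0 addr0.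
Qed.
Lemma lie_anti x y : lie x y = - lie y x.
Proof.
apply/eqP; rewrite -addr_eq0; apply/eqP; have := liexx (x + y).
by rewrite lieD_r !lieD_l !liexx add0r addr0 addrC.
Qed.

(* The derivation D of /\(h) with D y = [x, y], read off from the algebra map
   into upper triangular matrices a |-> [[a, D a], [0, a]]. *)
Definition derivation_gen x y : 'M[ext h]_2 :=
  \matrix_(i, j) (if i == j then ext_gen y
                  else if i == 0 then ext_gen (lie x y) else 0).
Definition derivation_mx x : ext h -> 'M[ext h]_2 :=
  palg_lift (fun c => (c%:A)%:M) (derivation_gen x).
Definition ext_derivation x a : ext h := derivation_mx x a 0 1.

Let derR x t u : @ext_rel K h t u ->
  aeval (fun c => (c%:A)%:M : 'M[ext h]_2) (derivation_gen x) t =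
  aeval (fun c => (c%:A)%:M : 'M[ext h]_2) (derivation_gen x) u.
Proof.
apply: ext_rel_lift => [|c y z|y]; first by rewrite scale0r raddf0.
- apply/matrixP => i j; rewrite -mulmxE mul_scalar_mx !mxE lie_linearr !ext_gen_linear.
  by case: ifP => _; first rewrite -scalerAl mul1r //; case: ifP => _;
    rewrite ?mulr0 ?addr0 // -scalerAl mul1r.
- apply/matrixP => i j; rewrite -mulmxE !mxE !big_ord_recl big_ord0 addr0 !mxE.
  rewrite (_ : lift ord0 ord0 = 1); last exact/val_inj.
  case: i => [[|[|//]] ?]; case: j => [[|[|//]] ?] /=;
    rewrite ?ext_gen_sqr ?mul0r ?mulr0 ?addr0 //.
  by rewrite ext_gen_anticomm addNr.
Qed.

Let derM x a b : derivation_mx x (a * b) = derivation_mx x a * derivation_mx x b.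
Proof. exact: (palg_liftM (alg_mx_central _) (derR x)). Qed.
Let derD x a b : derivation_mx x (a + b) = derivation_mx x a + derivation_mx x b.
Proof. exact: (palg_liftD (alg_mx_central _) (derR x)). Qed.
Let derZ x c a : derivation_mx x (c *: a) = c%:A *: derivation_mx x a.
Proof.
by rewrite [LHS](palg_liftZ (alg_mx_central _) (derR x)) -mulmxE mul_scalar_mx.
Qed.
Let derG x y : derivation_mx x (ext_gen y) = derivation_gen x y.
Proof. exact: (palg_lift_gen (alg_mx_central _) (derR x)). Qed.
Let der1 x : derivation_mx x 1 = 1.
Proof. exact: (palg_lift1 (alg_mx_central _) (derR x)). Qed.

Let derC x a : [/\ derivation_mx x a 0 0 = a, derivation_mx x a 1 1 = a
  & derivation_mx x a 1 0 = 0].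
Proof.
elim/ext_ind: a => [c|a b [e1 o1 z1] [e2 o2 z2]|a b [e1 o1 z1] [e2 o2 z2]|y].
- by rewrite derZ der1 !mxE mulr0 /= mulr1.
- by rewrite derD !mxE e1 e2 o1 o2 z1 z2 addr0.
- rewrite derM -mulmxE !mxE !big_ord_recl !big_ord0 !addr0.
  rewrite (_ : lift ord0 ord0 = 1); last exact/val_inj.
  by rewrite e1 e2 o1 o2 z1 z2 !(mul0r, mulr0, addr0, add0r).
- by rewrite derG !mxE.
Qed.

Lemma ext_derivation_gen x y : ext_derivation x (ext_gen y) = ext_gen (lie x y).
Proof. by rewrite /ext_derivation derG mxE. Qed.
Lemma ext_derivationM x a b :
  ext_derivation x (a * b) = ext_derivation x a * b + a * ext_derivation x b.
Proof.
rewrite /ext_derivation derM -mulmxE !mxE !big_ord_recl !big_ord0 !addr0.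
rewrite (_ : lift ord0 ord0 = 1); last exact/val_inj.
by have [-> _ _] := derC x a; have [_ -> _] := derC x b; rewrite addrC.
Qed.
Lemma ext_derivation_linear x : linear (ext_derivation x).
Proof.
by move=> c a b; rewrite /ext_derivation derD derZ !mxE -scalerAl mul1r.
Qed.
Lemma ext_derivation1 x : ext_derivation x 1 = 0.
Proof. by rewrite /ext_derivation der1 mxE. Qed.

Definition ext_derivation_endo x : endo (ext h) := Endo (ext_derivation_linear x).

Definition uea_act (v : uea h) (a : ext h) : ext h :=
  palg_lift (@endo_scal K (ext h)) ext_derivation_endo v a.

Let derScal x c : ext_derivation x c%:A = 0.
Proof.
have := ext_derivation_linear x c 1 0.
by rewrite (linear_0 (ext_derivation_linear x)) !addr0 ext_derivation1 scaler0.
Qed.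

Let actR t u : @uea_rel K h t u ->
  aeval (@endo_scal K (ext h)) ext_derivation_endo t =
  aeval (@endo_scal K (ext h)) ext_derivation_endo u.
Proof.
have dD z := linear_D (ext_derivation_linear z).
apply: uea_rel_lift => [c x y|x y]; apply: endoP => a /=.
- elim/ext_ind: a => [d|a b ha hb|a b ha hb|z].
  + by rewrite !derScal scaler0 addr0.
  + by rewrite !dD ha hb scalerDr addrACA.
  + rewrite !ext_derivationM ha hb scalerDr mulrDl mulrDr.
    by rewrite -scalerAl -scalerAr addrACA.
  + by rewrite !ext_derivation_gen lie_linearl ext_gen_linear.
- elim/ext_ind: a => [d|a b ha hb|a b ha hb|z].
  + by rewrite !derScal !(linear_0 (ext_derivation_linear _)) addr0.
  + by rewrite !dD ha hb addrACA.
  + rewrite !ext_derivationM !dD !ext_derivationM ha hb !mulrDl !mulrDr.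
    by rewrite [RHS](AC ((2*2)*2)%AC (((1*5)*3)*(2*(4*6)))%AC).
  + rewrite !ext_derivation_gen -(linear_D (@ext_gen_linear _ h)); congr ext_gen.
    have := lie_jacobi x y z; rewrite (lie_anti z x) (lie_anti z (lie x y)) lieN_r.
    by move/eqP; rewrite -addrA -opprD subr_eq0 => /eqP.
Qed.

Lemma uea_act_gen x a : uea_act (uea_gen x) a = ext_derivation x a.
Proof. by rewrite /uea_act (palg_lift_gen (endo_scal_central _) actR). Qed.
Lemma uea_act1 a : uea_act 1 a = a.
Proof.
rewrite /uea_act (palg_lift1 (endo_scal_central _) actR).
exact: scale1r.
Qed.
Lemma uea_actM v w a : uea_act (v * w) a = uea_act v (uea_act w a).
Proof. by rewrite /uea_act (palg_liftM (endo_scal_central _) actR). Qed.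
Lemma uea_act_bilinear : bilinear uea_act.
Proof.
split=> [a c v w|v]; last exact: endo_linear.
rewrite /uea_act (palg_liftD (endo_scal_central _) actR).
by rewrite (palg_liftZ (endo_scal_central _) actR).
Qed.
End Action.

(* The algebra maps U(h) -> U(h) and /\(h) -> /\(h) extending a Lie algebra
   map f. *)
Section Functoriality.
Variables (K : fieldType) (h : lieAlgType K) (f : h -> h).

Definition uea_map : uea h -> uea h :=
  palg_lift (fun c => c%:A) (fun x => uea_gen (f x)).
Definition ext_map : ext h -> ext h :=
  palg_lift (fun c => c%:A) (fun x => ext_gen (f x)).

Section Theory.
Hypotheses (f_lin : linear f) (f_lie : forall x y, f (lie x y) = lie (f x) (f y)).

Let umapR t u : @uea_rel K h t u ->
  aeval (fun c => c%:A) (fun x => uea_gen (f x)) t =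
  aeval (fun c => c%:A) (fun x => uea_gen (f x)) u.
Proof.
apply: uea_rel_lift => [c x y|x y].
- by rewrite f_lin uea_gen_linear -scalerAl mul1r.
- by rewrite f_lie uea_genM.
Qed.
Let emapR t u : @ext_rel K h t u ->
  aeval (fun c => c%:A) (fun x => ext_gen (f x)) t =
  aeval (fun c => c%:A) (fun x => ext_gen (f x)) u.
Proof.
apply: ext_rel_lift => [|c x y|x]; first exact: scale0r.
- by rewrite f_lin ext_gen_linear -scalerAl mul1r.
- by rewrite ext_gen_sqr.
Qed.

Lemma uea_map_gen x : uea_map (uea_gen x) = uea_gen (f x).
Proof. exact: (palg_lift_gen (alg_central _) umapR). Qed.
Lemma uea_map1 : uea_map 1 = 1.
Proof. exact: (palg_lift1 (alg_central _) umapR). Qed.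
Lemma uea_mapM : {morph uea_map : v w / v * w}.
Proof. exact: (palg_liftM (alg_central _) umapR). Qed.
Lemma uea_map_linear : linear uea_map.
Proof.
move=> c a b; rewrite /uea_map (palg_liftD (alg_central _) umapR).
by rewrite (palg_liftZ (alg_central _) umapR) -scalerAl mul1r.
Qed.

Lemma ext_map_gen x : ext_map (ext_gen x) = ext_gen (f x).
Proof. exact: (palg_lift_gen (alg_central _) emapR). Qed.
Lemma ext_map1 : ext_map 1 = 1.
Proof. exact: (palg_lift1 (alg_central _) emapR). Qed.
Lemma ext_mapM : {morph ext_map : v w / v * w}.
Proof. exact: (palg_liftM (alg_central _) emapR). Qed.
Lemma ext_map_linear : linear ext_map.
Proof.
move=> c a b; rewrite /ext_map (palg_liftD (alg_central _) emapR).
by rewrite (palg_liftZ (alg_central _) emapR) -scalerAl mul1r.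
Qed.
End Theory.
End Functoriality.

Definition span (K : fieldType) (V : lmodType K) (G : V -> Prop) (x : V) : Prop :=
  exists s : seq (K * V),
    (forall q, q \in s -> G q.2) /\ x = \sum_(q <- s) q.1 *: q.2.

Definition subspace (K : fieldType) (V : lmodType K) (P : V -> Prop) : Prop :=
  P 0 /\ forall (c : K) x y, P x -> P y -> P (c *: x + y).

(* F k r is the filtration step V_k^r, and V_k is the union of the V_k^r. *)
Section FilteredDGHopf.
Variables (K : fieldType) (V : lmodType K) (F : nat -> nat -> V -> Prop).

Definition homog (k : nat) (x : V) : Prop := exists r, F k r x.

Record filtered_graded : Prop := FilteredGraded {
  fg_subspace : forall k r, subspace (F k r);
  fg_increasing : forall k r s x, (r <= s)%N -> F k r x -> F k s x;
  fg_generate : forall x, exists n (f : nat -> V),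
    (forall k, homog k (f k)) /\ x = \sum_(k < n) f k;
  fg_independent : forall n (f : nat -> V), (forall k, homog k (f k)) ->
    \sum_(k < n) f k = 0 -> forall k, (k < n)%N -> f k = 0 }.

Variables (mul : V -> V -> V) (one : V) (Delta : V -> tensor V V) (eps : V -> K)
  (S : V -> V) (d : V -> V).

(* The product m2 and the differential d2 of V ⊗ V.  The signs refer to
   homogeneous elements only; as these span V, m2 and d2 are unique. *)
Definition signed_mul (m2 : tensor V V -> tensor V V -> tensor V V) : Prop :=
  bilinear m2 /\
  forall i j x y x' y', homog i y -> homog j x' ->
    m2 (x ⊗ y) (x' ⊗ y') = (-1) ^+ (i * j) *: (mul x x' ⊗ mul y y').

Definition signed_diff (d2 : tensor V V -> tensor V V) : Prop :=
  linear d2 /\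
  forall i x y, homog i x ->
    d2 (x ⊗ y) = d x ⊗ y + (-1) ^+ i *: (x ⊗ d y).

Record graded_hopf : Prop := GradedHopf {
  gh_mul_bilinear : bilinear mul;
  gh_mulA : associative mul;
  gh_mul1l : left_id one mul;
  gh_mul1r : right_id one mul;
  gh_coprod_linear : linear Delta;
  gh_coassoc : forall x,
    tassoc (tmap Delta id (Delta x)) = tmap id Delta (Delta x);
  gh_counit_linear : scalar eps;
  gh_counitl : forall x, tlift (fun x1 x2 => eps x1 *: x2) (Delta x) = x;
  gh_counitr : forall x, tlift (fun x1 x2 => eps x2 *: x1) (Delta x) = x;
  gh_coprod1 : Delta one = one ⊗ one;
  gh_coprodM : exists m2, signed_mul m2 /\
    forall x y, Delta (mul x y) = m2 (Delta x) (Delta y);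
  gh_counit1 : eps one = 1;
  gh_counitM : {morph eps : x y / mul x y >-> x * y};
  gh_antipode_linear : linear S;
  gh_antipodel : forall x,
    tlift (fun x1 x2 => mul (S x1) x2) (Delta x) = eps x *: one;
  gh_antipoder : forall x,
    tlift (fun x1 x2 => mul x1 (S x2)) (Delta x) = eps x *: one }.

Record filtered_compat : Prop := FilteredCompat {
  fc_mul : forall i j s t x y,
    F i s x -> F j t y -> F (i + j) (s + t) (mul x y);
  fc_coprod : forall k r x, F k r x ->
    span (fun z => exists i j s t y y',
      [/\ (i + j = k)%N, (s + t = r)%N, F i s y, F j t y' & z = y ⊗ y'])
      (Delta x);
  fc_counit : forall k x, homog k.+1 x -> eps x = 0;
  fc_antipode : forall k r x, F k r x -> F k r (S x) }.

Record dg_compat : Prop := DGCompat {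
  dg_linear : linear d;
  dg_degree : forall k r x, F k.+1 r x -> F k r.+1 (d x);
  dg_degree0 : forall r x, F 0 r x -> d x = 0;
  dg_square : forall x, d (d x) = 0;
  dg_leibniz : forall i x y, homog i x ->
    d (mul x y) = mul (d x) y + (-1) ^+ i *: mul x (d y);
  dg_coleibniz : exists d2, signed_diff d2 /\
    forall x, Delta (d x) = d2 (Delta x) }.

Definition filtered_dg_hopf : Prop :=
  [/\ filtered_graded, graded_hopf, filtered_compat & dg_compat].
End FilteredDGHopf.

Record lie_representation (K : fieldType) (h : lieAlgType K) (H : groupType)
    (A : H -> h -> h) : Prop := LieRepresentation {
  rep_linear : forall p, linear (A p);
  rep_lie : forall p x y, A p (lie x y) = lie (A p x) (A p y);
  rep1 : forall x, A 1%g x = x;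
  repM : forall p q x, A (p * q)%g x = A p (A q x) }.

Section HopfSpace.
Variables (K : fieldType) (h : lieAlgType K) (H : groupType).

Definition uea_filt (r : nat) : uea h -> Prop :=
  span (fun v => exists s : seq h,
    (size s <= r)%N /\ v = \prod_(x <- s) uea_gen x).

Definition ext_deg (k : nat) : ext h -> Prop :=
  span (fun a => exists s : seq h,
    size s = k /\ a = \prod_(x <- s) ext_gen x).

Definition hopf_space : Type := gsum H (tensor (uea h) (ext h)).
HB.instance Definition _ := GRing.Lmodule.on hopf_space.

Definition hpure (p : H) (x : tensor (uea h) (ext h)) : hopf_space := gpure p x.

Definition hopf_filt (k r : nat) : hopf_space -> Prop :=
  span (fun y => exists p v a,
    [/\ uea_filt r v, ext_deg k a & y = hpure p (v ⊗ a)]).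
End HopfSpace.
Arguments hopf_space {K} h H.
Arguments hopf_filt {K} h H k r.

(* Main.v *)
(* In the algebra to be constructed, (p, v ⊗ a) is the product a p v, where the
   elements x of h in degree 0, y of h in degree 1 and p of H satisfy
   p x = A_p(x) p, p y = A_p(y) p and x y = y x + [x, y].  Left multiplications
   by these generators are explicit endomorphisms Lu x, Le y and Lp p of the
   underlying space; since they satisfy the defining relations, U(h) and /\(h)
   act, and the action defines the product.  As every element is obtained from
   the unit by applying such endomorphisms, each identity reduces to the way its
   terms commute with them: if sigma is the parity automorphism, the coproduct
   turns Le y into Le y ⊗ 1 + sigma ⊗ Le y, the antipode satisfies
   S(y X) = - sigma(S(X)) y, and the differential is determined by d(1) = 0 and
   d Le y = Lu y - Le y d, d Lu x = Lu x d, d Lp p = Lp p d. *)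

Require Import Defs.
From HB Require Import structures.
From mathcomp Require Import all_boot all_algebra.

Set Implicit Arguments.
Unset Strict Implicit.
Unset Printing Implicit Defensive.

Import GRing.Theory.
Local Open Scope ring_scope.

Arguments endo_fun : simpl never.

(** The stated product and antipode entangle Sweedler components, so checking an axiom on them
    directly would mean handling iterated coproducts of several factors at once. The product is
    therefore first an action on the space, and the Sweedler formulas of the theorem are recovered
    afterwards ([LUeaE], [hmul_formula], [hantipode_formula]). Koszul signs are a second obstacle:
    they depend on a degree, whereas a linear map on the whole space has no degree to consult. The
    graded axioms are first proved in a sign-free form with the linear operators [hsigma], [heven]
    and [hodd]; [filt_sigma] and [filt_parity] turn these into powers of -1 on homogeneous elements.
    Finally, the differential is not multiplicative, so the universal property of ∧(h) does not
    produce it directly. It is read off as the off-diagonal entry of a multiplicative map from ∧(h)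
    into operators on pairs. *)

Section Endo.
Variables (K : fieldType) (V : lmodType K).
Implicit Types (f g : endo V) (v : V).

HB.instance Definition _ f :=
  GRing.isLinear.Build K V V *:%R (endo_fun f) (@endo_linear K V f).
Lemma endo_addE f g v : (f + g) v = f v + g v. Proof. by []. Qed.
Lemma endo_oppE f v : (- f) v = - f v. Proof. by []. Qed.
Lemma endo_mulE f g v : (f * g) v = f (g v). Proof. by []. Qed.
Lemma endo_1E v : (1 : endo V) v = v. Proof. exact: scale1r. Qed.
Lemma endo_0E v : (0 : endo V) v = 0. Proof. exact: scale0r. Qed.
Lemma endo_scalE c v : endo_scal V c v = c *: v. Proof. by []. Qed.
Definition endoE :=
  (endo_addE, endo_oppE, endo_mulE, endo_1E, endo_0E, endo_scalE).

End Endo.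

(** * Linear maps and operators on tensor products *)

Section Tensor.
Variables (K : fieldType).
Implicit Types (V W Z : lmodType K).

HB.instance Definition _ V W (v : V) :=
  GRing.isLinear.Build K W (tensor V W) *:%R (tpure v) ((tpure_bilinear V W).2 v).
Lemma tpureDl V W (w : W) : {morph (fun v : V => v ⊗ w) : x y / x + y}.
Proof. exact: linear_D ((tpure_bilinear V W).1 w). Qed.

Lemma tpureZl V W (w : W) c (v : V) : (c *: v) ⊗ w = c *: (v ⊗ w).
Proof.
have L := (tpure_bilinear V W).1 w.
by have := L c v 0; rewrite (linear_0 L) !addr0.
Qed.

Lemma tpure0l V W (w : W) : (0 : V) ⊗ w = 0.
Proof. exact: linear_0 ((tpure_bilinear V W).1 w). Qed.
Lemma tpureNl V W (w : W) (v : V) : (- v) ⊗ w = - (v ⊗ w).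
Proof. by rewrite -scaleN1r tpureZl scaleN1r. Qed.
Lemma tensor_eq V W Z (f g : {linear tensor V W -> Z}) :
  (forall v w, f (v ⊗ w) = g (v ⊗ w)) -> f =1 g.
Proof. by apply: linear_eq; apply: linearP. Qed.

Lemma bil_comp V V' W W' Z (f : V' -> W' -> Z) (g : {linear V -> V'})
    (g' : {linear W -> W'}) :
  Defs.bilinear f -> Defs.bilinear (fun v w => f (g v) (g' w)).
Proof. by move=> [f1 f2]; split=> ? c u v; rewrite linearP ?f1 ?f2. Qed.

Lemma bil_add V W Z (f g : V -> W -> Z) :
  Defs.bilinear f -> Defs.bilinear g -> Defs.bilinear (fun v w => f v w + g v w).
Proof.
move=> [f1 f2] [g1 g2].
by split=> ? c u v; rewrite ?f1 ?f2 ?g1 ?g2 scalerDr addrACA.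
Qed.

Lemma tliftP V W Z (f : V -> W -> Z) c s t :
  Defs.bilinear f -> tlift f (c *: s + t) = c *: tlift f s + tlift f t.
Proof. by move=> fB; apply: tlift_linear. Qed.
Lemma tlift0 V W Z (f : V -> W -> Z) : Defs.bilinear f -> tlift f 0 = 0.
Proof. by move=> fB; apply: linear_0 (tlift_linear fB). Qed.
Lemma tliftD V W Z (f : V -> W -> Z) s t :
  Defs.bilinear f -> tlift f (s + t) = tlift f s + tlift f t.
Proof. by move=> fB; apply: linear_D (tlift_linear fB) s t. Qed.

Lemma eq_tlift (V W Z : lmodType K) (f g : V -> W -> Z) t :
  (forall v w, f v w = g v w) -> tlift f t = tlift g t.
Proof.
by move=> fg; rewrite (@tlift_comb K V W Z f g g 0) ?scale0r ?add0r // => v w;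
  rewrite scale0r add0r.
Qed.

Lemma tlift_add V W Z (f g : V -> W -> Z) t :
  tlift (fun v w => f v w + g v w) t = tlift f t + tlift g t.
Proof.
by rewrite (@tlift_comb K V W Z _ f g 1) ?scale1r // => v w; rewrite scale1r.
Qed.

Lemma tlift_const0 (V1 V2 Z : lmodType K) (t : tensor V1 V2) :
  tlift (fun _ _ => 0 : Z) t = 0.
Proof.
(* The sum T satisfies T = -T + T, because 0 = (-1) 0 + 0 holds in each summand. *)
by rewrite (@tlift_comb K V1 V2 Z _ (fun _ _ => 0) (fun _ _ => 0) (-1))
  ?scaleN1r ?addNr // => *; rewrite scaler0 addr0.
Qed.

Lemma tlift_comp (V W Z Z' : lmodType K) (g : {linear Z -> Z'})
    (f : V -> W -> Z) t :
  Defs.bilinear f -> g (tlift f t) = tlift (fun v w => g (f v w)) t.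
Proof.
move=> [f1 f2].
have fB : Defs.bilinear f by [].
have gfB : Defs.bilinear (fun v w => g (f v w)).
  by split=> ? c u v /=; rewrite ?f1 ?f2 linearP.
elim/tensor_ind: t => [|c x y Ex Ey|v w].
- by rewrite (linear_0 (tlift_linear fB)) (linear_0 (tlift_linear gfB)) linear0.
- by rewrite (tlift_linear fB) (tlift_linear gfB) linearP Ex Ey.
- by rewrite !tliftE.
Qed.

Lemma tmap_bilinear V V' W W' (f : {linear V -> V'}) (g : {linear W -> W'}) :
  Defs.bilinear (fun v w => f v ⊗ g w).
Proof. split=> [w c u v|v c u u'] /=; last by rewrite !linearP.
by rewrite linearP tpureDl tpureZl.
Qed.

HB.instance Definition _ V V' W W' (f : {linear V -> V'}) (g : {linear W -> W'}) :=
  GRing.isLinear.Build K (tensor V W) (tensor V' W') *:%R (tmap f g)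
    (tlift_linear (tmap_bilinear f g)).
Lemma tmapE V V' W W' (f : {linear V -> V'}) (g : {linear W -> W'}) v w :
  tmap f g (v ⊗ w) = f v ⊗ g w.
Proof. exact: tliftE (tmap_bilinear f g). Qed.

(* Operators are extracted from existence lemmas closed by Qed, because
   unification would otherwise unfold them down to the presented modules. *)
Lemma tendo_sig V W (f : endo V) (g : endo W) :
  {F : endo (tensor V W) | forall v w, F (v ⊗ w) = f v ⊗ g w}.
Proof. by exists (Endo (tlift_linear (tmap_bilinear f g))); apply: tmapE. Qed.

Definition tendo V W f g : endo (tensor V W) := sval (tendo_sig f g).
Definition tendoE V W (f : endo V) (g : endo W) v w :
  tendo f g (v ⊗ w) = f v ⊗ g w := svalP (tendo_sig f g) v w.
Lemma tendo_eq V W (f g : endo (tensor V W)) :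
  (forall v w, f (v ⊗ w) = g (v ⊗ w)) -> f = g.
Proof. by move=> fg; apply: endoP; apply: tensor_eq. Qed.
Lemma tendoM V W (f f' : endo V) (g g' : endo W) :
  tendo f g * tendo f' g' = tendo (f * f') (g * g').
Proof. by apply: tendo_eq => v w /=; rewrite endoE !tendoE !endoE. Qed.
Lemma tendoDl V W (f f' : endo V) (g : endo W) :
  tendo (f + f') g = tendo f g + tendo f' g.
Proof. by apply: tendo_eq => v w /=; rewrite endoE !tendoE !endoE tpureDl. Qed.
Lemma tendoDr V W (f : endo V) (g g' : endo W) :
  tendo f (g + g') = tendo f g + tendo f g'.
Proof. by apply: tendo_eq => v w /=; rewrite endoE !tendoE !endoE linearD. Qed.
Lemma tendoNl V W (f : endo V) (g : endo W) : tendo (- f) g = - tendo f g.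
Proof. by apply: tendo_eq => v w /=; rewrite endoE !tendoE !endoE tpureNl. Qed.
Lemma tendoNr V W (f : endo V) (g : endo W) : tendo f (- g) = - tendo f g.
Proof. by apply: tendo_eq => v w /=; rewrite endoE !tendoE !endoE linearN. Qed.
Lemma tendo1 V W : tendo (1 : endo V) (1 : endo W) = 1.
Proof. by apply: tendo_eq => v w /=; rewrite tendoE !endoE. Qed.

Lemma tlift_tendo V W Z (f : V -> W -> Z) (g : endo V) (g' : endo W) t :
  Defs.bilinear f -> tlift f (tendo g g' t) = tlift (fun v w => f (g v) (g' w)) t.
Proof.
move=> fB; have fB' := bil_comp g g' fB.
by elim/tensor_ind: t => [|c s t Es Et|v w];
  rewrite ?linear0 ?tlift0 // ?linearP ?tliftP ?Es ?Et // tendoE !tliftE.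
Qed.

Lemma tassoc_bil V W Z : Defs.bilinear
  (fun t (z : Z) => tlift (fun (v : V) (w : W) => v ⊗ (w ⊗ z)) t).
Proof.
have B z : Defs.bilinear (fun (v : V) (w : W) => v ⊗ (w ⊗ z)).
  by split=> [w c u v|v c u w]; rewrite tpureDl tpureZl // linearP.
split=> [z|t c z z']; first exact: tlift_linear.
by apply: tlift_comb => v w; rewrite !linearP.
Qed.

HB.instance Definition _ V W Z := GRing.isLinear.Build K _ _ *:%R
  (@tassoc K V W Z) (tlift_linear (@tassoc_bil V W Z)).

Lemma tassocE V W Z (v : V) (w : W) (z : Z) : tassoc (v ⊗ w ⊗ z) = v ⊗ (w ⊗ z).
Proof.
rewrite [LHS](tliftE _ _ (@tassoc_bil V W Z)) tliftE //.
by split=> [w' c u v'|v' c u w']; rewrite tpureDl tpureZl // linearP.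
Qed.

Lemma tassoc_tendo V W Z (f : endo V) (g : endo W) (k : endo Z) t :
  tassoc (tendo (tendo f g) k t) = tendo f (tendo g k) (tassoc t).
Proof.
elim/tensor_ind: t => [|c s t Es Et|s z]; first by rewrite !linear0.
- by rewrite !linearP /= Es Et.
- rewrite tendoE; elim/tensor_ind: s => [|c s t Es Et|v w].
  + by rewrite !linear0 !tpure0l !linear0.
  + by rewrite linearP !tpureDl !tpureZl !linearP /= Es Et.
  + by rewrite tendoE !tassocE !tendoE.
Qed.

End Tensor.

(** * Spans and subspaces *)

Section Span.
Variables (K : fieldType) (W : lmodType K).
Implicit Types (G P : W -> Prop) (z : W).

Lemma span_gen G z : G z -> Defs.span G z.
Proof.
move=> Gz; exists [:: (1, z)]; split; last by rewrite big_seq1 scale1r.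
by move=> q; rewrite inE => /eqP->.
Qed.

Lemma span_subspace G : subspace (Defs.span G).
Proof.
split; first by exists [::]; split=> //; rewrite big_nil.
move=> c z z' [s [sG ->]] [t [tG ->]].
exists ([seq (c * u.1, u.2) | u <- s] ++ t); split.
- by move=> q; rewrite mem_cat => /orP[/mapP[r rs ->]|/tG//]; exact: (sG r).
- rewrite big_cat big_map scaler_sumr; congr (_ + _).
  by apply: eq_bigr => q _; rewrite scalerA.
Qed.

Lemma span_ind G P : subspace P -> (forall z, G z -> P z) ->
  forall z, Defs.span G z -> P z.
Proof.
move=> [P0 PD] GP z [s [sG ->]]; elim: s sG => [|q s IHs] sG.
- by rewrite big_nil.
- rewrite big_cons; apply: PD; first by apply/GP/sG/mem_head.
  by apply: IHs => r rs; apply: sG; rewrite inE rs orbT.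
Qed.

Lemma subspaceD P z z' : subspace P -> P z -> P z' -> P (z + z').
Proof. by move=> [_ PD] Pz Pw; rewrite -[z]scale1r; apply: PD. Qed.
Lemma subspaceZ P c z : subspace P -> P z -> P (c *: z).
Proof. by move=> [P0 PD] Pz; rewrite -[_ *: _]addr0; apply: PD. Qed.
Lemma subspaceN P z : subspace P -> P z -> P (- z).
Proof. by move=> PS Pz; rewrite -scaleN1r; apply: subspaceZ. Qed.

Lemma subspace_preim (W' : lmodType K) (f : {linear W' -> W}) P :
  subspace P -> subspace (fun u => P (f u)).
Proof.
move=> [P0 PD]; split=> [|c z z' Pz Pw]; first by rewrite linear0.
by rewrite linearP; apply: PD.
Qed.

Lemma subspace_eq (W' : lmodType K) (f g : {linear W' -> W}) :
  subspace (fun u => f u = g u).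
Proof.
by split=> [|c z z' Ez Ew]; rewrite ?linear0 // !linearP Ez Ew.
Qed.

End Span.

(** Meant for the hatted products of the differential: an omitted factor is encoded by a predicate
    on the indices, so peeling off index 0 leaves a conditional that says whether this factor was
    omitted. *)
Lemma prod_recl_cond (R : pzRingType) n (P : pred 'I_n.+1) (F : 'I_n.+1 -> R) :
  \prod_(l | P l) F l = (if P ord0 then F ord0 else 1) *
    \prod_(l | P (lift ord0 l)) F (lift ord0 l).
Proof. by rewrite big_mkcond big_ord_recl -big_mkcond. Qed.

Lemma sum_recl_cond (Z : nmodType) n (P : pred 'I_n.+1) (F : 'I_n.+1 -> Z) :
  \sum_(l | P l) F l = (if P ord0 then F ord0 else 0) +
    \sum_(l | P (lift ord0 l)) F (lift ord0 l).
Proof. by rewrite big_mkcond big_ord_recl -big_mkcond. Qed.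

(** * The enveloping and the exterior algebra *)

Section Algebras.
Variables (K : fieldType) (h : lieAlgType K).
Local Notation U := (uea h).
Local Notation E := (ext h).
Implicit Types (x y : h) (v w : U) (a b : E).

(** [uea_ind] splits products at an arbitrary place, while all later arguments strip generators from
    the left. Proving P (v * u) for every u with P u turns the product case into associativity. *)
Lemma uea_lind (P : uea h -> Prop) :
  P 1 -> (forall c v w, P v -> P w -> P (c *: v + w)) ->
  (forall x v, P v -> P (uea_gen x * v)) -> forall v, P v.
Proof.
move=> P1 PL Pg v; rewrite -[v]mulr1; elim/uea_ind: v (1) P1 => /=.
(* P 0 is read off from -v + v, and c v is then treated as c v + 0. *)
- by move=> c v Pv; rewrite mulr_algl -[_ *: _]addr0; apply: (PL) => //;
    rewrite -(subrr v) addrC -scaleN1r; apply: PL.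
- by move=> v w Pv Pw u Pu; rewrite mulrDl -[v * u]scale1r; apply: PL; auto.
- by move=> v w Pv Pw u Pu; rewrite -mulrA; auto.
- by move=> x v; apply: Pg.
Qed.

Lemma ext_lind (P : ext h -> Prop) :
  P 1 -> (forall c a b, P a -> P b -> P (c *: a + b)) ->
  (forall x a, P a -> P (ext_gen x * a)) -> forall a, P a.
Proof.
move=> P1 PL Pg a; rewrite -[a]mulr1; elim/ext_ind: a (1) P1 => /=.
- by move=> c a Pa; rewrite mulr_algl -[_ *: _]addr0; apply: (PL) => //;
    rewrite -(subrr a) addrC -scaleN1r; apply: PL.
- by move=> a b Pa Pb u Pu; rewrite mulrDl -[a * u]scale1r; apply: PL; auto.
- by move=> a b Pa Pb u Pu; rewrite -mulrA; auto.
- by move=> x a; apply: Pg.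
Qed.

HB.instance Definition _ := GRing.isLinear.Build K h (uea h) *:%R
  (@uea_gen K h) (@uea_gen_linear K h).
HB.instance Definition _ := GRing.isLinear.Build K h (ext h) *:%R
  (@ext_gen K h) (@ext_gen_linear K h).
HB.instance Definition _ := GRing.isLinear.Build K (uea h) (uea h) *:%R
  (@uea_antipode K h) (@uea_antipode_linear K h).
HB.instance Definition _ := GRing.isLinear.Build K (ext h) (ext h) *:%R
  (@ext_antipode K h) (@ext_antipode_linear K h).
HB.instance Definition _ := GRing.isLinear.Build K (ext h) (ext h) *:%R
  (@ext_even K h) (@ext_even_linear K h).
HB.instance Definition _ := GRing.isLinear.Build K (ext h) (ext h) *:%R
  (@ext_odd K h) (@ext_odd_linear K h).
HB.instance Definition _ := GRing.isLinear.Build K (uea h) _ *:%R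
  (@uea_coprod K h) (@uea_coprod_linear K h).
HB.instance Definition _ := GRing.isLinear.Build K (ext h) _ *:%R
  (@ext_coprod K h) (@ext_coprod_linear K h).
HB.instance Definition _ x := GRing.isLinear.Build K (ext h) (ext h) *:%R
  (@ext_derivation K h x) (@ext_derivation_linear K h x).
HB.instance Definition _ v := GRing.isLinear.Build K (ext h) (ext h) *:%R
  (@uea_act K h v) ((@uea_act_bilinear K h).2 v).
Lemma uea_mulr_linear (v : uea h) : linear ( *%R v).
Proof. by move=> c u w; rewrite mulrDr scalerAr. Qed.
Lemma ext_mulr_linear (a : ext h) : linear ( *%R a).
Proof. by move=> c u w; rewrite mulrDr scalerAr. Qed.
Definition uea_lmul v : endo (uea h) := Endo (uea_mulr_linear v).
Definition ext_lmul a : endo (ext h) := Endo (ext_mulr_linear a).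

Lemma ext_endo_lind (f g : {linear E -> E}) :
  f 1 = g 1 -> (forall x a, f a = g a -> f (ext_gen x * a) = g (ext_gen x * a)) ->
  f =1 g.
Proof.
move=> f1 fg; elim/ext_lind => // c a b Ea Eb.
by rewrite !linearP Ea Eb.
Qed.

Lemma ext_endo_eq (f g : endo E) :
  f 1 = g 1 -> (forall x a, f a = g a -> f (ext_gen x * a) = g (ext_gen x * a)) ->
  f = g.
Proof. by move=> f1 fg; apply: endoP; apply: ext_endo_lind. Qed.

Lemma uea_actZDl c v w a : uea_act (c *: v + w) a = c *: uea_act v a + uea_act w a.
Proof. exact: (uea_act_bilinear h).1. Qed.

(** This is the relation xy = yx + [x, y] of U(h), transported through its action on ∧(h). *)
Lemma derivation_lie x y a : ext_derivation x (ext_derivation y a) =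
  ext_derivation y (ext_derivation x a) + ext_derivation (lie x y) a.
Proof.
rewrite -!uea_act_gen -!uea_actM uea_genM.
exact: (linear_D ((uea_act_bilinear h).1 a)).
Qed.

Lemma derivation_comb c x y a : ext_derivation (c *: x + y) a =
  c *: ext_derivation x a + ext_derivation y a.
Proof. by rewrite -!uea_act_gen linearP; apply: (uea_act_bilinear h).1. Qed.

(** Graded commutativity with a generator; the antipode supplies the sign (-1)^k on ∧^k without
    mentioning k. *)
Lemma ext_gen_comm x a : ext_gen x * a = ext_antipode a * ext_gen x.
Proof.
elim/ext_lind: a => [|c a b Ea Eb|y a Ea].
- by rewrite ext_antipode1 mulr1 mul1r.
- by rewrite linearP mulrDr mulrDl -scalerAr -scalerAl Ea Eb.
- rewrite ext_antipodeM ext_antipode_gen -mulrA -Ea !mulrA.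
  by rewrite ext_gen_anticomm !mulNr.
Qed.

Lemma ext_antipode_derivation x a :
  ext_antipode (ext_derivation x a) = ext_derivation x (ext_antipode a).
Proof.
apply: (ext_endo_lind (f := @ext_antipode K h \o ext_derivation x)
  (g := ext_derivation x \o @ext_antipode K h)) => [|y b /= IH] /=.
- by rewrite ext_derivation1 linear0 ext_antipode1 ext_derivation1.
- rewrite ext_derivationM linearD /= 3!ext_antipodeM ext_derivationM IH.
  by rewrite !(ext_derivation_gen, ext_antipode_gen) linearN /= ext_derivation_gen.
Qed.

Lemma ext_parity_derivation x a :
  (ext_even (ext_derivation x a) = ext_derivation x (ext_even a)) *
  (ext_odd (ext_derivation x a) = ext_derivation x (ext_odd a)).
Proof.
elim/ext_lind: a => [|c a b Ea Eb|y a Ea].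
- rewrite ext_derivation1 !linear0 ext_even1 ext_odd1 ext_derivation1.
  by rewrite linear0.
- by rewrite !linearP /= !Ea !Eb.
- rewrite ext_evenM ext_oddM ext_even_gen ext_odd_gen !mul0r !add0r.
  rewrite !ext_derivationM !ext_derivation_gen !linearD /=.
  by rewrite !(ext_evenM, ext_oddM) !ext_even_gen !ext_odd_gen !Ea !mul0r !add0r.
Qed.

(** The Leibniz rule, with each bracket moved to the front: passing j generators costs (-1)^j. These
    are the bracket terms with i = 0 in the differential. *)
Lemma derivation_prod x n (c : 'I_n -> h) :
  ext_derivation x (\prod_(l < n) ext_gen (c l)) =
  \sum_(j < n) (-1) ^+ j *:
    (ext_gen (lie x (c j)) * \prod_(l < n | l != j) ext_gen (c l)).
Proof.
elim: n c => [|n IHn] c; first by rewrite !big_ord0 ext_derivation1.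
rewrite !big_ord_recl ext_derivationM ext_derivation_gen expr0 scale1r IHn.
congr (_ * _ + _); first by rewrite prod_recl_cond eqxx mul1r.
rewrite mulr_sumr; apply: eq_bigr => j _.
rewrite prod_recl_cond neq_lift -scalerAr exprS mulN1r scaleNr -scalerN; congr (_ *: _).
rewrite !mulrA [X in X * _ = _]ext_gen_anticomm mulNr; congr (- (_ * _)).
Qed.

Lemma ext_counit_derivation x a : ext_counit (ext_derivation x a) = 0.
Proof.
elim/ext_lind: a => [|c a b Ea Eb|y a Ea].
- by rewrite ext_derivation1 (linear_0 (@ext_counit_linear K h : linear (_ : _ -> K^o))).
- by rewrite linearP ext_counit_linear Ea Eb mulr0 addr0.
- rewrite ext_derivationM (linear_D (@ext_counit_linear K h : linear (_ : _ -> K^o))).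
  by rewrite ext_derivation_gen !ext_counitM !ext_counit_gen !mul0r addr0.
Qed.

Lemma ext_counit_antipode a : ext_counit (ext_antipode a) = ext_counit a.
Proof.
elim/ext_lind: a => [|c a b Ea Eb|y a Ea].
- by rewrite ext_antipode1.
- by rewrite linearP !ext_counit_linear Ea Eb.
- rewrite ext_antipodeM ext_antipode_gen mulNr -mulrN.
  by rewrite !ext_counitM !ext_counit_gen !mul0r.
Qed.

(** The two terms reflect that x is primitive. With an arbitrary bilinear f the rule applies inside
    any Sweedler sum, and f can change along an induction on v. *)
Lemma tlift_uea_coprod (Z : lmodType K) (f : uea h -> uea h -> Z) x v :
  Defs.bilinear f ->
  tlift f (uea_coprod (uea_gen x * v)) =
  tlift (fun v1 v2 => f (uea_gen x * v1) v2 + f v1 (uea_gen x * v2)) (uea_coprod v).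
Proof.
move=> fB; have [f1 f2] := fB; rewrite uea_coprodM uea_coprod_gen.
have [m1 m2] := uea_tmul_bilinear h.
have gB : Defs.bilinear
    (fun v1 v2 => f (uea_gen x * v1) v2 + f v1 (uea_gen x * v2)).
  by split=> ? c u w /=; rewrite mulrDr -scalerAr ?f1 ?f2 scalerDr addrACA.
elim/tensor_ind: (uea_coprod v) => [|c s t Es Et|v1 v2].
- by rewrite (linear_0 (m2 _)) !(linear_0 (tlift_linear _)).
- by rewrite m2 !(tlift_linear fB, tlift_linear gB) Es Et.
- rewrite (linear_D (m1 _)) !uea_tmulE !mul1r (linear_D (tlift_linear fB)).
  by rewrite !tliftE.
Qed.

Lemma tlift_uea_coprodr (Z : lmodType K) (f : U -> U -> Z) v x :
  Defs.bilinear f ->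
  tlift f (uea_coprod (v * uea_gen x)) =
  tlift (fun v1 v2 => f (v1 * uea_gen x) v2 + f v1 (v2 * uea_gen x)) (uea_coprod v).
Proof.
move=> fB; have [f1 f2] := fB; rewrite uea_coprodM uea_coprod_gen.
have [m1 m2] := uea_tmul_bilinear h.
have gB : Defs.bilinear
    (fun v1 v2 => f (v1 * uea_gen x) v2 + f v1 (v2 * uea_gen x)).
  by split=> ? c u w /=; rewrite mulrDl -scalerAl ?f1 ?f2 scalerDr addrACA.
elim/tensor_ind: (uea_coprod v) => [|c s t Es Et|v1 v2].
- by rewrite (linear_0 (m1 _)) !(linear_0 (tlift_linear _)).
- by rewrite m1 !(tlift_linear fB, tlift_linear gB) Es Et.
- rewrite (linear_D (m2 _)) !uea_tmulE !mulr1 (linear_D (tlift_linear fB)).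
  by rewrite !tliftE.
Qed.

(** An antipode in general reverses the order of the two factors. Here the order is kept: the
    generators are primitive, so each induction step treats both factors alike. Multiplication by x
    moves from the right of S(v) to the left of v, which is why the right-handed rule is used as
    well. *)
Lemma tlift_coprod_antipode (Z : lmodType K) (f : U -> U -> Z) v :
  Defs.bilinear f ->
  tlift f (uea_coprod (uea_antipode v)) =
  tlift (fun v1 v2 => f (uea_antipode v1) (uea_antipode v2)) (uea_coprod v).
Proof.
elim/uea_lind: v f => [|c v w Ev Ew|x v Ev] f fB;
  have fB' := bil_comp (@uea_antipode K h) (@uea_antipode K h) fB.
- by rewrite uea_antipode1 uea_coprod1 !tliftE // !uea_antipode1.
- by rewrite !linearP !tliftP // Ev // Ew.
- rewrite uea_antipodeM uea_antipode_gen mulrN !linearN /=.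
  rewrite -scaleN1r -[_ *: _]addr0 tliftP // tlift0 // addr0 tlift_uea_coprodr //.
  rewrite Ev; last first.
    have [f1 f2] := fB; split=> ? c u w /=; rewrite mulrDl -scalerAl ?f1 ?f2.
    + by rewrite scalerDr addrACA.
    + by rewrite scalerDr addrACA.
  rewrite tlift_uea_coprod //.
  rewrite [RHS](@tlift_comb K _ _ _ _ (fun v1 v2 =>
    f (uea_antipode v1 * uea_gen x) (uea_antipode v2) +
    f (uea_antipode v1) (uea_antipode v2 * uea_gen x)) (fun _ _ => 0) (-1)).
    by rewrite (@tlift_comb K _ _ _ (fun _ _ => 0) (fun _ _ => 0) (fun _ _ => 0) (-1))
      ?scaleN1r ?addNr ?addr0 // => *; rewrite scaler0 addr0.
  move=> v1 v2; rewrite addr0 !uea_antipodeM uea_antipode_gen !mulrN scaleN1r opprD.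
  have [f1 f2] := fB; congr (_ + _).
    by rewrite -scaleN1r -[_ *: _]addr0 f1 (linear_0 (f1 _)) addr0 scaleN1r.
  by rewrite -scaleN1r -[_ *: _]addr0 f2 (linear_0 (f2 _)) addr0 scaleN1r.
Qed.

(** Again x is primitive, but in the term 1 ⊗ x it has to pass a1, whence the antipode on a1. *)
Lemma tlift_ext_coprod (Z : lmodType K) (f : ext h -> ext h -> Z) x a :
  Defs.bilinear f ->
  tlift f (ext_coprod (ext_gen x * a)) =
  tlift (fun a1 a2 => f (ext_gen x * a1) a2 + f (ext_antipode a1) (ext_gen x * a2))
    (ext_coprod a).
Proof.
move=> fB; have [f1 f2] := fB; rewrite ext_coprodM ext_coprod_gen.
have [m1 m2] := ext_tmul_bilinear h.
have gB : Defs.bilinear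
    (fun a1 a2 => f (ext_gen x * a1) a2 + f (ext_antipode a1) (ext_gen x * a2)).
  split=> ? c u w /=; first by rewrite linearP mulrDr -scalerAr !f1 scalerDr addrACA.
  by rewrite mulrDr -scalerAr ?f2 scalerDr addrACA.
elim/tensor_ind: (ext_coprod a) => [|c s t Es Et|a1 a2].
- by rewrite (linear_0 (m2 _)) !(linear_0 (tlift_linear _)).
- by rewrite m2 !(tlift_linear fB, tlift_linear gB) Es Et.
- rewrite (linear_D (m1 _)) !ext_tmulE ext_even1 ext_odd1 ext_even_gen ext_odd_gen.
  rewrite !(mul0r, mul1r) !linear0 addr0 add0r (linear_D (tlift_linear fB)).
  by rewrite !tliftE.
Qed.

(** The derivation [x, -] is also a coderivation, because it maps primitive generators to primitive
    generators and commutes with the sign operator that occurs in the coproduct of a product. *)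
Lemma tlift_coprod_derivation (Z : lmodType K) (f : E -> E -> Z) x a :
  Defs.bilinear f ->
  tlift f (ext_coprod (ext_derivation x a)) =
  tlift (fun a1 a2 => f (ext_derivation x a1) a2 + f a1 (ext_derivation x a2))
    (ext_coprod a).
Proof.
elim/ext_lind: a f => [|c a b Ea Eb|y a Ea] f fB;
  have fB' := bil_add (bil_comp (ext_derivation x) idfun fB)
    (bil_comp idfun (ext_derivation x) fB).
- rewrite ext_derivation1 linear0 tlift0 // ext_coprod1 tliftE //=.
  by rewrite ext_derivation1 (linear_0 (fB.1 _)) (linear_0 (fB.2 _)) addr0.
- by rewrite !linearP !tliftP // Ea // Eb.
- rewrite ext_derivationM ext_derivation_gen linearD tliftD //.
  rewrite !tlift_ext_coprod // Ea; last first.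
    apply: bil_add (bil_comp (ext_lmul _) idfun fB) _.
    exact: bil_comp (@ext_antipode K h) (ext_lmul _) fB.
  rewrite -tlift_add; apply: eq_tlift => a1 a2.
  rewrite !ext_derivationM !ext_derivation_gen ext_antipode_derivation.
  rewrite !(linear_D (fB.1 _)) !(linear_D (fB.2 _)).
  by rewrite [LHS](AC ((1*1)*((1*1)*(1*1)))%AC ((1*3*5)*(4*(2*6)))%AC).
Qed.

Lemma uea_filt_mono r s v : (r <= s)%N -> uea_filt r v -> uea_filt s v.
Proof.
move=> rs; apply: span_ind; first exact: span_subspace.
move=> _ [t [tr ->]]; apply: span_gen; exists t; split=> //.
exact: leq_trans tr rs.
Qed.

Lemma uea_filt_gen r x v : uea_filt r v -> uea_filt r.+1 (uea_gen x * v).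
Proof.
apply: (span_ind (P := fun v => uea_filt r.+1 (uea_gen x * v))).
  exact: (subspace_preim (uea_lmul (uea_gen x)) (span_subspace _)).
move=> _ [s [sr ->]]; apply: span_gen; exists (x :: s).
by rewrite big_cons.
Qed.

Lemma ext_deg_gen k x a : ext_deg k a -> ext_deg k.+1 (ext_gen x * a).
Proof.
apply: (span_ind (P := fun a => ext_deg k.+1 (ext_gen x * a))).
  exact: (subspace_preim (ext_lmul (ext_gen x)) (span_subspace _)).
move=> _ [s [sk ->]]; apply: span_gen; exists (x :: s).
by rewrite big_cons /= sk.
Qed.

Lemma ext_deg_derivation k x a : ext_deg k a -> ext_deg k (ext_derivation x a).
Proof.
apply: (span_ind (P := fun a => ext_deg k (ext_derivation x a))).
  exact: (subspace_preim (ext_derivation x) (span_subspace _)).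
move=> _ [s [<- ->]]; elim: s => [|y s IHs].
  by rewrite big_nil ext_derivation1; apply: (span_subspace _).1.
rewrite big_cons ext_derivationM ext_derivation_gen.
apply: subspaceD; [exact: span_subspace| |exact: ext_deg_gen].
by apply: span_gen; exists (lie x y :: s); rewrite big_cons.
Qed.

(* The coefficient of 'X^k is the component of degree k. *)
Definition ext_grade : E -> {poly E} :=
  palg_lift (B := {poly E}) (fun c => (c%:A)%:P) (fun x => (ext_gen x)%:P * 'X).

Let grade_central : central_map (fun c : K => (c%:A : E)%:P).
Proof.
have [s0 s1 sD sM sC] := alg_central E.
split=> [||c d|c d|c u].
- by rewrite s0.
- by rewrite s1.
- by rewrite sD polyCD.
- by rewrite sM polyCM.
- by apply/polyP => i; rewrite coefCM coefMC sC.
Qed.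

Let grade_rel t u : @ext_rel K h t u ->
  aeval (B := {poly E}) (fun c => (c%:A)%:P) (fun x => (ext_gen x)%:P * 'X) t =
  aeval (B := {poly E}) (fun c => (c%:A)%:P) (fun x => (ext_gen x)%:P * 'X) u.
Proof.
apply: ext_rel_lift => [|c x y|x]; first by rewrite scale0r.
- by rewrite linearP polyCD mulrDl /= mulrA -polyCM mulr_algl.
- rewrite -mulrA ['X * _]mulrA -commr_polyX !mulrA -polyCM.
  by rewrite ext_gen_sqr !mul0r.
Qed.

Lemma ext_grade_linear j : linear (fun a => (ext_grade a)`_j).
Proof.
move=> c a b; rewrite /ext_grade (palg_liftD grade_central grade_rel).
by rewrite (palg_liftZ grade_central grade_rel) coefD /= coefCM mulr_algl.
Qed.

Definition ext_proj j : endo E := Endo (ext_grade_linear j).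

Lemma ext_proj_prod j (s : seq h) : ext_proj j (\prod_(x <- s) ext_gen x) =
  if j == size s then \prod_(x <- s) ext_gen x else 0.
Proof.
have E : ext_grade (\prod_(x <- s) ext_gen x) =
    (\prod_(x <- s) ext_gen x)%:P * 'X^(size s).
  elim: s => [|x s IHs].
    by rewrite !big_nil mulr1; apply: (palg_lift1 grade_central grade_rel).
  rewrite !big_cons /ext_grade (palg_liftM grade_central grade_rel).
  rewrite (palg_lift_gen grade_central grade_rel) -/ext_grade IHs.
  by rewrite -mulrA ['X * _]mulrA -commr_polyX exprS polyCM !mulrA.
rewrite -[LHS]/((ext_grade _)`_j) E coefCM coefXn.
by case: eqP; rewrite ?mulr1 ?mulr0.
Qed.

End Algebras.

(** * The algebra [hopf_space h H] *)

Section Hopf.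
Variables (K : fieldType) (h : lieAlgType K) (H : groupType).
Variables (A : H -> h -> h) (hA : lie_representation A).
Local Notation U := (uea h).
Local Notation E := (ext h).
Local Notation V := (hopf_space h H).
Local Notation VV := (tensor V V).
Local Notation V2 := (V * V)%type.
Local Notation F := (hopf_filt h H).
Implicit Types (p q : H) (x y : h) (v w : U) (a b : E) (X Y Z : V).

HB.instance Definition _ (p : H) := GRing.isLinear.Build K _ (hopf_space h H) *:%R
  (@hpure K h H p) (gpure_linear p).

Lemma hopf_eq (Z : lmodType K) (f g : {linear V -> Z}) :
  (forall p v a, f (hpure p (v ⊗ a)) = g (hpure p (v ⊗ a))) -> f =1 g.
Proof.
move=> fg; elim/gsum_ind => [|c x y Ex Ey|p].
- by rewrite !linear0.
- by rewrite !linearP Ex Ey.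
- by apply: (tensor_eq (f := f \o hpure p) (g := g \o hpure p)); apply: fg.
Qed.

Lemma hopf_endo_eq (f g : endo V) :
  (forall p v a, f (hpure p (v ⊗ a)) = g (hpure p (v ⊗ a))) -> f = g.
Proof. by move=> fg; apply: endoP; apply: hopf_eq. Qed.

(** * The extensions of A_p to U(h) and ∧(h) *)

Lemma emap_sig p : {f : endo E | f =1 ext_map (A p)}.
Proof. by exists (Endo (ext_map_linear (rep_linear hA p))). Qed.
Lemma umap_sig p : {f : endo U | f =1 uea_map (A p)}.
Proof. by exists (Endo (uea_map_linear (rep_linear hA p) (rep_lie hA p))). Qed.
Definition emap p : endo E := sval (emap_sig p).
Definition umap p : endo U := sval (umap_sig p).
Definition emapE p : emap p =1 ext_map (A p) := svalP (emap_sig p).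
Definition umapE p : umap p =1 uea_map (A p) := svalP (umap_sig p).
Lemma emapM p a b : emap p (a * b) = emap p a * emap p b.
Proof. by rewrite !emapE; apply: ext_mapM (rep_linear hA p) _ _. Qed.
Lemma emap_gen p x : emap p (ext_gen x) = ext_gen (A p x).
Proof. by rewrite !emapE; apply: ext_map_gen (rep_linear hA p) x. Qed.
Lemma emap_1 p : emap p 1 = 1.
Proof. by rewrite !emapE; apply: ext_map1 (rep_linear hA p). Qed.
Lemma umapM p v w : umap p (v * w) = umap p v * umap p w.
Proof. by rewrite !umapE; apply: uea_mapM (rep_linear hA p) (rep_lie hA p) _ _. Qed.
Lemma umap_gen p x : umap p (uea_gen x) = uea_gen (A p x).
Proof. by rewrite umapE; apply: uea_map_gen (rep_linear hA p) (rep_lie hA p) x. Qed.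
Lemma umap_1 p : umap p 1 = 1.
Proof. by rewrite umapE; apply: uea_map1 (rep_linear hA p) (rep_lie hA p). Qed.

Lemma emap_id : emap 1%g = 1.
Proof.
apply: ext_endo_eq => [|x a IH].
- by rewrite emap_1 endoE.
- by rewrite emapM IH emap_gen (rep1 hA) !endoE.
Qed.

Lemma emap_mul p q : emap (p * q)%g = emap p * emap q.
Proof.
apply: ext_endo_eq => [|x a IH].
- by rewrite endoE !emap_1.
- by rewrite emapM IH !endoE !emapM !emap_gen (repM hA).
Qed.

Lemma emap_derivation p x a :
  emap p (ext_derivation x a) = ext_derivation (A p x) (emap p a).
Proof.
apply: (ext_endo_lind (f := emap p \o ext_derivation x)
  (g := ext_derivation (A p x) \o emap p)) => /= [|y b IH].
- by rewrite !ext_derivation1 linear0 emap_1 ext_derivation1.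
- rewrite !(ext_derivationM, linearD) /= !(emapM, ext_derivation_gen, emap_gen) IH.
  by rewrite ext_derivationM ext_derivation_gen (rep_lie hA).
Qed.

Lemma ext_antipode_emap p a : ext_antipode (emap p a) = emap p (ext_antipode a).
Proof.
apply: (ext_endo_lind (f := @ext_antipode K h \o emap p)
  (g := emap p \o @ext_antipode K h)) => [|y b /= IH] /=.
- by rewrite emap_1 ext_antipode1 emap_1.
- rewrite emapM emap_gen 2!ext_antipodeM emapM !ext_antipode_gen IH.
  by rewrite linearN /= emap_gen.
Qed.

Lemma ext_parity_emap p a :
  (ext_even (emap p a) = emap p (ext_even a)) *
  (ext_odd (emap p a) = emap p (ext_odd a)).
Proof.
elim/ext_lind: a => [|c a b Ea Eb|y a Ea].
- by rewrite emap_1 ext_even1 ext_odd1 emap_1 linear0.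
- by rewrite !linearP /= !Ea !Eb.
- rewrite emapM emap_gen !ext_evenM !ext_oddM !ext_even_gen !ext_odd_gen.
  by rewrite !mul0r !add0r !emapM emap_gen !Ea.
Qed.

Lemma ext_counit_emap p a : ext_counit (emap p a) = ext_counit a.
Proof.
elim/ext_lind: a => [|c a b Ea Eb|y a Ea].
- by rewrite emap_1.
- by rewrite linearP !ext_counit_linear Ea Eb.
- by rewrite emapM emap_gen !ext_counitM !ext_counit_gen !mul0r.
Qed.

Lemma ext_deg_emap k p a : ext_deg k a -> ext_deg k (emap p a).
Proof.
apply: (span_ind (P := fun a => ext_deg k (emap p a))).
  exact: (subspace_preim (emap p) (span_subspace _)).
move=> _ [s [<- ->]]; elim: s => [|y s IHs].
  by rewrite big_nil emap_1; apply: span_gen; exists [::]; rewrite big_nil.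
by rewrite big_cons emapM emap_gen; apply: ext_deg_gen.
Qed.

Lemma tlift_coprod_emap (Z : lmodType K) (f : E -> E -> Z) q a :
  Defs.bilinear f ->
  tlift f (ext_coprod (emap q a)) =
  tlift (fun a1 a2 => f (emap q a1) (emap q a2)) (ext_coprod a).
Proof.
elim/ext_lind: a f => [|c a b Ea Eb|x a Ea] f fB;
  have fB' := bil_comp (emap q) (emap q) fB.
- by rewrite emap_1 ext_coprod1 !tliftE // !emap_1.
- by rewrite !linearP !tliftP // Ea // Eb.
- rewrite emapM emap_gen !tlift_ext_coprod // Ea; last first.
    apply: bil_add (bil_comp (ext_lmul _) idfun fB) _.
    exact: bil_comp (@ext_antipode K h) (ext_lmul _) fB.
  apply: eq_tlift => a1 a2.
  by rewrite !emapM !emap_gen ext_antipode_emap.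
Qed.

(** * Left multiplications by the generators, and their relations *)

Lemma hop_sig s (f : H -> endo U) (g : H -> endo E) :
  {F : endo V |
    forall p v a, F (hpure p (v ⊗ a)) = hpure (s p) (f p v ⊗ g p a)}.
Proof.
have fgL p : linear (fun t => hpure (s p) (tendo (f p) (g p) t)).
  by move=> c x y; rewrite !linearP.
exists (Endo (glift_linear fgL)) => p v a.
by rewrite [LHS](gliftE _ _ fgL) tendoE.
Qed.

(* Left multiplication by (1, 1 ⊗ x), (1, x ⊗ 1) and (q, 1 ⊗ 1). *)
Lemma Le_sig x : {F : endo V |
  forall p v a, F (hpure p (v ⊗ a)) = hpure p (v ⊗ (ext_gen x * a))}.
Proof.
have [F FE] := hop_sig id (fun=> 1) (fun=> ext_lmul (ext_gen x)).
by exists F => p v a; rewrite FE endo_1E.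
Qed.

Lemma Lu_sig x : {F : endo V | forall p v a, F (hpure p (v ⊗ a)) =
  hpure p ((uea_gen (A p^-1%g x) * v) ⊗ a) + hpure p (v ⊗ ext_derivation x a)}.
Proof.
have [F FE] := hop_sig id (fun p => uea_lmul (uea_gen (A p^-1%g x))) (fun=> 1).
have [G GE] := hop_sig id (fun=> 1) (fun=> ext_derivation_endo x).
by exists (F + G) => p v a; rewrite endoE FE GE !endo_1E.
Qed.

Lemma Lp_sig q : {F : endo V |
  forall p v a, F (hpure p (v ⊗ a)) = hpure (q * p)%g (v ⊗ emap q a)}.
Proof.
have [F FE] := hop_sig (fun p => q * p)%g (fun=> 1) (fun=> emap q).
by exists F => p v a; rewrite FE endo_1E.
Qed.

Lemma Lext_sig (f : {linear E -> E}) : {F : endo V |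
  forall p v a, F (hpure p (v ⊗ a)) = hpure p (v ⊗ f a)}.
Proof.
have fL : linear f by exact: linearP.
have [F FE] := hop_sig id (fun=> 1) (fun=> Endo fL).
by exists F => p v a; rewrite FE endo_1E.
Qed.

Definition Le x : endo V := sval (Le_sig x).
Definition Lu x : endo V := sval (Lu_sig x).
Definition Lp q : endo V := sval (Lp_sig q).
Definition Lext f : endo V := sval (Lext_sig f).
Definition hsigma : endo V := Lext (@ext_antipode K h).
Definition heven : endo V := Lext (@ext_even K h).
Definition hodd : endo V := Lext (@ext_odd K h).
Definition LeE x p v a : Le x (hpure p (v ⊗ a)) = hpure p (v ⊗ (ext_gen x * a)) :=
  svalP (Le_sig x) p v a.
Definition LuE x p v a : Lu x (hpure p (v ⊗ a)) =
  hpure p ((uea_gen (A p^-1%g x) * v) ⊗ a) + hpure p (v ⊗ ext_derivation x a) :=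
  svalP (Lu_sig x) p v a.
Definition LpE q p v a : Lp q (hpure p (v ⊗ a)) = hpure (q * p)%g (v ⊗ emap q a) :=
  svalP (Lp_sig q) p v a.
Lemma LextE f p v a : Lext f (hpure p (v ⊗ a)) = hpure p (v ⊗ f a).
Proof. exact: svalP (Lext_sig f) p v a. Qed.
Lemma hsigmaE p v a : hsigma (hpure p (v ⊗ a)) = hpure p (v ⊗ ext_antipode a).
Proof. exact: LextE. Qed.
Lemma hevenE p v a : heven (hpure p (v ⊗ a)) = hpure p (v ⊗ ext_even a).
Proof. exact: LextE. Qed.
Lemma hoddE p v a : hodd (hpure p (v ⊗ a)) = hpure p (v ⊗ ext_odd a).
Proof. exact: LextE. Qed.
Definition opE := (LeE, LuE, LpE, hsigmaE, hevenE, hoddE).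

Lemma Le_comb c x y : Le (c *: x + y) = endo_scal V c * Le x + Le y.
Proof.
apply: hopf_endo_eq => p v a; rewrite !endoE !opE.
by rewrite linearP mulrDl -scalerAl !linearP.
Qed.

Lemma Lu_comb c x y : Lu (c *: x + y) = endo_scal V c * Lu x + Lu y.
Proof.
apply: hopf_endo_eq => p v a; rewrite !endoE !opE.
rewrite (rep_linear hA) linearP mulrDl -scalerAl tpureDl tpureZl derivation_comb.
by rewrite !linearP scalerDr addrACA.
Qed.

Lemma LeLe x : Le x * Le x = 0.
Proof.
apply: hopf_endo_eq => p v a; rewrite !endoE !opE.
by rewrite mulrA ext_gen_sqr mul0r !linear0.
Qed.

Lemma LuLe x y : Lu x * Le y = Le y * Lu x + Le (lie x y).
Proof.
apply: hopf_endo_eq => p v a; rewrite !endoE !opE !linearD /= !opE.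
by rewrite ext_derivationM ext_derivation_gen !linearD /= addrA addrAC.
Qed.

Lemma LuLu x y : Lu x * Lu y = Lu y * Lu x + Lu (lie x y).
Proof.
apply: hopf_endo_eq => p v a; rewrite !endoE !opE !linearD /= !opE.
rewrite derivation_lie !mulrA uea_genM (rep_lie hA) mulrDl tpureDl !linearD /=.
by rewrite [RHS](AC ((2*2)*2)%AC ((1*5*3)*(2*(4*6)))%AC).
Qed.

Lemma LpLe q x : Lp q * Le x = Le (A q x) * Lp q.
Proof.
by apply: hopf_endo_eq => p v a; rewrite !endoE !opE emapM emap_gen.
Qed.

Lemma rep_invK q x : A q^-1%g (A q x) = x.
Proof. by rewrite -(repM hA) mulVg (rep1 hA). Qed.
Lemma rep_Kinv q x : A q (A q^-1%g x) = x.
Proof. by rewrite -(repM hA) mulgV (rep1 hA). Qed.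

(** In the factor U(h) both sides agree because the inverse of qp takes A_q(x) to A_p^-1(x); in the
    factor ∧(h) this is the equivariance of the derivation. *)
Lemma LpLu q x : Lp q * Lu x = Lu (A q x) * Lp q.
Proof.
apply: hopf_endo_eq => p v a; rewrite !endoE !opE !linearD /= !opE.
by rewrite emap_derivation invgM (repM hA) rep_invK.
Qed.

Lemma LpLp p q : Lp p * Lp q = Lp (p * q)%g.
Proof.
by apply: hopf_endo_eq => r v a; rewrite !endoE !opE emap_mul mulgA.
Qed.

Lemma Lp1 : Lp 1%g = 1.
Proof.
by apply: hopf_endo_eq => r v a; rewrite !endoE !opE emap_id mul1g endoE.
Qed.

Definition LExt a : endo V := palg_lift (@endo_scal K V) Le a.
Definition LUea v : endo V := palg_lift (@endo_scal K V) Lu v.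
Let Le_rel t u : @ext_rel K h t u ->
  aeval (@endo_scal K V) Le t = aeval (@endo_scal K V) Le u.
Proof. by apply: ext_rel_lift => [||x] //; [exact: Le_comb|exact: LeLe]. Qed.

Let Lu_rel t u : @uea_rel K h t u ->
  aeval (@endo_scal K V) Lu t = aeval (@endo_scal K V) Lu u.
Proof.
by apply: uea_rel_lift => [c x y|x y]; [exact: Lu_comb|exact: LuLu].
Qed.

Lemma LExt_gen x : LExt (ext_gen x) = Le x.
Proof. exact: (palg_lift_gen (endo_scal_central V) Le_rel). Qed.
Lemma LExt1 : LExt 1 = 1.
Proof. exact: (palg_lift1 (endo_scal_central V) Le_rel). Qed.
Lemma LExtM a b : LExt (a * b) = LExt a * LExt b.
Proof. exact: (palg_liftM (endo_scal_central V) Le_rel). Qed.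

Lemma LExt_comb c a b : LExt (c *: a + b) = endo_scal V c * LExt a + LExt b.
Proof.
rewrite /LExt (palg_liftD (endo_scal_central V) Le_rel).
by rewrite (palg_liftZ (endo_scal_central V) Le_rel).
Qed.

Lemma LUea_gen x : LUea (uea_gen x) = Lu x.
Proof. exact: (palg_lift_gen (endo_scal_central V) Lu_rel). Qed.
Lemma LUea1 : LUea 1 = 1.
Proof. exact: (palg_lift1 (endo_scal_central V) Lu_rel). Qed.
Lemma LUeaM v w : LUea (v * w) = LUea v * LUea w.
Proof. exact: (palg_liftM (endo_scal_central V) Lu_rel). Qed.

Lemma LUea_comb c v w : LUea (c *: v + w) = endo_scal V c * LUea v + LUea w.
Proof.
rewrite /LUea (palg_liftD (endo_scal_central V) Lu_rel).
by rewrite (palg_liftZ (endo_scal_central V) Lu_rel).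
Qed.

Opaque LExt LUea.
Definition hone : V := hpure 1%g (1 ⊗ 1).

Lemma LExtE a p v b : LExt a (hpure p (v ⊗ b)) = hpure p (v ⊗ (a * b)).
Proof.
elim/ext_lind: a => [|c a a' Ea Ea'|x a Ea].
- by rewrite LExt1 endoE mul1r.
- by rewrite LExt_comb !endoE Ea Ea' mulrDl -scalerAl !linearP.
- by rewrite LExtM LExt_gen endoE Ea LeE mulrA.
Qed.

Lemma rep_inv1 x : A 1^-1%g x = x.
Proof. by rewrite invg1 (rep1 hA). Qed.

(** On the unit [Lu] has no bracket term, since derivations kill 1. Applying v first therefore only
    builds up the factor U(h). *)
Lemma LUea_one v : LUea v hone = hpure 1%g (v ⊗ 1).
Proof.
elim/uea_lind: v => [|c v w Ev Ew|x v Ev].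
- by rewrite LUea1 endoE.
- by rewrite LUea_comb !endoE Ev Ew tpureDl tpureZl !linearP.
- rewrite LUeaM LUea_gen endoE Ev LuE ext_derivation1 !linear0 addr0.
  by rewrite rep_inv1.
Qed.

Lemma hpureE p v a : hpure p (v ⊗ a) = LExt a (Lp p (LUea v hone)).
Proof. by rewrite LUea_one LpE emap_1 LExtE mulr1 mulg1. Qed.

Lemma hopf_lind (P : V -> Prop) : P hone ->
  (forall c X Y, P X -> P Y -> P (c *: X + Y)) ->
  (forall x Y, P Y -> P (Le x Y)) -> (forall x Y, P Y -> P (Lu x Y)) ->
  (forall p Y, P Y -> P (Lp p Y)) -> forall X, P X.
Proof.
move=> P1 PD Pe Pu Pp.
have P0 : P 0.
  by rewrite -(addNr hone) -scaleN1r; apply: PD.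
elim/gsum_ind => [//|//|p]; elim/tensor_ind => [|c s t Es Et|v a].
- by rewrite -[gpure _ _]/(hpure _ _) linear0.
- by rewrite -[gpure _ _]/(hpure _ _) linearP; apply: PD.
rewrite -[gpure _ _]/(hpure _ _) hpureE.
have: P (Lp p (LUea v hone)).
  apply: Pp; elim/uea_lind: v => [|c v w Ev Ew|x v Ev].
  - by rewrite LUea1 endoE.
  - by rewrite LUea_comb !endoE; apply: PD.
  - by rewrite LUeaM LUea_gen endoE; apply: Pu.
elim/ext_lind: a (Lp _ _) => [|c a b Ea Eb|x a Ea] Y PY.
- by rewrite LExt1 endoE.
- by rewrite LExt_comb !endoE; apply: PD; auto.
- by rewrite LExtM LExt_gen endoE; apply: Pe; auto.
Qed.

Lemma hopf_leq (Z : lmodType K) (f g : {linear V -> Z}) : f hone = g hone ->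
  (forall x Y, f Y = g Y -> f (Le x Y) = g (Le x Y)) ->
  (forall x Y, f Y = g Y -> f (Lu x Y) = g (Lu x Y)) ->
  (forall p Y, f Y = g Y -> f (Lp p Y) = g (Lp p Y)) -> f =1 g.
Proof.
move=> f1 fe fu fp; elim/hopf_lind => // c X Y EX EY.
by rewrite !linearP EX EY.
Qed.

(** * Product *)

Let mul_bil (Y : V) p : Defs.bilinear (fun v a => LExt a (Lp p (LUea v Y))).
Proof.
split=> [a c v w|v c a b].
- by rewrite LUea_comb !endoE !linearP.
- by rewrite LExt_comb !endoE.
Qed.

Let mul_lin (Y : V) p := tlift_linear (mul_bil Y p).
(** The element X = a p v acts on Y by its own left multiplications, v first and a last. Linearity
    in X is built in; linearity in Y still has to be proved. *)
Definition hmul X Y : V :=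
  glift (fun p => tlift (fun v a => LExt a (Lp p (LUea v Y)))) X.
Lemma hmul_linearl Y : linear (hmul^~ Y).
Proof. exact: glift_linear (mul_lin Y). Qed.

Lemma hmulE p v a Y : hmul (hpure p (v ⊗ a)) Y = LExt a (Lp p (LUea v Y)).
Proof.
by rewrite [LHS](gliftE _ _ (mul_lin Y)) [LHS](tliftE _ _ (mul_bil Y p)).
Qed.

Opaque hmul.
Definition hmul_l Y : endo V := Endo (hmul_linearl Y).
Lemma hmul_lE X Y : hmul_l Y X = hmul X Y. Proof. by []. Qed.
Opaque hmul_l.
Lemma hmulDl X Y Z : hmul (X + Y) Z = hmul X Z + hmul Y Z.
Proof. exact: linear_D (hmul_linearl Z) X Y. Qed.
Lemma hmulZl c X Z : hmul (c *: X) Z = c *: hmul X Z.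
Proof. by rewrite -!hmul_lE linearZ. Qed.
Lemma hmul0l Z : hmul 0 Z = 0.
Proof. exact: linear_0 (hmul_linearl Z). Qed.
Lemma hmulNl X Z : hmul (- X) Z = - hmul X Z.
Proof. by rewrite -scaleN1r hmulZl scaleN1r. Qed.

Lemma LpExt p a : Lp p * LExt a = LExt (emap p a) * Lp p.
Proof.
elim/ext_lind: a => [|c a b Ea Eb|x a Ea].
- by rewrite emap_1 LExt1 mulr1 mul1r.
- rewrite linearP !LExt_comb mulrDr mulrDl Eb; congr (_ + _).
  by rewrite mulrA -(centralC (endo_scal_central V)) -!mulrA Ea.
- by rewrite LExtM mulrA LExt_gen LpLe -mulrA Ea mulrA emapM emap_gen LExtM LExt_gen.
Qed.

Lemma LuExt x a : Lu x * LExt a = LExt a * Lu x + LExt (ext_derivation x a).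
Proof.
have LE0 : LExt 0 = 0.
  rewrite -(addNr (1 : E)) -scaleN1r LExt_comb LExt1 mulr1.
  by apply: endoP => X; rewrite !endoE scaleN1r addNr.
elim/ext_lind: a => [|c a b Ea Eb|y a Ea].
- by rewrite ext_derivation1 LExt1 mulr1 mul1r LE0 addr0.
- rewrite linearP !LExt_comb mulrDr mulrDl Eb addrACA; congr (_ + _).
  by rewrite mulrA -(centralC (endo_scal_central V)) -!mulrA Ea mulrDr.
- rewrite ext_derivationM ext_derivation_gen -[X in LExt (X + _)]scale1r.
  rewrite LExt_comb !LExtM !LExt_gen [Lu x * _]mulrA LuLe mulrDl -!mulrA Ea mulrDr.
  rewrite -[endo_scal V 1]/(1 : endo V) mul1r !mulrA -!addrA; congr (_ + _).
  by rewrite addrC.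
Qed.

(** Together with the analogues for [Lp] and [Lu], this says that right multiplication by Y commutes
    with the left generators. Linearity in Y, the right unit law and associativity then follow by
    induction on X. *)
Lemma hmul_Le x X Y : hmul (Le x X) Y = Le x (hmul X Y).
Proof.
move: X; apply: (hopf_eq (f := hmul_l Y \o Le x) (g := Le x \o hmul_l Y)) => p v a.
by rewrite /= !hmul_lE LeE !hmulE LExtM LExt_gen endoE.
Qed.

Lemma hmul_Lp q X Y : hmul (Lp q X) Y = Lp q (hmul X Y).
Proof.
move: X; apply: (hopf_eq (f := hmul_l Y \o Lp q) (g := Lp q \o hmul_l Y)) => p v a.
by rewrite /= !hmul_lE LpE !hmulE -[RHS]endo_mulE LpExt -LpLp !endoE.
Qed.

(** Here x has to be brought to its normal position: x a p v = a x p v + [x, a] p v, and x p = p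
    A_p^-1(x). These are the two terms of [LuE]. *)
Lemma hmul_Lu x X Y : hmul (Lu x X) Y = Lu x (hmul X Y).
Proof.
move: X; apply: (hopf_eq (f := hmul_l Y \o Lu x) (g := Lu x \o hmul_l Y)) => p v a.
rewrite /= !hmul_lE LuE hmulDl !hmulE -[RHS]endo_mulE LuExt !endoE.
congr (LExt a _ + _).
by rewrite LUeaM LUea_gen endoE -[LHS]endo_mulE LpLu rep_Kinv.
Qed.

Lemma hmul1l : left_id hone hmul.
Proof. by move=> Y; rewrite hmulE LExt1 Lp1 LUea1 !endoE. Qed.
Definition hmulgE := (hmul_Le, hmul_Lu, hmul_Lp).

Lemma hmul_linearr X : linear (hmul X).
Proof.
move=> c Y Z; elim/hopf_lind: X => [|d X X' EX EX'|x X EX|x X EX|p X EX].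
- by rewrite !hmul1l.
- rewrite !(hmulDl, hmulZl) EX EX' !scalerDr addrACA; congr (_ + _ + _).
  by rewrite !scalerA mulrC.
- by rewrite !hmulgE EX linearP.
- by rewrite !hmulgE EX linearP.
- by rewrite !hmulgE EX linearP.
Qed.

HB.instance Definition _ X := GRing.isLinear.Build K V V *:%R (hmul X) (hmul_linearr X).

Lemma hmul1r : right_id hone hmul.
Proof.
elim/hopf_lind => [|c X Y EX EY|x X EX|x X EX|p X EX].
- by rewrite hmul1l.
- by rewrite hmulDl hmulZl EX EY.
- by rewrite hmulgE EX.
- by rewrite hmulgE EX.
- by rewrite hmulgE EX.
Qed.

Lemma hmulA : associative hmul.
Proof.
move=> X Y Z; elim/hopf_lind: X => [|d X X' EX EX'|x X EX|x X EX|p X EX].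
- by rewrite !hmul1l.
- by rewrite !(hmulDl, hmulZl) EX EX'.
- by rewrite !hmulgE EX.
- by rewrite !hmulgE EX.
- by rewrite !hmulgE EX.
Qed.

Let LUea_bil q w b : Defs.bilinear
  (fun v1 v2 => hpure q ((umap q^-1%g v1 * w) ⊗ uea_act v2 b)).
Proof.
split=> [v2 c v' v''|v1 c v' v''].
- by rewrite linearP mulrDl -scalerAl tpureDl tpureZl linearP.
- by rewrite uea_actZDl !linearP.
Qed.

(** A generator acts on w ⊗ b by one term in each factor, as its primitive coproduct prescribes.
    Multiplicativity of the coproduct extends this from generators to U(h). *)
Lemma LUeaE v q w b : LUea v (hpure q (w ⊗ b)) =
  tlift (fun v1 v2 => hpure q ((umap q^-1%g v1 * w) ⊗ uea_act v2 b)) (uea_coprod v).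
Proof.
have fB := LUea_bil q w b.
elim/uea_lind: v => [|c v v' Ev Ev'|x v Ev].
- by rewrite LUea1 endoE uea_coprod1 tliftE // umap_1 uea_act1 mul1r.
- by rewrite LUea_comb !endoE Ev Ev' linearP (tlift_linear fB).
- rewrite LUeaM LUea_gen endoE Ev (tlift_comp _ _ fB) tlift_uea_coprod //.
  apply: eq_tlift => v1 v2.
  by rewrite /= LuE umapM umap_gen uea_actM uea_act_gen mulrA.
Qed.

Lemma hmul_formula p q v w a b :
  hmul (hpure p (v ⊗ a)) (hpure q (w ⊗ b)) =
  hpure (p * q)%g (tlift (fun v1 v2 => (uea_map (A q^-1%g) v1 * w) ⊗
    (a * ext_map (A p) (uea_act v2 b))) (uea_coprod v)).
Proof.
have gB : Defs.bilinear (fun v1 v2 =>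
    (uea_map (A q^-1%g) v1 * w) ⊗ (a * ext_map (A p) (uea_act v2 b))).
  split=> [v2 c v' v''|v1 c v' v''].
  - by rewrite -!umapE linearP mulrDl -scalerAl tpureDl tpureZl.
  - by rewrite -!emapE uea_actZDl linearP mulrDr -scalerAr linearP.
rewrite hmulE LUeaE -[LHS]endo_mulE (tlift_comp _ _ (LUea_bil _ _ _)).
rewrite (tlift_comp _ _ gB); apply: eq_tlift => v1 v2.
by rewrite /= endoE LpE LExtE umapE emapE.
Qed.

(** * The parity automorphism and the even and odd parts *)

Lemma sigmaLe x : hsigma * Le x = - (Le x * hsigma).
Proof.
apply: hopf_endo_eq => p v a; rewrite !endoE !opE ext_antipodeM ext_antipode_gen.
by rewrite mulNr !linearN.
Qed.

Lemma sigmaLu x : hsigma * Lu x = Lu x * hsigma.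
Proof.
apply: hopf_endo_eq => p v a; rewrite !endoE !opE linearD /= !opE.
by rewrite ext_antipode_derivation.
Qed.

Lemma sigmaLp q : hsigma * Lp q = Lp q * hsigma.
Proof.
by apply: hopf_endo_eq => p v a; rewrite !endoE !opE ext_antipode_emap.
Qed.

Lemma sigma2 : hsigma * hsigma = 1.
Proof. by apply: hopf_endo_eq => p v a; rewrite !endoE !opE ext_antipodeK. Qed.
Lemma sigma_one : hsigma hone = hone.
Proof. by rewrite opE ext_antipode1. Qed.

Lemma sigmaM X Y : hsigma (hmul X Y) = hmul (hsigma X) (hsigma Y).
Proof.
elim/hopf_lind: X => [|c X X' EX EX'|x X EX|x X EX|p X EX].
- by rewrite sigma_one !hmul1l.
- by rewrite linearP !hmulDl !hmulZl linearP /= EX EX'.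
- rewrite hmulgE -!endo_mulE sigmaLe !endoE EX -scaleN1r hmulZl scaleN1r.
  by rewrite -hmulgE.
- by rewrite hmulgE -!endo_mulE sigmaLu !endoE EX -hmulgE.
- by rewrite hmulgE -!endo_mulE sigmaLp !endoE EX -hmulgE.
Qed.

Lemma evenLe x : heven * Le x = Le x * hodd.
Proof.
apply: hopf_endo_eq => p v a; rewrite !endoE !opE ext_evenM.
by rewrite ext_even_gen ext_odd_gen mul0r add0r.
Qed.

Lemma oddLe x : hodd * Le x = Le x * heven.
Proof.
apply: hopf_endo_eq => p v a; rewrite !endoE !opE ext_oddM.
by rewrite ext_even_gen ext_odd_gen mul0r add0r.
Qed.

Lemma evenLu x : heven * Lu x = Lu x * heven.
Proof.
apply: hopf_endo_eq => p v a; rewrite !endoE !opE linearD /= !opE.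
by rewrite ext_parity_derivation.
Qed.

Lemma oddLu x : hodd * Lu x = Lu x * hodd.
Proof.
apply: hopf_endo_eq => p v a; rewrite !endoE !opE linearD /= !opE.
by rewrite ext_parity_derivation.
Qed.

Lemma evenLp q : heven * Lp q = Lp q * heven.
Proof.
by apply: hopf_endo_eq => p v a; rewrite !endoE !opE ext_parity_emap.
Qed.

Lemma oddLp q : hodd * Lp q = Lp q * hodd.
Proof.
by apply: hopf_endo_eq => p v a; rewrite !endoE !opE ext_parity_emap.
Qed.

Lemma even_one : heven hone = hone.
Proof. by rewrite opE ext_even1. Qed.
Lemma odd_one : hodd hone = 0.
Proof. by rewrite opE ext_odd1 !linear0. Qed.

(** * Coproduct and counit *)

Definition hdiag p v1 v2 a1 a2 : VV := hpure p (v1 ⊗ a1) ⊗ hpure p (v2 ⊗ a2).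

Lemma hdiag_bilr p v1 v2 : Defs.bilinear (hdiag p v1 v2).
Proof.
by split=> ? c a b; rewrite /hdiag !linearP // tpureDl tpureZl.
Qed.

Lemma hdiag_bill p a1 a2 : Defs.bilinear (fun v1 v2 => hdiag p v1 v2 a1 a2).
Proof.
split=> ? c v w; rewrite /hdiag tpureDl tpureZl !linearP //=.
by rewrite tpureDl tpureZl.
Qed.

Lemma hdiag_bil p : Defs.bilinear (fun s t =>
  tlift (fun v1 v2 => tlift (hdiag p v1 v2) t) s).
Proof.
apply: tlift2_bilinear => [v2 a1 a2|v1 a1 a2|v1 v2].
- exact: (hdiag_bill p a1 a2).1.
- exact: (hdiag_bill p a1 a2).2.
- exact: hdiag_bilr.
Qed.

Lemma hdiag_lin_bil p t :
  Defs.bilinear (fun v1 v2 => tlift (hdiag p v1 v2) t).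
Proof.
split=> ? c v w; apply: tlift_comb => a1 a2.
- exact: (hdiag_bill p a1 a2).1.
- exact: (hdiag_bill p a1 a2).2.
Qed.

Let coprod_bil p : Defs.bilinear (fun v a =>
  tlift (fun v1 v2 => tlift (hdiag p v1 v2) (ext_coprod a)) (uea_coprod v)).
Proof. exact: (bil_comp (@uea_coprod K h) (@ext_coprod K h) (hdiag_bil p)). Qed.
Let coprod_lin p := tlift_linear (coprod_bil p).
Definition hcoprod : V -> VV := glift (fun p => tlift (fun v a =>
  tlift (fun v1 v2 => tlift (hdiag p v1 v2) (ext_coprod a)) (uea_coprod v))).
Lemma hcoprod_linear : linear hcoprod.
Proof. exact: glift_linear coprod_lin. Qed.

Lemma hcoprodE p v a : hcoprod (hpure p (v ⊗ a)) =
  tlift (fun v1 v2 => tlift (hdiag p v1 v2) (ext_coprod a)) (uea_coprod v).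
Proof.
by rewrite [LHS](gliftE _ _ coprod_lin) [LHS](tliftE _ _ (coprod_bil p)).
Qed.

Opaque hcoprod.
HB.instance Definition _ := GRing.isLinear.Build K V VV *:%R hcoprod hcoprod_linear.
Definition TLe x : endo VV := tendo (Le x) 1 + tendo hsigma (Le x).
Definition TLu x : endo VV := tendo (Lu x) 1 + tendo 1 (Lu x).
Definition TLp p : endo VV := tendo (Lp p) (Lp p).

Lemma hcoprod_Le x X : hcoprod (Le x X) = TLe x (hcoprod X).
Proof.
move: X; apply: (hopf_eq (f := hcoprod \o Le x) (g := TLe x \o hcoprod)) => p v a.
rewrite /= LeE !hcoprodE (tlift_comp _ _ (hdiag_lin_bil _ _)).
apply: eq_tlift => v1 v2 /=.
rewrite (tlift_comp _ _ (hdiag_bilr _ _ _)) (tlift_ext_coprod _ _ (hdiag_bilr _ _ _)).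
apply: eq_tlift => a1 a2 /=.
by rewrite endoE !tendoE endoE hsigmaE !LeE.
Qed.

Lemma hcoprod_Lp q X : hcoprod (Lp q X) = TLp q (hcoprod X).
Proof.
move: X; apply: (hopf_eq (f := hcoprod \o Lp q) (g := TLp q \o hcoprod)) => p v a.
rewrite /= LpE !hcoprodE (tlift_comp _ _ (hdiag_lin_bil _ _)).
apply: eq_tlift => v1 v2 /=.
rewrite (tlift_comp _ _ (hdiag_bilr _ _ _)) (tlift_coprod_emap _ _ (hdiag_bilr _ _ _)).
by apply: eq_tlift => a1 a2 /=; rewrite tendoE !LpE.
Qed.

(** The four terms come from x being primitive in U(h) and from [x, -] being a coderivation of ∧(h).
    Both tensor factors carry the same p, hence the same A_p^-1(x), so the terms regroup by tensor
    factor. *)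
Lemma hcoprod_Lu x X : hcoprod (Lu x X) = TLu x (hcoprod X).
Proof.
move: X; apply: (hopf_eq (f := hcoprod \o Lu x) (g := TLu x \o hcoprod)) => p v a.
rewrite /= LuE linearD /= !hcoprodE (tlift_comp _ _ (hdiag_lin_bil _ _)).
rewrite (tlift_uea_coprod _ _ (hdiag_lin_bil _ _)) -tlift_add.
apply: eq_tlift => v1 v2 /=.
rewrite (tlift_comp _ _ (hdiag_bilr _ _ _)).
rewrite (tlift_coprod_derivation _ _ (hdiag_bilr _ _ _)) -!tlift_add.
apply: eq_tlift => a1 a2 /=; rewrite endoE !tendoE !endoE !LuE linearD tpureDl.
by rewrite addrACA.
Qed.

Lemma hcoprod_one : hcoprod hone = hone ⊗ hone.
Proof.
rewrite hcoprodE uea_coprod1 ext_coprod1.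
rewrite (tliftE _ _ (hdiag_lin_bil _ _)).
exact: (tliftE _ _ (hdiag_bilr _ _ _)).
Qed.

Definition hcoprodgE := (hcoprod_Le, hcoprod_Lu, hcoprod_Lp).

(** Coassociativity needs this: the coproduct of [Le x X] contains [hsigma] in its first factor,
    which is then split again. *)
Lemma hcoprod_sigma X : hcoprod (hsigma X) = tendo hsigma hsigma (hcoprod X).
Proof.
elim/hopf_lind: X => [|c X Y EX EY|x X EX|x X EX|p X EX].
- by rewrite sigma_one hcoprod_one tendoE !sigma_one.
- by rewrite !linearP /= EX EY.
- rewrite -endo_mulE sigmaLe !endoE linearN /= !hcoprod_Le EX -!endo_mulE -endo_oppE.
  congr (endo_fun _ _); rewrite /TLe mulrDl mulrDr !tendoM !sigmaLe mulr1 mul1r.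
  by rewrite tendoNl tendoNr opprD.
- rewrite -endo_mulE sigmaLu !endoE !hcoprod_Lu EX -!endo_mulE.
  congr (endo_fun _ _); rewrite /TLu mulrDl mulrDr !tendoM !sigmaLu mulr1 mul1r.
  by [].
- rewrite -endo_mulE sigmaLp !endoE !hcoprod_Lp EX -!endo_mulE.
  by congr (endo_fun _ _); rewrite /TLp !tendoM !sigmaLp.
Qed.

Lemma tmap_tendol (f : endo V) (F : endo VV) (g : endo V) t :
  (forall X, hcoprod (f X) = F (hcoprod X)) ->
  tmap hcoprod idfun (tendo f g t) = tendo F g (tmap hcoprod idfun t).
Proof.
move=> fF; move: t; apply: (tensor_eq (f := tmap hcoprod idfun \o tendo f g)
  (g := tendo F g \o tmap hcoprod idfun)) => X Y /=.
by rewrite tendoE !tmapE tendoE /= fF.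
Qed.

Lemma tmap_tendor (f : endo V) (F : endo VV) (g : endo V) t :
  (forall X, hcoprod (g X) = F (hcoprod X)) ->
  tmap idfun hcoprod (tendo f g t) = tendo f F (tmap idfun hcoprod t).
Proof.
move=> gF; move: t; apply: (tensor_eq (f := tmap idfun hcoprod \o tendo f g)
  (g := tendo f F \o tmap idfun hcoprod)) => X Y /=.
by rewrite tendoE !tmapE tendoE /= gF.
Qed.

(** For x of degree 1 and s = [hsigma], both sides apply x ⊗ 1 ⊗ 1 + s ⊗ x ⊗ 1 + s ⊗ s ⊗ x to the
    element given by induction. In degree 0 the same holds with s replaced by 1, and p acts as p ⊗ p
    ⊗ p. *)
Lemma hcoassoc X : tassoc (tmap hcoprod id (hcoprod X)) = tmap id hcoprod (hcoprod X).
Proof.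
have one_VV : (1 : endo VV) = tendo 1 1 by rewrite tendo1.
move: X; apply: (hopf_leq (f := @tassoc K V V V \o tmap hcoprod idfun \o hcoprod)
  (g := tmap idfun hcoprod \o hcoprod)) => /= [|x Y EY|x Y EY|p Y EY].
- by rewrite hcoprod_one !tmapE /= hcoprod_one tassocE.
- rewrite hcoprod_Le !endo_addE !linearD /=.
  rewrite (tmap_tendol _ _ (hcoprod_Le x)) (tmap_tendol _ _ hcoprod_sigma).
  rewrite (@tmap_tendor _ 1 _ _) => [|Z]; last by rewrite !endoE.
  rewrite (tmap_tendor _ _ (hcoprod_Le x)) -EY /TLe tendoDl endo_addE linearD /=.
  by rewrite !tassoc_tendo one_VV tendoDr endo_addE addrA.
- rewrite hcoprod_Lu !endo_addE !linearD /=.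
  rewrite (tmap_tendol _ _ (hcoprod_Lu x)) (@tmap_tendol _ 1 _ _) => [|Z]; last first.
    by rewrite !endoE.
  rewrite (@tmap_tendor _ 1 _ _) => [|Z]; last by rewrite !endoE.
  rewrite (tmap_tendor _ _ (hcoprod_Lu x)) -EY /TLu tendoDl endo_addE linearD /=.
  by rewrite one_VV !tassoc_tendo tendoDr endo_addE addrA.
- rewrite hcoprod_Lp (tmap_tendol _ _ (hcoprod_Lp p)) (tmap_tendor _ _ (hcoprod_Lp p)).
  by rewrite tassoc_tendo EY.
Qed.

Let counit_bil : Defs.bilinear
  (fun v a => uea_counit v * ext_counit a : K^o).
Proof.
split=> [a c v w|v c a b].
- by rewrite uea_counit_linear mulrDl -mulrA.
- by rewrite ext_counit_linear mulrDr mulrCA.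
Qed.

Let counit_lin p := tlift_linear counit_bil.
Definition hcounit : V -> K :=
  glift (Z := K^o) (fun p => tlift (Z := K^o) (fun v a => uea_counit v * ext_counit a)).
Lemma hcounit_linear : scalar hcounit.
Proof. exact: glift_linear counit_lin. Qed.

Lemma hcounitE p v a : hcounit (hpure p (v ⊗ a)) = uea_counit v * ext_counit a.
Proof.
by rewrite [LHS](gliftE _ _ counit_lin) [LHS](tliftE _ _ counit_bil).
Qed.

Opaque hcounit.
HB.instance Definition _ := GRing.isLinear.Build K V K^o *:%R (hcounit : V -> K^o)
  hcounit_linear.

Lemma hcounit_Le x X : hcounit (Le x X) = 0.
Proof.
move: X; apply: (hopf_eq (f := (hcounit : _ -> K^o) \o Le x) (g := \0)) => p v a /=.
by rewrite LeE hcounitE ext_counitM ext_counit_gen mul0r mulr0.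
Qed.

Lemma hcounit_Lu x X : hcounit (Lu x X) = 0.
Proof.
move: X; apply: (hopf_eq (f := (hcounit : _ -> K^o) \o Lu x) (g := \0)) => p v a /=.
rewrite LuE (linear_D (hcounit_linear : linear (_ : _ -> K^o))) !hcounitE.
by rewrite uea_counitM uea_counit_gen ext_counit_derivation !mul0r mulr0 addr0.
Qed.

Lemma hcounit_Lp p X : hcounit (Lp p X) = hcounit X.
Proof.
move: X; apply: (hopf_eq (f := (hcounit : _ -> K^o) \o Lp p) (g := hcounit : _ -> K^o)).
by move=> q v a /=; rewrite LpE !hcounitE ext_counit_emap.
Qed.

Lemma hcounit_sigma X : hcounit (hsigma X) = hcounit X.
Proof.
move: X; apply: (hopf_eq (f := (hcounit : _ -> K^o) \o hsigma) (g := hcounit : _ -> K^o)).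
by move=> q v a /=; rewrite hsigmaE !hcounitE ext_counit_antipode.
Qed.

Lemma hcounit_one : hcounit hone = 1.
Proof. by rewrite hcounitE uea_counit1 ext_counit1 mulr1. Qed.
Definition hcounitgE := (hcounit_Le, hcounit_Lu, hcounit_Lp, hcounit_sigma).

Lemma hcounitM X Y : hcounit (hmul X Y) = hcounit X * hcounit Y.
Proof.
elim/hopf_lind: X => [|c X X' EX EX'|x X EX|x X EX|p X EX].
- by rewrite hmul1l hcounit_one mul1r.
- by rewrite hmulDl hmulZl !hcounit_linear EX EX' mulrDl mulrA.
- by rewrite hmulgE !hcounitgE mul0r.
- by rewrite hmulgE !hcounitgE mul0r.
- by rewrite hmulgE !hcounitgE.
Qed.

Lemma counitl_bil : Defs.bilinear (fun X Y => hcounit X *: Y).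
Proof.
split=> [Y c X X'|X c Y Y'].
- by rewrite hcounit_linear scalerDl scalerA.
- by rewrite scalerDr !scalerA mulrC.
Qed.

Lemma counitr_bil : Defs.bilinear (fun X Y => hcounit Y *: X).
Proof.
split=> [Y c X X'|X c Y Y'].
- by rewrite scalerDr !scalerA mulrC.
- by rewrite hcounit_linear scalerDl scalerA.
Qed.

Lemma hcounitl X : tlift (fun X1 X2 => hcounit X1 *: X2) (hcoprod X) = X.
Proof.
have B := counitl_bil.
elim/hopf_lind: X => [|c X X' EX EX'|x X EX|x X EX|p X EX].
- by rewrite hcoprod_one tliftE // hcounit_one scale1r.
- by rewrite linearP tliftP // EX EX'.
- rewrite hcoprod_Le endoE tliftD // !tlift_tendo // -tlift_add -[in RHS]EX.
  rewrite (tlift_comp _ _ B); apply: eq_tlift => X1 X2 /=.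
  by rewrite !endoE !hcounitgE scale0r add0r linearZ.
- rewrite hcoprod_Lu endoE tliftD // !tlift_tendo // -tlift_add -[in RHS]EX.
  rewrite (tlift_comp _ _ B); apply: eq_tlift => X1 X2 /=.
  by rewrite !endoE !hcounitgE scale0r add0r linearZ.
- rewrite hcoprod_Lp !tlift_tendo // -[in RHS]EX.
  rewrite (tlift_comp _ _ B); apply: eq_tlift => X1 X2 /=.
  by rewrite !hcounitgE linearZ.
Qed.

Lemma hcounitr X : tlift (fun X1 X2 => hcounit X2 *: X1) (hcoprod X) = X.
Proof.
have B := counitr_bil.
elim/hopf_lind: X => [|c X X' EX EX'|x X EX|x X EX|p X EX].
- by rewrite hcoprod_one tliftE // hcounit_one scale1r.
- by rewrite linearP tliftP // EX EX'.
- rewrite hcoprod_Le endoE tliftD // !tlift_tendo // -tlift_add -[in RHS]EX.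
  rewrite (tlift_comp _ _ B); apply: eq_tlift => X1 X2 /=.
  by rewrite !endoE !hcounitgE scale0r addr0 linearZ.
- rewrite hcoprod_Lu endoE tliftD // !tlift_tendo // -tlift_add -[in RHS]EX.
  rewrite (tlift_comp _ _ B); apply: eq_tlift => X1 X2 /=.
  by rewrite !endoE !hcounitgE scale0r addr0 linearZ.
- rewrite hcoprod_Lp !tlift_tendo // -[in RHS]EX.
  rewrite (tlift_comp _ _ B); apply: eq_tlift => X1 X2 /=.
  by rewrite !hcounitgE linearZ.
Qed.

(* The sign (-1)^{|Y||X'|}, expressed by the even and odd parts of Y. *)
Definition htwist X Y X' Y' : VV :=
  hmul X X' ⊗ hmul (heven Y) Y' + hmul X (hsigma X') ⊗ hmul (hodd Y) Y'.

Definition htmul (s t : VV) : VV :=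
  tlift (fun X Y => tlift (htwist X Y) t) s.
Let comb (c : K) (s t s' t' : VV) :
  c *: s + t + (c *: s' + t') = c *: (s + s') + (t + t').
Proof. by rewrite scalerDr addrACA. Qed.
Let tw1 Y X' Y' : linear (fun X => htwist X Y X' Y').
Proof. by move=> c X Z; rewrite /htwist !(hmulDl, hmulZl) !(tpureDl, tpureZl) comb. Qed.
Let tw2 X X' Y' : linear (fun Y => htwist X Y X' Y').
Proof. by move=> c Y Z; rewrite /htwist !linearP !(hmulDl, hmulZl) !linearP comb. Qed.

Let tw3 X Y : Defs.bilinear (htwist X Y).
Proof.
split=> ? c Z Z'; rewrite /htwist !linearP /= ?(tpureDl, tpureZl) comb //.
Qed.

Lemma htmulE X Y X' Y' : htmul (X ⊗ Y) (X' ⊗ Y') = htwist X Y X' Y'.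
Proof. exact: tlift2E tw1 tw2 tw3. Qed.
Lemma htmul_bilinear : Defs.bilinear htmul.
Proof. exact: tlift2_bilinear tw1 tw2 tw3. Qed.
Opaque htmul.

Lemma htmul_endol (F : endo VV) (s t : VV) :
  (forall X Y X' Y', F (htmul (X ⊗ Y) (X' ⊗ Y')) = htmul (F (X ⊗ Y)) (X' ⊗ Y')) ->
  F (htmul s t) = htmul (F s) t.
Proof.
have [m1 m2] := htmul_bilinear => EF.
elim/tensor_ind: s => [|c s s' Es Es'|X Y].
- by rewrite linear0 (linear_0 (m1 _)) linear0.
- by rewrite m1 !linearP /= m1 Es Es'.
elim/tensor_ind: t => [|c t t' Et Et'|X' Y'] //.
- by rewrite !(linear_0 (m2 _)) linear0.
- by rewrite !m2 linearP /= Et Et'.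
Qed.

(** Multiplying Y by x exchanges its even and odd parts, which toggles [hsigma] on X'. On the other
    side the [hsigma] of [TLe] also reaches X', and the two agree because [hsigma] is an
    involution. *)
Lemma htmul_TLe x s t : TLe x (htmul s t) = htmul (TLe x s) t.
Proof.
have [m1 m2] := htmul_bilinear.
apply: htmul_endol => X Y X' Y'; rewrite /TLe !endo_addE !tendoE !endoE (linear_D (m1 _)).
rewrite !htmulE /htwist !linearD /= !tendoE !endoE !sigmaM -[hsigma (hsigma X')]endo_mulE.
rewrite sigma2 endoE !hmulgE -[heven (Le x Y)]endo_mulE -[hodd (Le x Y)]endo_mulE.
rewrite evenLe oddLe !endoE !hmulgE -!addrA; congr (_ + _).
by congr (_ + _); rewrite addrC.
Qed.

Lemma htmul_TLu x s t : TLu x (htmul s t) = htmul (TLu x s) t.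
Proof.
have [m1 m2] := htmul_bilinear.
apply: htmul_endol => X Y X' Y'; rewrite /TLu !endo_addE !tendoE !endoE (linear_D (m1 _)).
rewrite !htmulE /htwist !linearD /= !tendoE !endoE.
rewrite !hmulgE -[heven (Lu x Y)]endo_mulE -[hodd (Lu x Y)]endo_mulE.
by rewrite evenLu oddLu !endoE !hmulgE addrACA.
Qed.

Lemma htmul_TLp p s t : TLp p (htmul s t) = htmul (TLp p s) t.
Proof.
apply: htmul_endol => X Y X' Y'; rewrite /TLp !tendoE.
rewrite !htmulE /htwist !linearD /= !tendoE.
rewrite !hmulgE -[heven (Lp p Y)]endo_mulE -[hodd (Lp p Y)]endo_mulE.
by rewrite evenLp oddLp !endoE !hmulgE.
Qed.

Lemma hcoprodM X Y : hcoprod (hmul X Y) = htmul (hcoprod X) (hcoprod Y).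
Proof.
have [m1 m2] := htmul_bilinear.
elim/hopf_lind: X => [|c X X' EX EX'|x X EX|x X EX|p X EX].
- rewrite hmul1l hcoprod_one; elim/tensor_ind: (hcoprod Y) => [|c s t Es Et|X' Y'].
  + by rewrite (linear_0 (m2 _)).
  + by rewrite m2 -Es -Et.
  + by rewrite htmulE /htwist even_one odd_one hmul0l linear0 !hmul1l addr0.
- by rewrite hmulDl hmulZl !linearP /= EX EX' m1.
- by rewrite hmulgE !hcoprodgE EX htmul_TLe.
- by rewrite hmulgE !hcoprodgE EX htmul_TLu.
- by rewrite hmulgE !hcoprodgE EX htmul_TLp.
Qed.

(** * Antipode *)

(* S(a p v) = S(v) (p^-1 S(a)), and hR p a is the second factor. *)
Definition hR p a : V := hpure p^-1%g (1 ⊗ emap p^-1%g (ext_antipode a)).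

Lemma hR_linear p : linear (hR p).
Proof. by move=> c a b; rewrite /hR !linearP. Qed.
HB.instance Definition _ p := GRing.isLinear.Build K E V *:%R (hR p) (hR_linear p).
Lemma ipureU_linear : linear (fun v => hpure 1%g (v ⊗ 1) : V).
Proof. by move=> c v w; rewrite tpureDl tpureZl linearP. Qed.

Let antipode_bil p : Defs.bilinear
  (fun v a => hmul (hpure 1%g (uea_antipode v ⊗ 1)) (hR p a)).
Proof.
split=> [a c v w|v c a b]; last by rewrite !linearP.
by rewrite linearP ipureU_linear hmulDl hmulZl.
Qed.

Let antipode_lin p := tlift_linear (antipode_bil p).
Definition hantipode : V -> V := glift (fun p => tlift (fun v a =>
  hmul (hpure 1%g (uea_antipode v ⊗ 1)) (hR p a))).
Lemma hantipode_linear : linear hantipode.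
Proof. exact: glift_linear antipode_lin. Qed.

Lemma hantipodeE p v a : hantipode (hpure p (v ⊗ a)) =
  hmul (hpure 1%g (uea_antipode v ⊗ 1)) (hR p a).
Proof.
by rewrite [LHS](gliftE _ _ antipode_lin) [LHS](tliftE _ _ (antipode_bil p)).
Qed.

Opaque hantipode.
HB.instance Definition _ := GRing.isLinear.Build K V V *:%R hantipode hantipode_linear.

(** S(v) acts on p^-1 S(a) through [LUeaE], and the coproduct of S(v) is expressed by that of v. The
    group label is p^-1, so the inverse in [LUeaE] gives A_p. *)
Lemma hantipode_formula p v a : hantipode (hpure p (v ⊗ a)) =
  hpure p^-1%g (tlift (fun v1 v2 => uea_map (A p) (uea_antipode v1) ⊗
    uea_act (uea_antipode v2) (ext_map (A p^-1%g) (ext_antipode a))) (uea_coprod v)).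
Proof.
have B : Defs.bilinear (fun v1 v2 =>
    umap p v1 ⊗ uea_act v2 (emap p^-1%g (ext_antipode a))).
  split=> [v2 c v' v''|v1 c v' v'']; first by rewrite linearP tpureDl tpureZl.
  by rewrite uea_actZDl linearP.
rewrite hantipodeE /hR hmulE LExt1 Lp1 !endoE LUeaE.
rewrite tlift_coprod_antipode; last first.
  split=> [v2 c v' v''|v1 c v' v''].
  - by rewrite linearP mulrDl -scalerAl tpureDl tpureZl linearP.
  - by rewrite uea_actZDl !linearP.
transitivity (hpure p^-1%g (tlift (fun v1 v2 => umap p (uea_antipode v1) ⊗
    uea_act (uea_antipode v2) (emap p^-1%g (ext_antipode a))) (uea_coprod v))).
  rewrite (tlift_comp _ _ (bil_comp (@uea_antipode K h) (@uea_antipode K h) B)).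
  by apply: eq_tlift => v1 v2; rewrite invgK mulr1.
by congr hpure; apply: eq_tlift => v1 v2; rewrite umapE emapE.
Qed.

Lemma hantipode_one : hantipode hone = hone.
Proof.
by rewrite hantipodeE uea_antipode1 hmul1l /hR ext_antipode1 emap_1 invg1.
Qed.

(** S(x ∧ a) = - x ∧ S(a). Graded commutativity moves x to the right of S(a) and produces [hsigma];
    crossing the group element absorbs A_p^-1. *)
Lemma hR_Le p x a : hR p (ext_gen x * a) = - hmul (hsigma (hR p a)) (Le x hone).
Proof.
rewrite /hR hsigmaE ext_antipode_emap hmulE LUea1 endo_1E.
rewrite -[Lp _ (Le _ _)]endo_mulE LpLe endoE LpE emap_1 mulg1 LeE mulr1 LExtE.
rewrite -emap_gen -emapM -ext_gen_comm ext_antipodeM ext_antipode_gen mulNr.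
by rewrite !linearN.
Qed.

(** Bringing x to the far left leaves a commutator, which accounts for the term v ⊗ [x, a] of [Lu x]
    when S is applied in [hantipode_Lu]. *)
Lemma hR_Lu p x a : hmul (hR p a) (Lu x hone) =
  Lu (A p^-1%g x) (hR p a) - hR p (ext_derivation x a).
Proof.
rewrite /hR hmulE LUea1 endo_1E -[Lp _ (Lu _ _)]endo_mulE LpLu endoE.
rewrite -[LExt _ (Lu _ _)]endo_mulE.
have -> b y : LExt b * Lu y = Lu y * LExt b - LExt (ext_derivation y b).
  by rewrite LuExt addrK.
rewrite endoE endo_oppE endoE !LpE !emap_1 mulg1 !LExtE !mulr1.
by rewrite -emap_derivation ext_antipode_derivation.
Qed.

Lemma hR_Lp p q a : hmul (hR p a) (Lp q^-1%g hone) = hR (q * p)%g (emap q a).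
Proof.
rewrite /hR hmulE LUea1 endo_1E -[Lp _ (Lp _ _)]endo_mulE LpLp LpE !emap_1 mulg1 LExtE.
by rewrite mulr1 ext_antipode_emap -[emap _ (emap _ _)]endo_mulE -emap_mul invgM mulgVK.
Qed.

Lemma hantipode_Le x X :
  hantipode (Le x X) = - hmul (hsigma (hantipode X)) (Le x hone).
Proof.
move: X; apply: (hopf_eq (f := hantipode \o Le x)
  (g := - (hmul_l (Le x hone) * hsigma) \o hantipode)) => p v a.
rewrite /= !endoE hmul_lE LeE !hantipodeE hR_Le linearN sigmaM !hsigmaE /=.
by rewrite ext_antipode1 hmulA.
Qed.

Lemma hantipode_Lu x X : hantipode (Lu x X) = - hmul (hantipode X) (Lu x hone).
Proof.
move: X; apply: (hopf_eq (f := hantipode \o Lu x)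
  (g := - (hmul_l (Lu x hone)) \o hantipode)) => p v a.
rewrite /= !endoE hmul_lE LuE linearD /= !hantipodeE uea_antipodeM uea_antipode_gen.
rewrite -hmulA hR_Lu linearB /= opprB addrC mulrN tpureNl linearN /= hmulNl.
by rewrite !hmulE !LExt1 !Lp1 !endo_1E LUeaM LUea_gen endoE.
Qed.

Lemma hantipode_Lp q X : hantipode (Lp q X) = hmul (hantipode X) (Lp q^-1%g hone).
Proof.
move: X; apply: (hopf_eq (f := hantipode \o Lp q)
  (g := (hmul_l (Lp q^-1%g hone)) \o hantipode)) => p v a.
by rewrite /= hmul_lE LpE !hantipodeE -hmulA hR_Lp.
Qed.

Lemma hantipode_sigma X : hantipode (hsigma X) = hsigma (hantipode X).
Proof.
move: X; apply: (hopf_eq (f := hantipode \o hsigma) (g := hsigma \o hantipode)) => p v a.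
rewrite /= hsigmaE !hantipodeE sigmaM hsigmaE ext_antipode1 /hR hsigmaE.
by rewrite ext_antipode_emap.
Qed.

Let antl_bil : Defs.bilinear (fun X Y => hmul (hantipode X) Y).
Proof. by split=> ? c X Y; rewrite linearP // hmulDl hmulZl. Qed.
Let antr_bil : Defs.bilinear (fun X Y => hmul X (hantipode Y)).
Proof. by split=> ? c X Y; rewrite ?hmulDl ?hmulZl // !linearP. Qed.

(** S(x X1) ends in the generator x, which then stands next to X2. Hence for x in h, in either
    degree, the two terms produced by the coproduct cancel in each summand; for p the factors p^-1
    and p meet. *)
Lemma hantipodel X :
  tlift (fun X1 X2 => hmul (hantipode X1) X2) (hcoprod X) = hcounit X *: hone.
Proof.
have B := antl_bil.
elim/hopf_lind: X => [|c X X' EX EX'|x X EX|x X EX|p X EX].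
- by rewrite hcoprod_one tliftE // hantipode_one hmul1l hcounit_one scale1r.
- by rewrite linearP tliftP // EX EX' hcounit_linear scalerDl scalerA.
- rewrite hcoprod_Le endoE tliftD // !tlift_tendo // -tlift_add.
  rewrite hcounit_Le scale0r -[RHS](tlift_const0 _ (hcoprod X)).
  apply: eq_tlift => X1 X2; rewrite !endoE hantipode_Le hantipode_sigma hmulNl.
  by rewrite -hmulA hmulgE hmul1l addNr.
- rewrite hcoprod_Lu endoE tliftD // !tlift_tendo // -tlift_add.
  rewrite hcounit_Lu scale0r -[RHS](tlift_const0 _ (hcoprod X)).
  apply: eq_tlift => X1 X2; rewrite !endoE hantipode_Lu hmulNl.
  by rewrite -hmulA hmulgE hmul1l addNr.
- rewrite hcoprod_Lp tlift_tendo // hcounit_Lp -EX.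
  apply: eq_tlift => X1 X2; rewrite hantipode_Lp.
  by rewrite -hmulA !hmulgE hmul1l -endo_mulE LpLp mulVg Lp1 endoE.
Qed.

(** Here the generator ends up at the outer ends of X1 S(X2), so nothing cancels in a single
    summand. The whole sum for the new element is instead g applied to the sum for X, a multiple of
    the unit by induction; g kills the unit for x in h and fixes it for p. *)
Lemma hantipoder X :
  tlift (fun X1 X2 => hmul X1 (hantipode X2)) (hcoprod X) = hcounit X *: hone.
Proof.
have B := antr_bil.
elim/hopf_lind: X => [|c X X' EX EX'|x X EX|x X EX|p X EX].
- by rewrite hcoprod_one tliftE // hantipode_one hmul1l hcounit_one scale1r.
- by rewrite linearP tliftP // EX EX' hcounit_linear scalerDl scalerA.
- rewrite hcoprod_Le endoE tliftD // !tlift_tendo // -tlift_add.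
  (* The graded commutator with x: Z is sent to x Z - sigma(Z) x. *)
  pose g : endo V := Le x - hmul_l (Le x hone) * hsigma.
  transitivity (g (tlift (fun X1 X2 => hmul X1 (hantipode X2)) (hcoprod X))).
    rewrite (tlift_comp _ _ B); apply: eq_tlift => X1 X2 /=.
    rewrite !endoE hantipode_Le linearN /= hmul_lE sigmaM hmulA.
    by rewrite hmulgE.
  rewrite EX linearZ /= !endoE hmul_lE sigma_one hmul1l subrr scaler0.
  by rewrite hcounit_Le scale0r.
- rewrite hcoprod_Lu endoE tliftD // !tlift_tendo // -tlift_add.
  pose g : endo V := Lu x - hmul_l (Lu x hone).
  transitivity (g (tlift (fun X1 X2 => hmul X1 (hantipode X2)) (hcoprod X))).
    rewrite (tlift_comp _ _ B); apply: eq_tlift => X1 X2 /=.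
    by rewrite !endoE hantipode_Lu linearN /= hmul_lE hmulA hmulgE.
  rewrite EX linearZ /= !endoE hmul_lE hmul1l subrr scaler0.
  by rewrite hcounit_Lu scale0r.
- rewrite hcoprod_Lp tlift_tendo // hcounit_Lp.
  pose g : endo V := Lp p * hmul_l (Lp p^-1%g hone).
  transitivity (g (tlift (fun X1 X2 => hmul X1 (hantipode X2)) (hcoprod X))).
    rewrite (tlift_comp _ _ B); apply: eq_tlift => X1 X2 /=.
    by rewrite !endoE hantipode_Lp hmul_lE hmulA !hmulgE.
  rewrite EX linearZ /= !endoE hmul_lE hmul1l -endo_mulE LpLp mulgV Lp1 endoE.
  by [].
Qed.

(** * Differential *)

Let pairDE (X Y X' Y' : V) : (X, Y) + (X', Y') = (X + X', Y + Y') :> V2.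
Proof. by []. Qed.
Let pairZE c (X Y : V) : c *: (X, Y) = (c *: X, c *: Y) :> V2.
Proof. by []. Qed.
Lemma pair_endo_linear (f : endo V) : linear (fun z : V2 => (f z.1, f z.2)).
Proof. by move=> c [z1 z2] [w1 w2]; rewrite /= !linearP. Qed.
Definition pair_endo f : endo V2 := Endo (pair_endo_linear f).

(* The algebra map dExt from /\(h) to the endomorphisms of V * V sending x to
   dstep x maps a to (Y, Z) |-> (d(a) Z + sigma(a) Y, a Z), where d is the
   derivation with d x = x in U(h); it exists because dstep x squares to 0. *)
Lemma dstep_linear x : linear (fun z : V2 => (Lu x z.2 - Le x z.1, Le x z.2)).
Proof.
move=> c [z1 z2] [w1 w2]; rewrite /= !linearP /= addrACA -scalerDr.
by [].
Qed.

Definition dstep x : endo V2 := Endo (dstep_linear x).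
Lemma pair_endoE f z : pair_endo f z = (f z.1, f z.2). Proof. by []. Qed.
Lemma dstepE x z : dstep x z = (Lu x z.2 - Le x z.1, Le x z.2). Proof. by []. Qed.
Opaque pair_endo dstep.

Lemma Le0 : Le 0 = 0.
Proof.
rewrite -(addNr (0 : h)) -scaleN1r Le_comb.
by apply: endoP => X; rewrite !endoE scaleN1r addNr.
Qed.

Let dstep_rel t u : @ext_rel K h t u ->
  aeval (@endo_scal K V2) dstep t = aeval (@endo_scal K V2) dstep u.
Proof.
apply: ext_rel_lift => // [c x y|x]; apply: endoP => -[X Y].
- rewrite !endoE !dstepE Le_comb Lu_comb !endoE /= pairZE pairDE.
  by congr pair; rewrite scalerBr opprD addrACA.
(* Writing x' for x in degree 0, the first entry of the square is x' (x Y) - x (x' Y) + x (x X). The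
   first two terms give [x, x] Y = 0, and x squares to 0. *)
- rewrite !endoE !dstepE /= linearB /= -[Lu x (Le x Y)]endo_mulE LuLe liexx Le0.
  rewrite addr0 endo_mulE -[Le x (Le x X)]endo_mulE -[Le x (Le x Y)]endo_mulE LeLe.
  by rewrite !endo_0E subr0 subrr.
Qed.

Definition dExt a : endo V2 := palg_lift (@endo_scal K V2) dstep a.
Lemma dExt_gen x : dExt (ext_gen x) = dstep x.
Proof. exact: (palg_lift_gen (endo_scal_central V2) dstep_rel). Qed.
Lemma dExt1 : dExt 1 = 1.
Proof. exact: (palg_lift1 (endo_scal_central V2) dstep_rel). Qed.
Lemma dExtM a b : dExt (a * b) = dExt a * dExt b.
Proof. exact: (palg_liftM (endo_scal_central V2) dstep_rel). Qed.

Lemma dExt_comb c a b : dExt (c *: a + b) = endo_scal V2 c * dExt a + dExt b.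
Proof.
rewrite /dExt (palg_liftD (endo_scal_central V2) dstep_rel).
by rewrite (palg_liftZ (endo_scal_central V2) dstep_rel).
Qed.

Opaque dExt.

Lemma dExt0 z : dExt 0 z = 0.
Proof.
rewrite -(addNr (0 : E)) -scaleN1r dExt_comb.
by rewrite !endoE scaleN1r addNr.
Qed.

Lemma dExt_snd a z : (dExt a z).2 = LExt a z.2.
Proof.
elim/ext_lind: a => [|c a b Ea Eb|x a Ea].
- by rewrite dExt1 LExt1 !endoE.
- by rewrite dExt_comb LExt_comb !endoE /= Ea Eb.
- by rewrite dExtM LExtM dExt_gen LExt_gen !endoE dstepE /= Ea.
Qed.

Lemma dExt_Lp q a z : dExt (emap q a) (pair_endo (Lp q) z) = pair_endo (Lp q) (dExt a z).
Proof.
elim/ext_lind: a => [|c a b Ea Eb|x a Ea].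
- by rewrite emap_1 dExt1 !endoE.
- by rewrite !linearP !dExt_comb !endoE Ea Eb linearP.
- rewrite emapM emap_gen !dExtM !endoE Ea !dExt_gen !(dstepE, pair_endoE) /=.
  rewrite linearB /= -[Lp q (Lu _ _)]endo_mulE -![Lp q (Le _ _)]endo_mulE.
  by rewrite LpLu !LpLe !endoE.
Qed.

(** With h acting diagonally on pairs, [dstep] is equivariant: its two entries transform by [LuLu]
    and [LuLe]. This passes to all of ∧(h) by the Leibniz rule. *)
Lemma dExt_Lu x a z : pair_endo (Lu x) (dExt a z) =
  dExt a (pair_endo (Lu x) z) + dExt (ext_derivation x a) z.
Proof.
elim/ext_lind: a => [|c a b Ea Eb|y a Ea].
- by rewrite ext_derivation1 dExt1 dExt0 !endoE addr0.
- rewrite (linearP (ext_derivation x)) !dExt_comb !endoE linearP /= Ea Eb.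
  by rewrite scalerDr addrACA.
- rewrite ext_derivationM ext_derivation_gen -[X in dExt (X + _)]scale1r dExt_comb.
  rewrite !dExtM !endoE scale1r addrCA -[in RHS]linearD -Ea !dExt_gen.
  rewrite !(dstepE, pair_endoE) /=; congr pair.
  + rewrite dstepE linearB /= -[Lu x (Lu _ _)]endo_mulE -[Lu x (Le _ _)]endo_mulE.
    rewrite LuLu LuLe !endoE.
    by rewrite opprD addrACA addrC.
  + by rewrite -[Lu x (Le _ _)]endo_mulE LuLe !endoE addrC.
Qed.

Let d_bil p : Defs.bilinear (fun v a => (dExt a (0, hpure p (v ⊗ 1))).1).
Proof.
split=> [a c v w|v c a b]; last by rewrite dExt_comb !endoE.
rewrite tpureDl tpureZl linearP -/V.
have -> : (0, c *: hpure p (v ⊗ 1) + hpure p (w ⊗ 1)) =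
    c *: ((0 : V), hpure p (v ⊗ 1)) + (0, hpure p (w ⊗ 1)) :> V2.
  by congr pair; rewrite /= scaler0 addr0.
by rewrite linearP.
Qed.

Let d_lin p := tlift_linear (d_bil p).
(** The starting pair (0, Z) with Z = (p, v ⊗ 1) records that Z has differential 0; after a has
    acted, the first entry is the differential of a Z. *)
Definition hdiff : V -> V := glift (fun p => tlift (fun v a =>
  (dExt a (0, hpure p (v ⊗ 1))).1)).
Lemma hdiff_linear : linear hdiff.
Proof. exact: glift_linear d_lin. Qed.
Lemma hdiffE p v a : hdiff (hpure p (v ⊗ a)) = (dExt a (0, hpure p (v ⊗ 1))).1.
Proof. by rewrite [LHS](gliftE _ _ d_lin) [LHS](tliftE _ _ (d_bil p)). Qed.
Opaque hdiff.
Definition hd : endo V := Endo hdiff_linear.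
Lemma hdE X : hd X = hdiff X. Proof. by []. Qed.
Opaque hd.

Lemma dLe x : hd * Le x = Lu x - Le x * hd.
Proof.
apply: hopf_endo_eq => p v a; rewrite !endo_mulE !endo_addE endo_oppE endo_mulE.
rewrite LeE !hdE !hdiffE dExtM endo_mulE dExt_gen dstepE /= dExt_snd LExtE /=.
by rewrite mulr1.
Qed.

Lemma dLp q : hd * Lp q = Lp q * hd.
Proof.
apply: hopf_endo_eq => p v a; rewrite !endo_mulE LpE !hdE !hdiffE.
rewrite (_ : (_, _) = pair_endo (Lp q) (0, hpure p (v ⊗ 1))); last first.
  by rewrite pair_endoE /= linear0 LpE emap_1.
by rewrite dExt_Lp pair_endoE.
Qed.

Lemma dLu x : hd * Lu x = Lu x * hd.
Proof.
apply: hopf_endo_eq => p v a; rewrite !endo_mulE LuE linearD /= !hdE !hdiffE.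
(* As [x, 1] = 0, [Lu x] takes the starting pair to another starting pair, so the right-hand side
   collects the differentials of the two terms of [LuE]. *)
have := congr1 fst (dExt_Lu x a (0, hpure p (v ⊗ 1))).
rewrite !pair_endoE /= linear0 LuE ext_derivation1 !linear0 addr0 => ->.
by [].
Qed.

Lemma d_one : hd hone = 0.
Proof. by rewrite hdE hdiffE dExt1 endoE. Qed.
Lemma hd_Le x X : hd (Le x X) = Lu x X - Le x (hd X).
Proof. by rewrite -endo_mulE dLe !endoE. Qed.
Lemma hd_Lu x X : hd (Lu x X) = Lu x (hd X).
Proof. by rewrite -endo_mulE dLu !endoE. Qed.
Lemma hd_Lp p X : hd (Lp p X) = Lp p (hd X).
Proof. by rewrite -endo_mulE dLp !endoE. Qed.

(** Induction on the number of factors, by d(x X) = x' X - x d(X) for the first factor x, where x'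
    is x in degree 0. The term x' X yields all contributions with i = 0 in both sums, the term - x
    d(X) those in which every index is positive. *)
Lemma hd_formula p v n (c : 'I_n -> h) :
  hd (hpure p (v ⊗ \prod_(l < n) ext_gen (c l))) =
  hpure p
    (\sum_(i < n) (-1) ^+ i *:
       ((uea_gen (A p^-1%g (c i)) * v) ⊗
        (\prod_(l < n | l != i) ext_gen (c l)))
     + \sum_(i < n) \sum_(j < n | (i < j)%N) (-1) ^+ (i + j + 1) *:
       (v ⊗ (ext_gen (lie (c i) (c j)) *
             \prod_(l < n | (l != i) && (l != j)) ext_gen (c l)))).
Proof.
elim: n c => [|n IHn] c.
  by rewrite !big_ord0 addr0 linear0 hdE hdiffE dExt1 endoE.
rewrite [in LHS]big_ord_recl -LeE hd_Le IHn LuE derivation_prod.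
rewrite 2![in RHS]big_ord_recl sum_recl_cond /= add0r expr0 scale1r.
rewrite prod_recl_cond eqxx mul1r.
set T1 := (\sum_(i < n) _ in RHS); set T2 := (\sum_(j | _) _ in RHS).
set T3 := (\sum_(i < n) _ in RHS).
rewrite [in LHS]linearD [in LHS](linearD (Le _)) /=.
rewrite opprD addrACA -!addrA !linearD /=; congr (_ + (_ + (_ + _))).
- rewrite {}/T1 !linear_sum; apply: eq_bigr => i _.
  rewrite /= prod_recl_cond neq_lift /bump /= add1n exprS mulN1r scaleNr.
  by rewrite [RHS]linearN /=; congr (- _); rewrite !linearZ /= LeE.
(* The brackets of the first factor with the one at position j + 1: the sign (-1)^(0 + (j+1) + 1) is
   the (-1)^j of [derivation_prod]. *)
- rewrite {}/T2 !linear_sum; apply: eq_bigr => j _ /=.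
  rewrite prod_recl_cond eqxx /= mul1r !linearZ /=.
  by rewrite /bump /= add0n add1n addn1 !exprS !mulN1r opprK.
(* Both indices shift by one, so the power of -1 is unchanged; the minus sign in front is used up by
   moving the first factor past the bracket. *)
- rewrite {}/T3 !linear_sum; apply: eq_bigr => i _.
  rewrite /= sum_recl_cond /= add0r !linear_sum.
  apply: eq_bigr => j _ /=.
  rewrite prod_recl_cond /= [RHS]linearZ -scaleN1r !linearZ /= LeE.
  rewrite /bump /= !add1n !addn1 addSn addnS !exprS !mulN1r !opprK; congr (_ *: _).
  rewrite mulrA [X in X * _]ext_gen_anticomm mulNr -mulrA !linearN /=.
  by rewrite opprK.
Qed.

Lemma hd_sigmaE X : hd (hsigma X) = - hsigma (hd X).
Proof.
elim/hopf_lind: X => [|c X X' EX EX'|x X EX|x X EX|p X EX].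
- by rewrite sigma_one d_one linear0 oppr0.
- by rewrite !linearP /= EX EX'.
- rewrite -[hsigma (Le _ _)]endo_mulE sigmaLe !endoE (linearN hd) /= !hd_Le EX.
  rewrite (linearB hsigma) /= -[hsigma (Le _ _)]endo_mulE -[hsigma (Lu _ _)]endo_mulE.
  by rewrite sigmaLe sigmaLu !endoE (linearN (Le x)) /= !opprK.
- rewrite -[hsigma (Lu _ _)]endo_mulE sigmaLu endo_mulE !hd_Lu EX.
  by rewrite -[hsigma (Lu _ _)]endo_mulE sigmaLu endo_mulE linearN.
- rewrite -[hsigma (Lp _ _)]endo_mulE sigmaLp endo_mulE !hd_Lp EX.
  by rewrite -[hsigma (Lp _ _)]endo_mulE sigmaLp endo_mulE linearN.
Qed.

Lemma hd_sigma : hd * hsigma = - (hsigma * hd).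
Proof. by apply: endoP => X; rewrite !endoE hd_sigmaE. Qed.

Lemma hd_square X : hd (hd X) = 0.
Proof.
elim/hopf_lind: X => [|c X X' EX EX'|x X EX|x X EX|p X EX].
- by rewrite d_one linear0.
- by rewrite !linearP /= EX EX' scaler0 addr0.
(* With x' for x in degree 0, d(x' X - x dX) = x' dX - (x' dX - x ddX), and ddX = 0 by induction. *)
- by rewrite hd_Le linearB /= hd_Lu hd_Le EX linear0 subr0 subrr.
- by rewrite !hd_Lu EX linear0.
- by rewrite !hd_Lp EX linear0.
Qed.

Lemma hd_mul X Y : hd (hmul X Y) = hmul (hd X) Y + hmul (hsigma X) (hd Y).
Proof.
elim/hopf_lind: X => [|c X X' EX EX'|x X EX|x X EX|p X EX].
- by rewrite d_one hmul0l sigma_one !hmul1l add0r.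
- rewrite hmulDl hmulZl !linearP /= EX EX' !hmulDl !hmulZl scalerDr addrACA.
  by [].
- rewrite hmulgE !hd_Le EX hmulDl hmulNl !hmulgE linearD /=.
  by rewrite -[hsigma (Le _ _)]endo_mulE sigmaLe !endoE hmulNl hmulgE opprD addrA.
- rewrite hmulgE !hd_Lu EX linearD /= -[hsigma (Lu _ _)]endo_mulE sigmaLu endo_mulE.
  by rewrite !hmulgE.
- rewrite hmulgE !hd_Lp EX linearD /= -[hsigma (Lp _ _)]endo_mulE sigmaLp endo_mulE.
  by rewrite !hmulgE.
Qed.

Definition hd2 : endo VV := tendo hd 1 + tendo hsigma hd.

(** [hd2] satisfies on V ⊗ V the relations of [hd]: [hd2 * TLe x = TLu x - TLe x * hd2], while it
    commutes with [TLu x] and [TLp p]. The mixed terms cancel because [hsigma] anticommutes with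
    both [Le x] and [hd]. *)
Lemma hcoprod_hd X : hcoprod (hd X) = hd2 (hcoprod X).
Proof.
elim/hopf_lind: X => [|c X X' EX EX'|x X EX|x X EX|p X EX].
- rewrite d_one linear0 hcoprod_one /hd2 !endo_addE !tendoE d_one.
  by rewrite tpure0l linear0 addr0.
- by rewrite !linearP /= EX EX'.
- rewrite hd_Le linearB /= hcoprod_Lu !hcoprod_Le EX.
  rewrite -!endo_mulE -endo_oppE -endo_addE; congr (endo_fun _ _).
  rewrite /hd2 /TLe /TLu !(mulrDl, mulrDr) !tendoM !mul1r !mulr1 dLe sigma2.
  rewrite sigmaLe hd_sigma !tendoDl !tendoDr !tendoNl !tendoNr.
  by rewrite !opprD [LHS](AC (2*(2*2))%AC ((1*3*5)*(4*(2*6)))%AC).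
- rewrite hd_Lu !hcoprod_Lu EX -!endo_mulE; congr (endo_fun _ _).
  rewrite /hd2 /TLu !(mulrDl, mulrDr) !tendoM !mul1r !mulr1 dLu sigmaLu.
  by rewrite addrACA.
- rewrite hd_Lp !hcoprod_Lp EX -!endo_mulE; congr (endo_fun _ _).
  by rewrite /hd2 /TLp !(mulrDl, mulrDr) !tendoM !mul1r !mulr1 dLp sigmaLp.
Qed.

(** * Filtration *)

Lemma filt_subspace k r : subspace (F k r).
Proof. exact: span_subspace. Qed.

Lemma filt_mono k r s X : (r <= s)%N -> F k r X -> F k s X.
Proof.
move=> rs; apply: span_ind; first exact: filt_subspace.
move=> _ [p [v [a [vr ak ->]]]]; apply: span_gen; exists p, v, a; split=> //.
exact: uea_filt_mono vr.
Qed.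

Lemma filt_pure k r p v a : uea_filt r v -> ext_deg k a -> F k r (hpure p (v ⊗ a)).
Proof. by move=> vr ak; apply: span_gen; exists p, v, a. Qed.

Lemma filt_Le k r x X : F k r X -> F k.+1 r (Le x X).
Proof.
apply: (span_ind (P := fun X => F k.+1 r (Le x X))).
  exact: (subspace_preim _ (filt_subspace _ _)).
move=> _ [p [v [a [vr ak ->]]]]; rewrite LeE; apply: filt_pure => //.
exact: ext_deg_gen.
Qed.

Lemma filt_Lu k r x X : F k r X -> F k r.+1 (Lu x X).
Proof.
apply: (span_ind (P := fun X => F k r.+1 (Lu x X))).
  exact: (subspace_preim _ (filt_subspace _ _)).
move=> _ [p [v [a [vr ak ->]]]]; rewrite LuE.
apply: subspaceD; [exact: filt_subspace|exact: filt_pure (uea_filt_gen _ vr) ak|].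
by apply: filt_pure (ext_deg_derivation _ ak); apply: uea_filt_mono vr.
Qed.

Lemma filt_Lp k r p X : F k r X -> F k r (Lp p X).
Proof.
apply: (span_ind (P := fun X => F k r (Lp p X))).
  exact: (subspace_preim _ (filt_subspace _ _)).
move=> _ [q [v [a [vr ak ->]]]]; rewrite LpE; apply: filt_pure => //.
exact: ext_deg_emap.
Qed.

Lemma filt_one : F 0 0 hone.
Proof.
by apply: filt_pure; apply: span_gen; exists [::]; rewrite big_nil.
Qed.

(** Generators of ∧(h) raise the degree, generators of U(h) the filtration index, and group elements
    neither. The second premise is there because [uea_filt r] also contains the words shorter than
    r. *)
Lemma filt_ind (Q : nat -> nat -> V -> Prop) :
  (forall k r, subspace (Q k r)) -> (forall k r X, Q k r X -> Q k r.+1 X) ->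
  Q 0 0 hone -> (forall k r x X, Q k r X -> Q k.+1 r (Le x X)) ->
  (forall k r x X, Q k r X -> Q k r.+1 (Lu x X)) ->
  (forall k r p X, Q k r X -> Q k r (Lp p X)) ->
  forall k r X, F k r X -> Q k r X.
Proof.
move=> QS Qr Q1 Qe Qu Qp k r; apply: span_ind => // _ [p [v [a [vr ak ->]]]].
move: a ak; apply: span_ind.
  exact: (subspace_preim (hpure p \o tpure v) (QS k r)).
move=> _ [t [<- ->]]; move: v vr; apply: span_ind.
  split=> [|c v w Qv Qw]; first by rewrite tpure0l linear0; apply: (QS _ _).1.
  by rewrite tpureDl tpureZl linearP; apply: (QS _ _).2.
move=> _ [s [sr ->]]; rewrite hpureE.
have Qmono j m n X : (m <= n)%N -> Q j m X -> Q j n X.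
  by move=> /subnKC <-; elim: (n - m)%N => [|i IHi] QX;
    rewrite ?addn0 // addnS; apply/Qr/IHi.
(* The construction reaches the index [size s], at most r; the rest is monotonicity. *)
apply: (Qmono _ (size s)) => //.
have: Q 0 (size s) (Lp p (LUea (\prod_(x <- s) uea_gen x) hone)).
  apply: Qp; elim: (s) => [|x s' IHs]; first by rewrite big_nil LUea1 endo_1E.
  by rewrite big_cons LUeaM LUea_gen endo_mulE; apply: Qu.
elim: t (Lp _ _) => [|x t IHt] X QX; first by rewrite big_nil LExt1 endo_1E.
by rewrite big_cons LExtM LExt_gen endo_mulE; apply/Qe/IHt.
Qed.

Lemma filt_mul i j s t X Y : F i s X -> F j t Y -> F (i + j) (s + t) (hmul X Y).
Proof.
move=> FX; move: i s X FX j t Y.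
apply: (filt_ind (Q := fun i s X => forall j t Y,
  F j t Y -> F (i + j) (s + t) (hmul X Y))).
- move=> k r; split=> [j t Y _|c X X' QX QX' j t Y FY].
    by rewrite hmul0l; apply: (filt_subspace _ _).1.
  by rewrite hmulDl hmulZl; apply: (filt_subspace _ _).2; auto.
- by move=> k r X QX j t Y FY; apply: filt_mono (QX _ _ _ FY); rewrite addSn.
- by move=> j t Y FY; rewrite hmul1l.
- by move=> k r x X QX j t Y FY; rewrite hmulgE addSn; apply/filt_Le/QX.
- by move=> k r x X QX j t Y FY; rewrite hmulgE addSn; apply/filt_Lu/QX.
- by move=> k r p X QX j t Y FY; rewrite hmulgE; apply/filt_Lp/QX.
Qed.

(** This is where the operator form of the identities becomes the signed form of the axioms. *)
Lemma filt_sigma k r X : F k r X -> hsigma X = (-1) ^+ k *: X.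
Proof.
move: k r X; apply: (filt_ind (Q := fun k r X => hsigma X = (-1) ^+ k *: X)).
- move=> k r; exact: (subspace_eq hsigma (endo_scal V ((-1) ^+ k))).
- by [].
- by rewrite sigma_one scale1r.
- move=> k r x X EX; rewrite -endo_mulE sigmaLe endo_oppE endo_mulE EX linearZ /=.
  by rewrite exprS mulN1r scaleNr.
- by move=> k r x X EX; rewrite -endo_mulE sigmaLu endo_mulE EX linearZ.
- by move=> k r p X EX; rewrite -endo_mulE sigmaLp endo_mulE EX linearZ.
Qed.

Lemma filt_parity k r X : F k r X ->
  heven X = (if odd k then 0 else X) /\
  hodd X = (if odd k then X else 0).
Proof.
move: k r X; apply: (filt_ind (Q := fun k r X =>
  heven X = (if odd k then 0 else X) /\
  hodd X = (if odd k then X else 0))).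
- move=> k r; case: (odd k); split; rewrite ?linear0 // => c X Y [e1 o1] [e2 o2];
    by rewrite !linearP /= e1 e2 o1 o2 scaler0 addr0.
- by [].
- by rewrite even_one odd_one.
- move=> k r x X [EX OX]; rewrite -!endo_mulE evenLe oddLe !endo_mulE EX OX /=.
  by case: odd; rewrite /= linear0.
- move=> k r x X [EX OX]; rewrite -!endo_mulE evenLu oddLu !endo_mulE EX OX /=.
  by case: odd; rewrite /= linear0.
- move=> k r p X [EX OX]; rewrite -!endo_mulE evenLp oddLp !endo_mulE EX OX /=.
  by case: odd; rewrite /= linear0.
Qed.

Lemma filt_sigma_closed k r X : F k r X -> F k r (hsigma X).
Proof.
by move=> FX; rewrite (filt_sigma FX); apply: subspaceZ => //; apply: filt_subspace.
Qed.

Definition coprod_filt k r : VV -> Prop :=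
  Defs.span (fun z => exists i j s t Y Y',
      [/\ (i + j = k)%N, (s + t = r)%N, F i s Y, F j t Y' & z = Y ⊗ Y']).
Lemma coprod_filt_pure i j s t k r Y Y' : (i + j = k)%N -> (s + t = r)%N ->
  F i s Y -> F j t Y' -> coprod_filt k r (Y ⊗ Y').
Proof. by move=> *; apply: span_gen; exists i, j, s, t, Y, Y'. Qed.

Lemma filt_coprod k r X : F k r X -> coprod_filt k r (hcoprod X).
Proof.
move: k r X; apply: (filt_ind (Q := fun k r X => coprod_filt k r (hcoprod X))).
- by move=> k r; apply: subspace_preim; apply: span_subspace.
(* To pass from r to r + 1, the index of the second tensor factor is raised. *)
- move=> k r X; apply: span_ind; first exact: span_subspace.
  move=> _ [i [j [s [t [Y [Y' [<- <- FY FY' ->]]]]]]].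
  by apply: (coprod_filt_pure _ _ FY (filt_mono (leqnSn t) FY')); rewrite ?addnS.
- by rewrite hcoprod_one; apply: (coprod_filt_pure _ _ filt_one filt_one).
- move=> k r x X; rewrite hcoprod_Le.
  apply: (span_ind (P := fun z => coprod_filt k.+1 r (TLe x z))).
    by apply: subspace_preim; apply: span_subspace.
  move=> _ [i [j [s [t [Y [Y' [<- <- FY FY' ->]]]]]]].
  rewrite /TLe endo_addE !tendoE endo_1E; apply: subspaceD.
  + exact: span_subspace.
  + by apply: (coprod_filt_pure _ _ (filt_Le x FY) FY'); rewrite ?addSn.
  + by apply: (coprod_filt_pure _ _ (filt_sigma_closed FY) (filt_Le x FY'));
      rewrite ?addnS.
- move=> k r x X; rewrite hcoprod_Lu.
  apply: (span_ind (P := fun z => coprod_filt k r.+1 (TLu x z))).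
    by apply: subspace_preim; apply: span_subspace.
  move=> _ [i [j [s [t [Y [Y' [<- <- FY FY' ->]]]]]]].
  rewrite /TLu endo_addE !tendoE !endo_1E; apply: subspaceD.
  + exact: span_subspace.
  + by apply: (coprod_filt_pure _ _ (filt_Lu x FY) FY'); rewrite ?addSn.
  + by apply: (coprod_filt_pure _ _ FY (filt_Lu x FY')); rewrite ?addnS.
- move=> k r p X; rewrite hcoprod_Lp.
  apply: (span_ind (P := fun z => coprod_filt k r (TLp p z))).
    by apply: subspace_preim; apply: span_subspace.
  move=> _ [i [j [s [t [Y [Y' [<- <- FY FY' ->]]]]]]].
  rewrite /TLp tendoE.
  by apply: (coprod_filt_pure _ _ (filt_Lp p FY) (filt_Lp p FY')).
Qed.

Lemma filt_counit k r X : F k r X -> (0 < k)%N -> hcounit X = 0.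
Proof.
move: k r X; apply: (filt_ind (Q := fun k r X => (0 < k)%N -> hcounit X = 0)).
- move=> k r; split=> [_|c X Y EX EY k0].
    exact: linear_0 (hcounit_linear : linear (_ : V -> K^o)).
  by rewrite hcounit_linear EX // EY // mulr0 addr0.
- by [].
- by [].
- by move=> *; rewrite hcounit_Le.
- by move=> *; rewrite hcounit_Lu.
- by move=> k r p X EX k0; rewrite hcounit_Lp EX.
Qed.

(** S of a generator times X is, up to sign and [hsigma], S(X) times one generator, so [filt_mul]
    bounds it. *)
Lemma filt_antipode k r X : F k r X -> F k r (hantipode X).
Proof.
have SF i s := filt_subspace i s.
move: k r X; apply: (filt_ind (Q := fun k r X => F k r (hantipode X))).
- by move=> k r; apply: subspace_preim.
- by move=> k r X; apply: filt_mono.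
- by rewrite hantipode_one; apply: filt_one.
- move=> k r x X FX; rewrite hantipode_Le -addn1 -[r]addn0; apply: subspaceN => //.
  by apply: filt_mul (filt_sigma_closed FX) (filt_Le x filt_one).
- move=> k r x X FX; rewrite hantipode_Lu -addn1 -[k]addn0; apply: subspaceN => //.
  by apply: filt_mul FX (filt_Lu x filt_one).
- move=> k r p X FX; rewrite hantipode_Lp -[k]addn0 -[r]addn0.
  by apply: filt_mul FX (filt_Lp _ filt_one).
Qed.

(** Membership of X itself is carried along because d(x X) contains [Lu x X]; this term is also what
    raises r by one. In degree 0 the claim has to be d(X) = 0, which makes the other term, - x d(X),
    vanish when x X has degree 1. *)
Lemma filt_hd k r X : F k r X ->
  F k r X /\ if k is k'.+1 then F k' r.+1 (hd X) else hd X = 0.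
Proof.
have SF i s := filt_subspace i s.
move: k r X; apply: (filt_ind (Q := fun k r X =>
  F k r X /\ if k is k'.+1 then F k' r.+1 (hd X) else hd X = 0)).
- move=> k r; split.
    by rewrite linear0; case: k => [|k]; split=> //; apply: (SF _ _).1.
  move=> c X Y [FX dX] [FY dY]; split; first by apply: (SF _ _).2.
  case: k {FX FY} dX dY => [|k] dX dY; rewrite linearP /=.
    by rewrite dX dY scaler0 addr0.
  by apply: (SF _ _).2.
- move=> k r X [FX dX]; split; first exact: filt_mono FX.
  by case: k {FX} dX => // k; apply: filt_mono.
- by rewrite d_one; split=> //; apply: filt_one.
- move=> k r x X [FX dX]; split; first exact: filt_Le.
  rewrite hd_Le; apply: subspaceD => //; first exact: filt_Lu.
  apply: subspaceN => //; case: k {FX} dX => [->|k dX].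
    by rewrite linear0; apply: (SF _ _).1.
  exact: filt_Le.
- move=> k r x X [FX dX]; split; first exact: filt_Lu.
  by rewrite hd_Lu; case: k {FX} dX => [->|k dX]; [rewrite linear0|apply: filt_Lu].
- move=> k r p X [FX dX]; split; first exact: filt_Lp.
  by rewrite hd_Lp; case: k {FX} dX => [->|k dX]; [rewrite linear0|apply: filt_Lp].
Qed.

(** The degree projections of ∧(h) separate the components, which is what makes their sum direct. *)
Lemma filt_proj j k r X : F k r X ->
  Lext (ext_proj h j) X = if j == k then X else 0.
Proof.
apply: (span_ind (P := fun X => Lext (ext_proj h j) X = if j == k then X else 0)).
  case: (j == k).
  - exact: (subspace_eq (Lext (ext_proj h j)) idfun).
  - exact: (subspace_eq (Lext (ext_proj h j)) \0).
move=> _ [p [v [a [_ ak ->]]]]; rewrite LextE /=.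
suff -> : ext_proj h j a = if j == k then a else 0.
  by case: eqP; rewrite ?linear0.
move: a ak; apply: span_ind.
  case: (j == k).
  - exact: (subspace_eq (ext_proj h j) idfun).
  - exact: (subspace_eq (ext_proj h j) \0).
by move=> _ [s [<- ->]]; apply: ext_proj_prod.
Qed.

Lemma filt_generate X : exists n (f : nat -> V),
  (forall k, homog F k (f k)) /\ X = \sum_(k < n) f k.
Proof.
have F0 k : homog F k 0 by exists 0%N; apply: (filt_subspace _ _).1.
have trunc n m (f : nat -> V) : (n <= m)%N ->
    \sum_(k < n) f k = \sum_(k < m) (if (k < n)%N then f k else 0).
  by move=> nm; rewrite (big_ord_widen _ f nm) big_mkcond.
elim/hopf_lind: X.
- exists 1%N, (fun k => if k is 0 then hone else 0); split; last by rewrite big_ord1.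
  by case=> [|k] //; exists 0%N; apply: filt_one.
- move=> c X Y [n [f [fF ->]]] [m [g [gF ->]]].
  (* The values of f beyond n and of g beyond m are arbitrary, so each family is cut off at its own
     bound before the two are added. *)
  exists (maxn n m), (fun k => c *: (if (k < n)%N then f k else 0) +
    (if (k < m)%N then g k else 0)); split.
    move=> k; have [r Fr] : homog F k (if (k < n)%N then f k else 0) by case: ifP.
    have [s Fs] : homog F k (if (k < m)%N then g k else 0) by case: ifP.
    exists (maxn r s) => /=; apply: (filt_subspace _ _).2.
      exact: filt_mono (leq_maxl _ _) Fr.
    exact: filt_mono (leq_maxr _ _) Fs.
  by rewrite big_split -scaler_sumr /= -!trunc ?leq_maxl ?leq_maxr.
- move=> x X [n [f [fF ->]]].
  exists n.+1, (fun k => if k is k'.+1 then Le x (f k') else 0); split.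
    by case=> [|k] //; have [r fr] := fF k; exists r; apply: filt_Le.
  by rewrite big_ord_recl add0r linear_sum.
- move=> x X [n [f [fF ->]]]; exists n, (fun k => Lu x (f k)); split.
    by move=> k; have [r fr] := fF k; exists r.+1; apply: filt_Lu.
  by rewrite linear_sum.
- move=> p X [n [f [fF ->]]]; exists n, (fun k => Lp p (f k)); split.
    by move=> k; have [r fr] := fF k; exists r; apply: filt_Lp.
  by rewrite linear_sum.
Qed.

Lemma filt_graded : filtered_graded F.
Proof.
split.
- exact: filt_subspace.
- by move=> k r s X; apply: filt_mono.
- exact: filt_generate.
- move=> n f fF f0 k kn; have := congr1 (Lext (ext_proj h k)) f0.
  rewrite linear0 linear_sum (bigD1 (Ordinal kn)) //= big1 => [|i /eqP ik].
    by have [r fr] := fF k; rewrite (filt_proj _ fr) eqxx addr0.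
  have [r fr] := fF i; rewrite (filt_proj _ fr); case: eqP => // ki.
  by case: ik; apply: val_inj.
Qed.

(** For homogeneous Y one of its even and odd parts is Y and the other 0, so one term of [htwist]
    survives; it carries (-1)^j exactly when i is odd. *)
Lemma htmul_signed : signed_mul F hmul htmul.
Proof.
split=> [|i j X Y X' Y' [r FY] [s FX']]; first exact: htmul_bilinear.
have [eY oY] := filt_parity FY.
rewrite htmulE /htwist eY oY (filt_sigma FX') linearZ /= tpureZl.
rewrite -[(-1) ^+ (i * j)]signr_odd oddM -[(-1) ^+ j]signr_odd.
by case: odd; rewrite /= hmul0l linear0 ?scaler0 ?addr0 ?add0r ?scale1r.
Qed.

Lemma hd2_signed : signed_diff F hd hd2.
Proof.
split=> [|i X Y [r FX]]; first exact: endo_linear.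
by rewrite /hd2 endo_addE !tendoE endo_1E (filt_sigma FX) tpureZl.
Qed.

Lemma hopf_structure :
  filtered_dg_hopf F hmul hone hcoprod hcounit hantipode hd.
Proof.
split.
- exact: filt_graded.
- split.
  + by split=> [Y c X X'|X c Y Y']; rewrite ?hmulDl ?hmulZl // linearP.
  + exact: hmulA.
  + exact: hmul1l.
  + exact: hmul1r.
  + exact: hcoprod_linear.
  + exact: hcoassoc.
  + exact: hcounit_linear.
  + exact: hcounitl.
  + exact: hcounitr.
  + exact: hcoprod_one.
  + exists htmul; split; [exact: htmul_signed|exact: hcoprodM].
  + exact: hcounit_one.
  + exact: hcounitM.
  + exact: hantipode_linear.
  + exact: hantipodel.
  + exact: hantipoder.
- split.
  + by move=> *; apply: filt_mul.
  + by move=> k r X FX; have := filt_coprod FX.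
  + by move=> k X [r FX]; apply: (filt_counit FX).
  + by move=> *; apply: filt_antipode.
- split.
  + exact: endo_linear.
  + by move=> k r X /filt_hd [].
  + by move=> r X /filt_hd [].
  + exact: hd_square.
  + by move=> i X Y [r FX]; rewrite hd_mul (filt_sigma FX) hmulZl.
  + exists hd2; split; [exact: hd2_signed|exact: hcoprod_hd].
Qed.

End Hopf.

Theorem theorem3 (K : fieldType) (h : lieAlgType K) (H : groupType)
    (A : H -> h -> h) (hA : lie_representation A) :
  exists (mul : hopf_space h H -> hopf_space h H -> hopf_space h H)
    (Delta : hopf_space h H -> tensor (hopf_space h H) (hopf_space h H))
    (eps : hopf_space h H -> K)
    (S : hopf_space h H -> hopf_space h H)
    (d : hopf_space h H -> hopf_space h H),
  [/\ (forall (p : H) (v : uea h), d (hpure p (v ⊗ 1)) = 0) /\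
      (forall (p : H) (v : uea h) (k : nat) (a : 'I_k.+1 -> h),
        d (hpure p (v ⊗ \prod_(l < k.+1) ext_gen (a l))) =
        hpure p
          (\sum_(i < k.+1) (-1) ^+ i *:
             ((uea_gen (A p^-1%g (a i)) * v) ⊗
              (\prod_(l < k.+1 | l != i) ext_gen (a l)))
           + \sum_(i < k.+1) \sum_(j < k.+1 | (i < j)%N) (-1) ^+ (i + j + 1) *:
             (v ⊗ (ext_gen (lie (a i) (a j)) *
                   \prod_(l < k.+1 | (l != i) && (l != j)) ext_gen (a l))))),
      forall (p : H) (v : uea h) (alpha : ext h),
        Delta (hpure p (v ⊗ alpha)) =
        tlift (fun v1 v2 => tlift (fun alpha1 alpha2 =>
            hpure p (v1 ⊗ alpha1) ⊗ hpure p (v2 ⊗ alpha2))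
          (ext_coprod alpha)) (uea_coprod v),
      forall (p : H) (v : uea h) (alpha : ext h),
        eps (hpure p (v ⊗ alpha)) = uea_counit v * ext_counit alpha,
      forall (p q : H) (v w : uea h) (alpha beta : ext h),
        mul (hpure p (v ⊗ alpha)) (hpure q (w ⊗ beta)) =
        hpure (p * q)%g
          (tlift (fun v1 v2 => (uea_map (A q^-1%g) v1 * w) ⊗
                               (alpha * ext_map (A p) (uea_act v2 beta)))
            (uea_coprod v)) &
      forall (p : H) (v : uea h) (alpha : ext h),
        S (hpure p (v ⊗ alpha)) =
        hpure p^-1%g
          (tlift (fun v1 v2 =>
              uea_map (A p) (uea_antipode v1) ⊗
              uea_act (uea_antipode v2)
                (ext_map (A p^-1%g) (ext_antipode alpha)))
            (uea_coprod v))]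
  /\ filtered_dg_hopf (hopf_filt h H) mul (hpure 1%g (1 ⊗ 1)) Delta eps S d.
Proof.
exists (hmul hA), (@hcoprod K h H), (@hcounit K h H), (hantipode hA), (hd hA).
split; last exact: hopf_structure.
split; [split|..].
(* Vanishing in degree 0 is the formula for an empty product, where both sums are empty. *)
- by move=> p v; have := hd_formula hA p v (fun _ : 'I_0 => 0);
    rewrite !big_ord0 addr0 linear0.
- by move=> p v k a; apply: hd_formula.
- exact: hcoprodE.
- exact: hcounitE.
- exact: hmul_formula.
- exact: hantipode_formula.
Qed.
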